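(* Consider the NPIV model, the sieve NPIV estimator $\widehat h$, and the quantities $\sigma_{JK}$, $P_nh_0$, $\widetilde B$, $S$, $\widehat S$ defined in the context, and let Assumptions 1, 2, 3 and 4 of the context hold. If $\sigma_{JK}>0$ then $$\|h_0-\widehat h\|_\infty\le \|h_0-P_nh_0\|_\infty+O_p\left(\sigma_{JK}^{-1}\sqrt{K(\log n)/n}\right)$$ provided $n,J,K\to\infty$ and (i) $J\le K$, $K\lesssim (n/\log n)^{\delta/(2+\delta)}$, and $\sigma_{JK}^{-1}\sqrt{K(\log n)/n}\lesssim 1$; (ii) $\sigma_{JK}^{-1}\left(\|(\widetilde B'\widetilde B/n)-I_K\|+\|\widehat S-S\|\right)=O_p(\sqrt{(\log n)/K})=o_p(1)$. Here $\delta>0$ is the constant in Assumption 2(iii).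
   Context: Notation. $\|\cdot\|$ is the Euclidean norm for vectors and the spectral norm for matrices; $\|\cdot\|_\infty$ is the sup norm; $A^-$ is the Moore-Penrose inverse; $a_n\lesssim b_n$ means $a_n\le Cb_n$ for some finite $C>0$ and all $n$ sufficiently large. $J=J(n)$, $K=K(n)$. Model. $Y_{1i}=h_0(Y_{2i})+\epsilon_i$, $E[\epsilon_i|X_i]=0$, with $Y_{1i}\in\mathbb R$, $Y_{2i}$ with support $\mathcal Y_2$, $X_i$ with support $\mathcal X$; the unknown function $h_0:\mathcal Y_2\to\mathbb R$ belongs to $\mathcal H\subset L^2(Y_2)$ and is assumed uniquely identified by the conditional moment restriction. The sample is $\{(X_i,Y_{1i},Y_{2i})\}_{i=1}^n$. Let $Z_i=(X_i,Y_{1i},Y_{2i})$ and $\mathcal F_{i-1}=\sigma(X_i,X_{i-1},\epsilon_{i-1},X_{i-2},\epsilon_{i-2},\ldots)$. Sieves and estimator. $\Psi_J\subset L^2(Y_2)$ and $B_K\subset L^2(X)$ are the linear spans of basis functions $\psi^J=(\psi_{J1},\dots,\psi_{JJ})'$ and $b^K=(b_{K1},\dots,b_{KK})'$, of dimensions $J$ and $K$, which become dense in $\mathcal H$ and $L^2(X)$ respectively as $J,K\to\infty$. Let $B=(b^K(X_1),\dots,b^K(X_n))'$, $\Psi=(\psi^J(Y_{21}),\dots,\psi^J(Y_{2n}))'$, $Y=(Y_{11},\dots,Y_{1n})'$. The sieve NPIV estimator is $$\widehat h(y_2)=\psi^J(y_2)'[\Psi'B(B'B)^-B'\Psi]^-\Psi'B(B'B)^-B'Y.$$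 Orthonormalized bases: $\widetilde b^K(x)=E[b^K(X)b^K(X)']^{-1/2}b^K(x)$, $\widetilde\psi^J(y_2)=E[\psi^J(Y_2)\psi^J(Y_2)']^{-1/2}\psi^J(y_2)$; $\widetilde B=(\widetilde b^K(X_1),\dots,\widetilde b^K(X_n))'$, $\widetilde\Psi=(\widetilde\psi^J(Y_{21}),\dots,\widetilde\psi^J(Y_{2n}))'$. The $J\times K$ matrices are $S=E[\widetilde\psi^J(Y_2)\widetilde b^K(X)']$ and $\widehat S=\widetilde\Psi'\widetilde B/n$; $\sigma_{JK}\ge 0$ is defined by $\sigma_{JK}^2=\lambda_{\min}(SS')$. With $H_0=(h_0(Y_{21}),\dots,h_0(Y_{2n}))'$, $$P_nh_0(y_2)=\widetilde\psi^J(y_2)'[\widehat S(\widetilde B'\widetilde B/n)^-\widehat S']^-\widehat S(\widetilde B'\widetilde B/n)^-\widetilde B'H_0/n.$$ Assumption 1. (i) $\{Z_i\}_{i=-\infty}^\infty$ is strictly stationary; (ii) $\mathcal X=[0,1]^d$ and $\mathcal Y_2=[0,1]^d$; (iii) the distributions of $X$ and $Y_2$ have Lebesgue densities uniformly bounded away from zero and infinity on $\mathcal X$ and $\mathcal Y_2$. Assumption 2. (i) $(\epsilon_i,\mathcal F_{i-1})_{i=-\infty}^\infty$ is a strictly stationary martingale difference sequence (in particular $E[\epsilon_i|\mathcal F_{i-1}]=0$); (ii) $E[\epsilon_i^2|\mathcal F_{i-1}]$ is uniformly bounded away from zero and infinity; (iii) $E[|\epsilon_i|^{2+\delta}]<\infty$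 for some $\delta>0$. Assumption 3. (i) The sieve basis $\psi^J(\cdot)$ is Hölder continuous with smoothness $\gamma>p$ (where $p>0$ denotes the smoothness of $h_0$) and $\sup_{y_2\in\mathcal Y_2}\|\psi^J(y_2)\|\lesssim\sqrt J$; (ii) $\lambda_{\min}(E[\psi^J(Y_2)\psi^J(Y_2)'])\ge\underline\lambda>0$ for all $J\ge1$. Assumption 4. (i) The sieve basis $b^K(\cdot)$ is Hölder continuous with smoothness $\gamma_x\ge\gamma>p$ and $\sup_{x\in\mathcal X}\|b^K(x)\|\lesssim\sqrt K$; (ii) $\lambda_{\min}(E[b^K(X)b^K(X)'])\ge\underline\lambda>0$ for all $K\ge1$.
   Formalization: In Assumption 3(i), the Hölder norms (smoothness γ) of the basis functions in ψ^J are also assumed to grow at most polynomially in J: a uniform bound contradicts Assumption 3(ii), and with arbitrary growth the claim fails (e.g. high-frequency Rademacher-type functions in the basis). *)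

(* Defs.v *)
From HB Require Import structures.
From mathcomp Require Import all_boot all_order all_algebra.
From mathcomp Require Import all_classical all_reals all_analysis.

Set Implicit Arguments.
Unset Strict Implicit.
Unset Printing Implicit Defensive.

Import Order.TTheory GRing.Theory Num.Theory.
Import numFieldNormedType.Exports.

Local Open Scope classical_set_scope.
Local Open Scope ring_scope.

(* Lebesgue measure on d.-tuple R, the measurable space used for R^d, as an
   iterated product measure. *)
Section lebesgue_tuple.
Context {R : realType}.

Definition cons_pair n (x : R * n.-tuple R) : n.+1.-tuple R :=
  [tuple of x.1 :: x.2].

Definition uncons n (t : n.+1.-tuple R) : R * n.-tuple R :=
  (thead t, [tuple of behead t]).

Lemma measurable_cons_pair n :
  @measurable_fun _ _ (measurableTypeR R * n.-tuple R)%type _ setT (@cons_pair n).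
Proof.
by apply: measurable_cons; [exact: measurable_fst|exact: measurable_snd].
Qed.

Lemma measurable_uncons n : measurable_fun [set: n.+1.-tuple R] (@uncons n).
Proof.
apply: measurable_fun_pair; first exact: measurable_tnth.
exact: measurable_behead.
Qed.

Section step.
Context n (mu : {sigma_finite_measure set (n.-tuple R) -> \bar R}).

Definition lebesgue_cons (A : set (n.+1.-tuple R)) : \bar R :=
  (lebesgue_measure \x mu)%E (@cons_pair n @^-1` A).

Lemma lebesgue_cons0 : lebesgue_cons set0 = 0%E.
Proof. by rewrite /lebesgue_cons preimage_set0 measure0. Qed.

Lemma lebesgue_cons_ge0 A : (0 <= lebesgue_cons A)%E.
Proof. exact: measure_ge0. Qed.

Lemma lebesgue_cons_sigma_additive : semi_sigma_additive lebesgue_cons.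
Proof.
move=> F mF tF mUF; rewrite /lebesgue_cons preimage_bigcup.
have mF' i : measurable (@cons_pair n @^-1` F i : set (measurableTypeR R * _)%type).
  by rewrite -[X in measurable X]setTI; exact: measurable_cons_pair.
apply: measure_semi_sigma_additive => //.
- apply/trivIsetP => /= i j _ _ ij; rewrite -preimage_setI.
  by move/trivIsetP : tF => /(_ i j I I ij) ->; rewrite preimage_set0.
- exact: bigcup_measurable.
Qed.

HB.instance Definition _ := isMeasure.Build _ _ _ lebesgue_cons
  lebesgue_cons0 lebesgue_cons_ge0 lebesgue_cons_sigma_additive.

Lemma lebesgue_cons_sigma_finite : sigma_finite setT lebesgue_cons.
Proof.
have /sigma_finiteP[F [TF ndF Foo]] := sigma_finiteT (@lebesgue_measure R).
have /sigma_finiteP[G [TG ndG Goo]] := sigma_finiteT mu.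
have consK : @uncons n \o @cons_pair n = id.
  by apply/funext => -[x t] /=; congr pair; exact/val_inj.
exists (fun k => @uncons n @^-1` (F k `*` G k)).
  rewrite -preimage_bigcup (_ : \bigcup_k _ = setT) ?preimage_setT//.
  rewrite -subTset => -[x y] _.
  have [k _ Fkx] : (\bigcup_i F i) x by rewrite -TF.
  have [l _ Gly] : (\bigcup_i G i) y by rewrite -TG.
  exists (maxn k l) => //; split => /=.
  - by move: x Fkx; exact/subsetPset/ndF/leq_maxl.
  - by move: y Gly; exact/subsetPset/ndG/leq_maxr.
move=> k; have [mF Fk] := Foo k; have [mG Gk] := Goo k; split.
  by rewrite -[X in measurable X]setTI; apply: measurable_uncons => //; exact: measurableX.
rewrite /lebesgue_cons -comp_preimage consK preimage_id.
by rewrite product_measure1E// lte_mul_pinfty// ge0_fin_numE.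
Qed.

HB.instance Definition _ :=
  Measure_isSigmaFinite.Build _ _ _ lebesgue_cons lebesgue_cons_sigma_finite.

End step.

Fixpoint lebesgue_tuple d : {sigma_finite_measure set (d.-tuple R) -> \bar R} :=
  match d return {sigma_finite_measure set (d.-tuple R) -> \bar R} with
  | 0 => \d_([tuple] : 0.-tuple R)
  | n.+1 => lebesgue_cons (lebesgue_tuple n)
  end.

End lebesgue_tuple.

Section matrices.
Context {R : realType}.

Definition enorm n (x : 'cV[R]_n) : R := Num.sqrt (\sum_i x i 0 ^+ 2).

Definition spectral_norm m n (A : 'M[R]_(m, n)) : R :=
  sup [set enorm (A *m x) | x in [set x : 'cV[R]_n | enorm x <= 1]].

(* the smallest eigenvalue of a real symmetric matrix of positive size *)
Definition lambda_min n (A : 'M[R]_n) : R := inf [set a | eigenvalue A a].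

Definition is_moore_penrose m n (A : 'M[R]_(m, n)) (G : 'M[R]_(n, m)) : Prop :=
  [/\ A *m G *m A = A, G *m A *m G = G,
      (A *m G)^T = A *m G & (G *m A)^T = G *m A].

Definition mpinv m n (A : 'M[R]_(m, n)) : 'M[R]_(n, m) :=
  xget 0 [set G | is_moore_penrose A G].

Definition is_psd n (A : 'M[R]_n) : Prop :=
  A^T = A /\ forall x : 'cV[R]_n, 0 <= (x^T *m A *m x) 0 0.

(* A^(-1/2) for a symmetric positive definite matrix A *)
Definition mxinvsqrt n (A : 'M[R]_n) : 'M[R]_n :=
  xget 0 [set G | is_psd G /\ G *m G = invmx A].

End matrices.

Section cube.
Context {R : realType} {d : nat}.
Implicit Types (x y : d.-tuple R) (f g : d.-tuple R -> R).

Definition eucl_dist x y : R := Num.sqrt (\sum_i (tnth x i - tnth y i) ^+ 2).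

Definition unit_cube : set (d.-tuple R) :=
  [set x | forall i, 0 <= tnth x i <= 1].

Definition open_unit_cube : set (d.-tuple R) :=
  [set x | forall i, 0 < tnth x i < 1].

Definition sup_norm f : \bar R := ereal_sup [set `|f x|%:E | x in unit_cube].

Definition set_coord x (i : 'I_d) (t : R) : d.-tuple R :=
  [tuple if j == i then t else tnth x j | j < d].

Definition is_partial (i : 'I_d) f g : Prop :=
  forall x, open_unit_cube x ->
    is_derive (tnth x i) 1 (fun t => f (set_coord x i t)) (g x).

Definition continuous_on_cube f : Prop :=
  forall x, unit_cube x -> forall e, 0 < e -> exists2 r, 0 < r &
    forall y, unit_cube y -> eucl_dist x y < r -> `|f x - f y| < e.

(* All partial derivatives of f of order at most m exist in the open cube and
   extend continuously to the closed cube, all are bounded by L, and those of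
   order m are alpha-Hoelder with constant L. *)
Fixpoint holder_rec (m : nat) (alpha L : R) f : Prop :=
  (forall x, unit_cube x -> `|f x| <= L) /\
  match m with
  | 0 => forall x y, unit_cube x -> unit_cube y ->
           `|f x - f y| <= L * eucl_dist x y `^ alpha
  | m'.+1 => continuous_on_cube f /\
      forall i, exists2 g, is_partial i f g & holder_rec m' alpha L g
  end.

(* Smoothness s is m + alpha with 0 < alpha <= 1: m is the largest integer
   strictly below s. *)
Definition holder (s L : R) f : Prop :=
  exists (m : nat) (alpha : R),
    [/\ 0 < alpha, alpha <= 1, s = m%:R + alpha & holder_rec m alpha L f].

End cube.

Section asymptotics.
Context {R : realType} {dT : measure_display} {T : measurableType dT}.
Context (P : probability T R).

Definition lesssim (a c : nat -> R) : Prop :=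
  exists2 C : R, 0 < C & \forall n \near \oo, a n <= C * c n.

(* The outer measure [mu_ext P] agrees with P on measurable events. *)
Definition is_Op (Z : nat -> T -> R) (r : nat -> R) : Prop :=
  forall eta : R, 0 < eta -> exists2 M : R, 0 < M &
    \forall n \near \oo, (mu_ext P [set w | (M * r n < `|Z n w|)%R] <= eta%:E)%E.

Definition is_op1 (Z : nat -> T -> R) : Prop :=
  forall e : R, 0 < e -> mu_ext P [set w | e < `|Z n w|] @[n --> \oo] --> 0%E.

End asymptotics.

Section probability.
Context {R : realType} {dT : measure_display} {T : measurableType dT}.
Context (P : probability T R).

(* V is a version of E[U | G] for a sub-sigma-algebra G *)
Definition is_cond_exp (G : set (set T)) (U V : T -> R) : Prop :=
  [/\ P.-integrable setT (EFin \o U), P.-integrable setT (EFin \o V),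
      forall B, measurable B -> G (V @^-1` B) &
      forall A, G A -> (\int[P]_(w in A) (U w)%:E = \int[P]_(w in A) (V w)%:E)%E].

(* The law of the whole path, on the product sigma-algebra, is shift
   invariant. *)
Definition strictly_stationary dS (S : measurableType dS) (Z : int -> T -> S) :
    Prop :=
  forall (h : int) (C : set (int -> S)),
    <<s [set D | exists (i : int) (A : set S),
                   measurable A /\ D = [set z : int -> S | A (z i)]] >> C ->
    P [set w | C (fun i => Z (i + h) w)] = P [set w | C (fun i => Z i w)].

Definition rv_support d (V : T -> d.-tuple R) : set (d.-tuple R) :=
  [set x | forall r : R, 0 < r -> (0 < P [set w | eucl_dist x (V w) < r]%R)%E].

(* V has a Lebesgue density on the cube, bounded away from 0 and infinity;
   taking A = setT shows that V lies in the cube almost surely. *)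
Definition has_bounded_density d (V : T -> d.-tuple R) : Prop :=
  exists (f : d.-tuple R -> R) (c C : R),
    [/\ measurable_fun setT f, 0 < c,
        forall x, unit_cube x -> c <= f x <= C &
        forall A, measurable A ->
          P (V @^-1` A) =
            (\int[lebesgue_tuple d]_(x in A `&` unit_cube) (f x)%:E)%E].

Definition expectation_mx m n (M : T -> 'M[R]_(m, n)) : 'M[R]_(m, n) :=
  \matrix_(i, j) fine 'E_P[fun w => M w i j].

End probability.

Section npiv.
Context {R : realType} {dT : measure_display} {T : measurableType dT}.
Context (P : probability T R) {d : nat}.
Context (X Y2 : int -> {RV P >-> d.-tuple R}) (Y1 eps : int -> {RV P >-> R}).
Context (H : set (d.-tuple R -> R)) (h0 : d.-tuple R -> R).
(* [psi J] is the vector of basis functions psi^J, [b K] the vector b^K. *)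
Context (psi b : forall m, d.-tuple R -> 'cV[R]_m).

Definition L2 (V : {RV P >-> d.-tuple R}) : set (d.-tuple R -> R) :=
  [set h | h \in Lfun (distribution P V) 2%:E].

Record npiv_model : Prop := {
  npiv_L2 : H `<=` L2 (Y2 0);
  npiv_h0 : H h0;
  npiv_eq : forall i w, Y1 i w = h0 (Y2 i w) + eps i w;
  npiv_exogenous : forall i,
    is_cond_exp P (g_sigma_algebra_preimage (X i)) (eps i) (cst 0);
  npiv_identified : forall h, H h ->
    is_cond_exp P (g_sigma_algebra_preimage (X 0))
      (fun w => Y1 0 w - h (Y2 0 w)) (cst 0) ->
    {ae distribution P (Y2 0), forall y, h y = h0 y} }.

(* Linear spans of f m contained in L^2(V), becoming dense in D as m grows. *)
Definition is_sieve (V : {RV P >-> d.-tuple R})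
    (f : forall m, d.-tuple R -> 'cV[R]_m) (D : set (d.-tuple R -> R)) : Prop :=
  (forall m j, L2 V (fun y => f m y j 0)) /\
  forall h, D h -> forall e, 0 < e -> \forall m \near \oo,
    exists c : 'cV[R]_m,
      ('N[distribution P V]_2%:E[EFin \o (fun y => h y - (c^T *m f m y) 0 0)%R] < e%:E)%E.

(* Population moments use the index 0 of the stationary process. *)
Definition gram m (V : T -> d.-tuple R) (f : d.-tuple R -> 'cV[R]_m) : 'M[R]_m :=
  expectation_mx P (fun w => f (V w) *m (f (V w))^T).

Definition psi_tilde J (y : d.-tuple R) : 'cV[R]_J :=
  mxinvsqrt (gram (Y2 0) (@psi J)) *m psi J y.

Definition b_tilde K (x : d.-tuple R) : 'cV[R]_K :=
  mxinvsqrt (gram (X 0) (@b K)) *m b K x.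

(* The n x m matrix with rows f(V_1)', ..., f(V_n)'. *)
Definition design n m (V : int -> T -> d.-tuple R) (f : d.-tuple R -> 'cV[R]_m)
    (w : T) : 'M[R]_(n, m) :=
  \matrix_(i < n, j < m) f (V (i.+1)%:Z w) j 0.

Definition Y_vec n (w : T) : 'cV[R]_n := \col_(i < n) Y1 (i.+1)%:Z w.

Definition H0_vec n (w : T) : 'cV[R]_n := \col_(i < n) h0 (Y2 (i.+1)%:Z w).

Definition h_hat n J K (w : T) (y : d.-tuple R) : R :=
  let B := design n X (@b K) w in
  let Psi := design n Y2 (@psi J) w in
  ((psi J y)^T
     *m mpinv (Psi^T *m B *m mpinv (B^T *m B) *m B^T *m Psi)
     *m Psi^T *m B *m mpinv (B^T *m B) *m B^T *m Y_vec n w) 0 0.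

Definition B_tilde n K (w : T) : 'M[R]_(n, K) := design n X (@b_tilde K) w.

Definition Psi_tilde n J (w : T) : 'M[R]_(n, J) := design n Y2 (@psi_tilde J) w.

Definition S_mx J K : 'M[R]_(J, K) :=
  expectation_mx P (fun w => psi_tilde J (Y2 0 w) *m (b_tilde K (X 0 w))^T).

Definition S_hat n J K (w : T) : 'M[R]_(J, K) :=
  n%:R^-1 *: ((Psi_tilde n J w)^T *m B_tilde n K w).

Definition G_hat n K (w : T) : 'M[R]_K :=
  n%:R^-1 *: ((B_tilde n K w)^T *m B_tilde n K w).

Definition sigma_JK J K : R :=
  Num.sqrt (lambda_min (S_mx J K *m (S_mx J K)^T)).

Definition Pn_h0 n J K (w : T) (y : d.-tuple R) : R :=
  let S := S_hat n J K w in
  let Ginv := mpinv (G_hat n K w) in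
  ((psi_tilde J y)^T *m mpinv (S *m Ginv *m S^T) *m S *m Ginv
     *m (n%:R^-1 *: ((B_tilde n K w)^T *m H0_vec n w))) 0 0.

Record assumption1 : Prop := {
  a1_stationary : strictly_stationary P (fun i w => (X i w, Y1 i w, Y2 i w));
  a1_support_X : rv_support P (X 0) = unit_cube;
  a1_support_Y2 : rv_support P (Y2 0) = unit_cube;
  a1_density_X : has_bounded_density P (X 0);
  a1_density_Y2 : has_bounded_density P (Y2 0) }.

(* sigma_field i is generated by X_{i+1}, X_i, eps_i, X_{i-1}, eps_{i-1}, ... *)
Definition sigma_field (i : int) : set (set T) :=
  <<s \bigcup_(j in [set j : int | j <= i])
        (g_sigma_algebra_preimage (X (j + 1)) `|`
         g_sigma_algebra_preimage (eps j)) >>.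

Record assumption2 (delta : R) : Prop := {
  a2_stationary : strictly_stationary P (fun i w => eps i w);
  a2_mds : forall i : int, is_cond_exp P (sigma_field (i - 1)) (eps i) (cst 0);
  a2_var : exists c C : R, 0 < c /\ forall i : int, exists2 V : T -> R,
    is_cond_exp P (sigma_field (i - 1)) (fun w => eps i w ^+ 2) V &
    {ae P, forall w, c <= V w <= C};
  a2_delta : 0 < delta;
  a2_moment : forall i, ('E_P[fun w => (`|eps i w| `^ (2 + delta))%R] < +oo)%E }.

(* The Hoelder norms of the psi_Jj cannot be bounded uniformly in J: that would
   contradict [a3_gram] by compactness. They grow at most polynomially in J, as
   for splines, wavelets and trigonometric bases. *)
Record assumption3 (p gamma lambda : R) : Prop := {
  a3_p : 0 < p;
  a3_h0 : exists L, holder p L h0;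
  a3_gamma : p < gamma;
  a3_holder : exists2 L : nat -> R,
    forall J j, holder gamma (L J) (fun y => psi J y j 0) &
    exists omega : R, lesssim L (fun J => J%:R `^ omega);
  a3_sup : exists2 C : R, 0 < C & \forall J \near \oo,
    (sup_norm (fun y => enorm (psi J y)) <= (C * Num.sqrt J%:R)%:E)%E;
  a3_lambda : 0 < lambda;
  a3_gram : forall J, (1 <= J)%N -> lambda <= lambda_min (gram (Y2 0) (@psi J)) }.

Record assumption4 (p gamma gamma_x lambda : R) : Prop := {
  a4_gamma : p < gamma;
  a4_gamma_x : gamma <= gamma_x;
  a4_holder : forall K k, exists L, holder gamma_x L (fun x => b K x k 0);
  a4_sup : exists2 C : R, 0 < C & \forall K \near \oo,
    (sup_norm (fun x => enorm (b K x)) <= (C * Num.sqrt K%:R)%:E)%E;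
  a4_lambda : 0 < lambda;
  a4_gram : forall K, (1 <= K)%N -> lambda <= lambda_min (gram (X 0) (@b K)) }.

End npiv.

(* Main.v *)
(* Let P, R be the inverse square roots of the Gram matrices. As sigma > 0, both are
   genuine and sigma <= 1. After whitening, the estimator minus P_n h0 is
   psi~(y)' Q u, where u = B~' eps / n and Q is the two-stage least squares operator
   of (S_hat, G_hat). Replacing (S_hat, G_hat) by (S, I) costs
   O(dev / sigma |psi~(y)| |u|), which is O_p(sigma^-1 sqrt (ln n / K) sqrt K sqrt (K / n)),
   i.e. of the order of the rate, because |u| = O_p(sqrt (K / n)) by the orthogonality
   of martingale differences. What remains is the linear form
   n^-1 sum_i g_y(X_i) eps_i with g_y = psi~(y)' (S S')^-1 S b~, of size at most
   K / sigma and with empirical second moment at most K / sigma^2 up to constants. For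
   fixed y, exp (sum_i min (l g eps_i, 1) - 3 C (l g)^2) is a supermartingale, which
   gives a Bernstein tail; the part of eps_i lost by truncation is controlled by the
   moment of order 2 + delta and the growth condition on K. Hoelder continuity of psi
   extends the bound from a grid of polynomially many points to the whole cube. *)
Require Import Defs.
From HB Require Import structures.
From mathcomp Require Import all_boot all_order all_algebra.
From mathcomp Require Import all_classical all_reals all_analysis.
From mathcomp Require Import measurable_realfun ring lra.

Set Implicit Arguments.
Unset Strict Implicit.
Unset Printing Implicit Defensive.

Import Order.TTheory GRing.Theory Num.Theory.
Import numFieldNormedType.Exports.

Local Open Scope classical_set_scope.
Local Open Scope ring_scope.

(** * Conditional expectations and martingale differences *)

(** No measurability of the suprema over y or of the spectral norms is established: probability
    enters through outer measures of finitely many bad events, and off them the bound is a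
    deterministic statement about one sample point, valid for all y at once. The growth condition on
    K is what the truncation needs. Write s for sigma and rho = sqrt (K ln n / n); with tilt l = s
    rho / K the terms l g eps_i can exceed 1 only for errors of order at least 1 / rho. Beyond that
    level they contribute at most the order of (K / s) rho^(1 + delta) times the empirical moment of
    order 2 + delta, hence rho / s as soon as K rho^delta stays bounded. A polynomial grid suffices
    because the oscillation of psi~ between neighbours only has to be bounded: it is multiplied by
    |u| / s, already within the rate. Finally, the bases are bounded on the cube only, and X_i lies
    there almost surely but not surely; the weights are therefore multiplied by the indicator of the
    cube in every martingale argument. *)

Section sub_sigma_algebra.
Context {R : realType} {dT : measure_display} {T : measurableType dT}.
Context (P : probability T R).
Implicit Types (G : set (set T)) (U W V : T -> R).

(** [G] is only a generating family: [g_sigma_algebraType G] carries [<<s G >>], so the general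
    lemmas on measurable functions apply to this coarser structure. *)
Definition sub_measurable G W :=
  @measurable_fun _ _ (g_sigma_algebraType G) R setT W.

Lemma sigma_algebra_measurable G : G `<=` measurable -> <<s G >> `<=` measurable.
Proof.
by move=> GT; apply: smallest_sub => //; exact: sigma_algebra_measurable.
Qed.

Lemma sub_measurableW G G' W : G `<=` <<s G' >> ->
  sub_measurable G W -> sub_measurable G' W.
Proof.
move=> GG' mW _ B mB; have := mW measurableT B mB; rewrite !setTI => GB.
have : <<s G >> `<=` <<s G' >>.
  by apply: smallest_sub => //; exact: smallest_sigma_algebra.
exact.
Qed.

Lemma sub_measurable_measurable G W : G `<=` measurable ->
  sub_measurable G W -> measurable_fun setT W.
Proof.
move=> GT mW _ B mB; apply: sigma_algebra_measurable GT _ _.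
exact: mW measurableT B mB.
Qed.

Lemma integrable_bounded_mul U W (B : R) :
  P.-integrable setT (EFin \o U) -> measurable_fun setT W ->
  (forall w, `|W w| <= B) -> P.-integrable setT (EFin \o (fun w => W w * U w)).
Proof.
move=> iU mW WB.
rewrite (_ : _ \o _ = (EFin \o W) \* (EFin \o U))%E; last exact/funext.
apply: integrableMr => //; exists B; split; first exact: num_real.
by move=> x Bx w _ /=; rewrite (le_trans (WB w))// ltW.
Qed.

Lemma integrable_bounded W (B : R) : measurable_fun setT W ->
  (forall w, `|W w| <= B) -> P.-integrable setT (EFin \o W).
Proof.
move=> mW WB; apply: measurable_bounded_integrable => //.
  by rewrite (le_lt_trans (probability_le1 _ _))// ltry.
by exists B; split; [exact: num_real|move=> x Bx w _ /=; rewrite (le_trans (WB w))// ltW].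
Qed.

Lemma integrable_mul_indic U A : measurable A ->
  P.-integrable setT (EFin \o U) ->
  P.-integrable setT (EFin \o (fun w => \1_A w * U w)).
Proof.
move=> mA iU; apply: (@integrable_bounded_mul _ _ 1) => //.
by move=> w; rewrite indicE; case: (_ \in _); rewrite /= ?normr1 ?normr0.
Qed.

Lemma Rintegral_mul_indic U A : measurable A ->
  \int[P]_w (\1_A w * U w) = \int[P]_(w in A) U w.
Proof.
move=> mA; rewrite [RHS]Rintegral_mkcond; apply: eq_Rintegral => w _.
by rewrite /patch indicE; case: (_ \in _); rewrite ?mul1r ?mul0r.
Qed.

Lemma integrable_Rsum I (s : seq I) (h : I -> T -> R) :
  (forall i, P.-integrable setT (EFin \o h i)) ->
  P.-integrable setT (EFin \o (fun w => \sum_(i <- s) h i w)).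
Proof.
move=> ih; rewrite (_ : _ \o _ = fun w => (\sum_(i <- s) (h i w)%:E)%E); last first.
  by apply/funext => w /=; rewrite -sumEFin.
by apply: integrable_sum => // i _; exact: ih.
Qed.

Lemma Rintegral_sum I (s : seq I) (h : I -> T -> R) :
  (forall i, P.-integrable setT (EFin \o h i)) ->
  \int[P]_w (\sum_(i <- s) h i w) = \sum_(i <- s) \int[P]_w (h i w).
Proof.
move=> ih; elim: s => [|i s IH].
  under eq_Rintegral do rewrite big_nil.
  by rewrite Rintegral_cst// mul0r big_nil.
under eq_Rintegral do rewrite big_cons.
by rewrite RintegralD// ?IH ?big_cons//; exact: integrable_Rsum.
Qed.

Lemma integrableZl_R (k : R) U : P.-integrable setT (EFin \o U) ->
  P.-integrable setT (EFin \o (fun w => k * U w)).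
Proof. by move=> iU; exact: (integrableZl measurableT k iU). Qed.

Lemma integrableD_R U W : P.-integrable setT (EFin \o U) ->
  P.-integrable setT (EFin \o W) ->
  P.-integrable setT (EFin \o (fun w => U w + W w)).
Proof. by move=> iU iW; exact: (integrableD measurableT iU iW). Qed.

Lemma integrableB_R U W : P.-integrable setT (EFin \o U) ->
  P.-integrable setT (EFin \o W) ->
  P.-integrable setT (EFin \o (fun w => U w - W w)).
Proof. by move=> iU iW; exact: (integrableB measurableT iU iW). Qed.

(** For x in [0, m] the sum counts the positive integers up to x, so it is the integer part of x.
    Applied to N W, this approximates W within 1 / N by an equally weighted sum of indicators of
    superlevel sets. *)
Lemma layer_cake_approx (m : nat) (x : R) : 0 <= x <= m%:R ->
  `|x - \sum_(k < m) ((k.+1%:R <= x)%R : nat)%:R| <= 1.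
Proof.
elim: m x => [|m IH] x /andP[x0 xm].
  by rewrite big_ord0 subr0 ger0_norm// (le_trans xm).
rewrite big_ord_recr/=; have [xm'|mx] := leP x m%:R.
  rewrite (_ : (m.+1%:R <= x) = false); last first.
    by apply/negbTE; rewrite -ltNge (le_lt_trans xm')// ltr_nat.
  by rewrite addr0 IH// x0.
rewrite (eq_bigr (fun=> 1)); last first.
  by move=> i _; rewrite (_ : _ <= _)// (le_trans _ (ltW mx))// ler_nat.
rewrite sumr_const card_ord -natr1 in xm *.
by rewrite ler_norml; case: (leP (m%:R + 1)) => ?; rewrite /=; lra.
Qed.

(** Conditional expectations are only known through integrals over sets of [<<s G >>]; approximating
    W uniformly by indicators of its superlevel sets carries a sign from sets to weights. The
    pull-out rules below all rest on this one. *)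
Lemma integral_mul_ge0 G U W (B : R) : G `<=` measurable ->
  P.-integrable setT (EFin \o U) ->
  (forall A, <<s G >> A -> 0 <= \int[P]_(w in A) U w) ->
  sub_measurable G W -> (forall w, 0 <= W w <= B) ->
  0 <= \int[P]_w (W w * U w).
Proof.
move=> GT iU U0 mW WB.
have mWT := sub_measurable_measurable GT mW.
have iWU : P.-integrable setT (EFin \o (fun w => W w * U w)).
  apply: (@integrable_bounded_mul _ _ B) => // w.
  by have /andP[W0 ?] := WB w; rewrite ger0_norm.
have iaU := integrable_norm iU.
apply/ler_addgt0Pr => e e0; rewrite -lerBlDr sub0r.
set I := \int[P]_w `|U w|.
have I0 : 0 <= I by apply: Rintegral_ge0.
have B0 : 0 <= B by have /andP[/le_trans h /h] := WB point.
(* The approximation error 1 / N, integrated against |U|, costs I / N; this choice brings it below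
   e. *)
pose N := (Num.truncn (I / e)).+1.
have Ie : I / N%:R <= e.
  rewrite ler_pdivrMr ?ltr0n// -ler_pdivrMl// mulrC.
  by rewrite ltW// /N truncnS_gt.
pose m := (Num.truncn (N%:R * B)).+1.
pose A k := W @^-1` [set x | k.+1%:R <= N%:R * x].
have sA k : <<s G >> (A k).
  rewrite -[A k]setTI; apply: mW => //.
  rewrite (_ : [set _ | _] = `[k.+1%:R / N%:R, +oo[%classic); first exact: measurable_itv.
  by apply/seteqP; split=> x /=; rewrite in_itv/= andbT ler_pdivrMr ?ltr0n// mulrC.
have mA k : measurable (A k) by exact: sigma_algebra_measurable GT _ _.
pose WN w := \sum_(k < m) N%:R^-1 * (\1_(A k) w * U w).
have iWN : P.-integrable setT (EFin \o WN).
  by apply: integrable_Rsum => k; apply: integrableZl_R; exact: integrable_mul_indic.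
have WN0 : 0 <= \int[P]_w WN w.
  rewrite Rintegral_sum; last first.
    by move=> k; apply: integrableZl_R; exact: integrable_mul_indic.
  apply: sumr_ge0 => k _; rewrite RintegralZl//; last exact: integrable_mul_indic.
  by rewrite mulr_ge0 ?invr_ge0// Rintegral_mul_indic// U0.
have : `|\int[P]_w (W w * U w) - \int[P]_w WN w| <= I / N%:R.
  rewrite -RintegralB//; apply: le_trans (le_normr_Rintegral _ _) _ => //.
    exact: integrableB_R.
  rewrite mulrC -RintegralZl//; apply: le_Rintegral => //.
  - by apply: integrable_norm; exact: integrableB_R.
  - exact: integrableZl_R.
  - move=> w _.
    rewrite /WN -mulr_sumr -mulr_suml mulrA -mulrBl normrM ler_wpM2r//.
    rewrite (_ : W w - _ =
        N%:R^-1 * (N%:R * W w - \sum_(i < m) ((i.+1%:R <= N%:R * W w)%R : nat)%:R)); last first.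
      rewrite mulrBr mulKf ?pnatr_eq0//; congr (_ - _ * _); apply: eq_bigr => i _.
      by rewrite indicE; congr (nat_of_bool _)%:R; apply/idP/idP; rewrite inE.
    rewrite normrM ger0_norm ?invr_ge0// ler_piMr ?invr_ge0//.
    apply: layer_cake_approx; have /andP[W0 W1] := WB w.
    rewrite mulr_ge0//= (le_trans (ler_wpM2l _ W1))//.
    by rewrite ltW// /m truncnS_gt.
rewrite ler_norml => /andP[h _]; lra.
Qed.

Lemma is_cond_exp0_integral G U A :
  is_cond_exp P (<<s G >>) U (cst 0) -> <<s G >> A -> \int[P]_(w in A) U w = 0.
Proof. by case=> _ _ _ h GA; rewrite /Rintegral h// integral0. Qed.

Lemma is_cond_exp0_mul G U W (B : R) : G `<=` measurable ->
  is_cond_exp P (<<s G >>) U (cst 0) ->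
  sub_measurable G W -> (forall w, `|W w| <= B) ->
  \int[P]_w (W w * U w) = 0.
Proof.
move=> GT EU mW WB; have [iU _ _ _] := EU.
have mWT := sub_measurable_measurable GT mW.
have iWU : P.-integrable setT (EFin \o (fun w => W w * U w)).
  exact: (@integrable_bounded_mul _ _ B).
have WB' : forall w, 0 <= W w + B <= B + B.
  by move=> w; have := WB w; rewrite ler_norml => /andP[? ?]; apply/andP; split; lra.
have mWB : sub_measurable G (fun w => W w + B).
  by apply: (@measurable_funD _ (g_sigma_algebraType G)) => //; exact: measurable_cst.
have U0 := is_cond_exp0_integral EU.
have UT : \int[P]_w U w = 0 by apply: U0; exact: (@measurableT _ (g_sigma_algebraType G)).
have E1 : \int[P]_w ((W w + B) * U w) = \int[P]_w (W w * U w).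
  under eq_Rintegral do rewrite mulrDl.
  by rewrite RintegralD//; [rewrite RintegralZl// UT mulr0 addr0|exact: integrableZl_R].
have h1 : 0 <= \int[P]_w ((W w + B) * U w).
  by apply: (integral_mul_ge0 GT iU _ mWB WB') => A GA; rewrite U0.
have iNU : P.-integrable setT (EFin \o (fun w => -1 * U w)) by exact: integrableZl_R.
have h2 : 0 <= \int[P]_w ((W w + B) * (-1 * U w)).
  apply: (integral_mul_ge0 GT iNU _ mWB WB') => A GA.
  rewrite RintegralZl ?U0 ?mulr0//; first exact: sigma_algebra_measurable GT _ GA.
  by apply: integrableS iU => //; exact: sigma_algebra_measurable GT _ GA.
move: h2; under eq_Rintegral do rewrite mulrCA.
rewrite RintegralZl//; last first.
  apply: (@integrable_bounded_mul _ _ (B + B)) => //.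
    exact: sub_measurable_measurable mWB.
  by move=> w; have /andP[? ?] := WB' w; rewrite ger0_norm.
rewrite E1 in h1 *; lra.
Qed.

(** The sign rule is applied to C - U, whose integral over a set of [<<s G >>] equals that of C -
    V. *)
Lemma is_cond_exp_mul_le G U V W (B C : R) : G `<=` measurable ->
  is_cond_exp P (<<s G >>) U V -> {ae P, forall w, V w <= C} ->
  sub_measurable G W -> (forall w, 0 <= W w <= B) ->
  \int[P]_w (W w * U w) <= C * \int[P]_w W w.
Proof.
move=> GT [iU iV _ EU] VC mW WB.
have mWT := sub_measurable_measurable GT mW.
have WB' w : `|W w| <= B by have /andP[? ?] := WB w; rewrite ger0_norm.
have iC : P.-integrable setT (EFin \o cst C) by exact: finite_measure_integrable_cst.
have iCU : P.-integrable setT (EFin \o (fun w => C - U w)) by exact: integrableB_R.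
have := @integral_mul_ge0 G _ _ B GT iCU _ mW WB.
under eq_Rintegral do rewrite mulrBr.
have iW := integrable_bounded mWT WB'.
have iWU := integrable_bounded_mul iU mWT WB'.
have iWC : P.-integrable setT (EFin \o (fun w => W w * C)).
  by under eq_fun do rewrite /= mulrC; exact: integrableZl_R.
rewrite RintegralB// RintegralZr// mulrC subr_ge0; apply=> A GA.
have mA := sigma_algebra_measurable GT GA.
have [iUA iVA iCA] : [/\ P.-integrable A (EFin \o U), P.-integrable A (EFin \o V) &
    P.-integrable A (EFin \o cst C)] by split; apply: (integrableS measurableT).
rewrite RintegralB// subr_ge0 {1}/Rintegral EU//.
(* [V <= C] holds almost everywhere only; the minimum with C leaves the integral unchanged and makes
   the comparison pointwise. *)
rewrite [leLHS](_ : _ = \int[P]_(w in A) Order.min (V w) C); last first.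
  rewrite /Rintegral; congr fine; apply: ae_eq_integral => //.
  - exact: (measurable_int P).
  - apply/measurable_EFinP/measurable_minr => //.
    exact/measurable_EFinP/(measurable_int P).
  - by apply: filterS VC => w Vw _; rewrite /= min_l.
have mV : measurable_fun A V by exact/measurable_EFinP/(measurable_int P).
apply: le_Rintegral => //; last by move=> w _; rewrite ge_min lexx orbT.
apply: (le_integrable mA _ _ (integrableD mA (integrable_abse iVA) (integrable_abse iCA))).
  by apply/measurable_EFinP/measurable_minr.
move=> w _ /=; rewrite lee_fin [leRHS]ger0_norm ?addr_ge0//.
by rewrite /Num.min; case: ifP => _; rewrite ?lerDl ?lerDr.
Qed.

Lemma sub_measurableM G U W : sub_measurable G U -> sub_measurable G W ->
  sub_measurable G (fun w => U w * W w).
Proof. exact: (@measurable_funM _ (g_sigma_algebraType G)). Qed.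

Lemma sub_measurableB G U W : sub_measurable G U -> sub_measurable G W ->
  sub_measurable G (fun w => U w - W w).
Proof. exact: (@measurable_funB _ (g_sigma_algebraType G)). Qed.

Lemma sub_measurableD G U W : sub_measurable G U -> sub_measurable G W ->
  sub_measurable G (fun w => U w + W w).
Proof. exact: (@measurable_funD _ (g_sigma_algebraType G)). Qed.

Lemma sub_measurable_comp G U (f : R -> R) : measurable_fun setT f ->
  sub_measurable G U -> sub_measurable G (f \o U).
Proof. by move=> mf mU; exact: measurableT_comp. Qed.

(** Serves the unbounded weights met in the square of a martingale. Cutting W to the events |W| <=
    m, which lie in [<<s G >>], reduces to bounded weights, and dominated convergence removes the
    cut. *)
Lemma is_cond_exp0_mul_integrable G U W : G `<=` measurable ->
  is_cond_exp P (<<s G >>) U (cst 0) -> sub_measurable G W ->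
  P.-integrable setT (EFin \o (fun w => W w * U w)) ->
  \int[P]_w (W w * U w) = 0.
Proof.
move=> GT EU mW iWU; have [iU _ _ _] := EU.
pose A m := [set w | `|W w| <= m%:R].
have sA m : <<s G >> (A m).
  have mA : measurable [set x : R | `|x| <= m%:R].
    rewrite (_ : [set _ | _] = `[- m%:R, m%:R]%classic); first exact: measurable_itv.
    by apply/seteqP; split=> x /=; rewrite in_itv/= ler_norml.
  by have := mW measurableT _ mA; rewrite setTI.
have mA m : measurable (A m) by exact: sigma_algebra_measurable GT _ (sA m).
pose Wm m w := \1_(A m) w * W w.
have mWm m : sub_measurable G (Wm m).
  apply: sub_measurableM => //.
  by apply: (@measurable_indic _ (g_sigma_algebraType G)); exact: sA.
have Wm0 m : \int[P]_w (Wm m w * U w) = 0.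
  apply: (@is_cond_exp0_mul G U _ m%:R) => // w.
  rewrite /Wm indicE; case: (boolP (w \in A m)) => [|_]; last by rewrite mul0r normr0.
  by rewrite inE mul1r.
have iWmU m : P.-integrable setT (EFin \o (fun w => Wm m w * U w)).
  under eq_fun do rewrite /= /Wm -mulrA.
  exact: integrable_mul_indic.
have [||_ _ cv] := @dominated_convergence _ _ _ P setT measurableT
  (fun m => EFin \o (fun w => Wm m w * U w)) (EFin \o (fun w => W w * U w))
  (EFin \o (fun w => `|W w * U w|)) (fun m => measurable_int P (iWmU m))
  (measurable_int P iWU) _ (integrable_norm iWU).
- apply: aeW => w _ /=; apply: cvg_near_cst.
  exists (Num.truncn `|W w|).+1 => // m /= Wwm; congr (_ * _)%:E.
  rewrite /Wm indicE mem_set ?mul1r//= /A/= (le_trans (ltW (truncnS_gt _)))//.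
  by rewrite ler_nat.
- apply: aeW => w m _ /=; rewrite lee_fin -!mulrA normrM ler_piMl//.
  by rewrite indicE; case: (_ \in _); rewrite ?normr0 ?normr1.
have : (\int[P]_w (W w * U w)%:E)%E = 0%E.
  apply: cvg_unique cv _ => //.
  apply: cvg_near_cst; apply: nearW => m /=.
  rewrite -[LHS]fineK; last exact: (integrable_fin_num measurableT (iWmU m)).
  by congr EFin; exact: Wm0.
by rewrite /Rintegral => ->.
Qed.

Lemma markov_Rintegral U (t : R) : 0 < t -> P.-integrable setT (EFin \o U) ->
  (forall w, 0 <= U w) ->
  (P [set w | (t <= U w)%R] <= ((\int[P]_w U w) / t)%:E)%E.
Proof.
move=> t0 iU U0.
have mU : measurable_fun setT U by exact/measurable_EFinP/(measurable_int P).
have mA : measurable [set w | t <= U w].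
  rewrite -[X in measurable X]setTI (_ : [set _ | _] = U @^-1` `[t, +oo[%classic).
    exact: mU.
  by apply/seteqP; split=> w /=; rewrite in_itv/= andbT.
rewrite mulrC EFinM muleC lee_pdivlMr// /Rintegral fineK ?integrable_fin_num//.
rewrite muleC -integral_cst//.
apply: (@le_trans _ _ (\int[P]_(w in [set w | (t <= U w)%R]) (U w)%:E)%E).
  apply: ge0_le_integral => //.
  - by move=> w _; rewrite lee_fin ltW.
  - by apply/measurable_EFinP; exact: measurable_funTS.
apply: ge0_subset_integral => //; first exact/measurable_EFinP.
by move=> w _; rewrite lee_fin.
Qed.

End sub_sigma_algebra.

Section martingale_differences.
Context {R : realType} {dT : measure_display} {T : measurableType dT}.
Context (P : probability T R).
Implicit Types (G : nat -> set (set T)) (e f : nat -> T -> R) (C B : R).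

(** Index convention: [e k] becomes known at time k + 1 and is centred given time k, so a weight
    multiplying [e k] must be known at time k. *)
Record is_mds (G : nat -> set (set T)) (e : nat -> T -> R) (C : R) : Prop := {
  mds_sub : forall k, G k `<=` measurable;
  mds_filtration : forall k, G k `<=` <<s G k.+1 >>;
  mds_adapted : forall k, sub_measurable (G k.+1) (e k);
  mds_mean : forall k, is_cond_exp P (<<s G k >>) (e k) (cst 0);
  mds_ge0 : 0 <= C;
  mds_var : forall k, exists2 V, is_cond_exp P (<<s G k >>) (fun w => e k w ^+ 2) V &
    {ae P, forall w, V w <= C} }.

Arguments mds_sub {G e C} _ k _ _.
Arguments mds_filtration {G e C} _ k _ _.
Arguments mds_adapted {G e C} _ k _ _ _.

Record predictable (G : nat -> set (set T)) (f : nat -> T -> R) (B : R) : Prop := {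
  pred_measurable : forall k, sub_measurable (G k) (f k);
  pred_bounded : forall k w, `|f k w| <= B }.

Arguments pred_measurable {G f B} _ k _ _ _.

(** Orthogonality by induction: the cross term is the new increment times a weight known at time n,
    unbounded because it contains the past sum. Integrability of the square is carried along to make
    that term integrable. *)
Lemma mds_second_moment G e C f B n : is_mds G e C -> predictable G f B ->
  P.-integrable setT (EFin \o (fun w => (\sum_(i < n) f i w * e i w) ^+ 2)) /\
  \int[P]_w ((\sum_(i < n) f i w * e i w) ^+ 2) <=
    C * \sum_(i < n) \int[P]_w (f i w ^+ 2).
Proof.
move=> Ge pf; pose M n w := \sum_(i < n) f i w * e i w.
have mM k : sub_measurable (G k) (M k).
  elim: k => [|k IH].
    by rewrite /M; under eq_fun do rewrite big_ord0; exact: measurable_cst.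
  rewrite (_ : M k.+1 = fun w => M k w + f k w * e k w); last first.
    by apply/funext => w; rewrite /M big_ord_recr.
  apply: sub_measurableD.
    exact: (sub_measurableW (mds_filtration Ge k) IH).
  apply: sub_measurableM; last exact: mds_adapted Ge k.
  exact: (sub_measurableW (mds_filtration Ge k) (pred_measurable pf k)).
elim: n => [|n [iM IH]].
  under eq_fun do rewrite big_ord0 expr0n.
  split; first exact: finite_measure_integrable_cst.
  by rewrite Rintegral_cst// big_ord0 mul0r mulr0.
have GT := mds_sub Ge n; have [V EV VC] := mds_var Ge n; have [ie2 _ _ _] := EV.
have B0 : 0 <= B by exact: le_trans (pred_bounded pf 0 point).
have f2B w : 0 <= f n w ^+ 2 <= B ^+ 2.
  by rewrite sqr_ge0 -real_normK ?num_real// ler_sqr ?nnegrE ?normr_ge0// (pred_bounded pf).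
have mf := pred_measurable pf n.
have mf2 : sub_measurable (G n) (fun w => f n w ^+ 2) by under eq_fun do rewrite expr2; exact: sub_measurableM.
have mf2T := sub_measurable_measurable GT mf2.
have if2e2 : P.-integrable setT (EFin \o (fun w => f n w ^+ 2 * e n w ^+ 2)).
  apply: (@integrable_bounded_mul _ _ _ P _ _ (B ^+ 2)) => // w.
  by have /andP[? ?] := f2B w; rewrite ger0_norm.
have me := sub_measurable_measurable (mds_sub Ge n.+1) (mds_adapted Ge n).
have mMf : sub_measurable (G n) (fun w => M n w * f n w) by exact: sub_measurableM.
have iMfe : P.-integrable setT (EFin \o (fun w => M n w * f n w * e n w)).
  apply: (le_integrable measurableT _ _ (integrableD_R iM if2e2)).
    by apply/measurable_EFinP/measurable_funM => //; exact: sub_measurable_measurable mMf.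
  (* M f e is dominated by M^2 + f^2 e^2, from the squares of M + f e and M - f e. *)
  move=> w _ /=; rewrite lee_fin [leRHS]ger0_norm; last by rewrite addr_ge0 ?sqr_ge0// -exprMn sqr_ge0.
  rewrite -/(M n w) ler_norml; apply/andP; split.
    have := sqr_ge0 (M n w + f n w * e n w); have := sqr_ge0 (M n w); have := sqr_ge0 (f n w * e n w); nra.
  have := sqr_ge0 (M n w - f n w * e n w); have := sqr_ge0 (M n w); have := sqr_ge0 (f n w * e n w); nra.
have cross := is_cond_exp0_mul_integrable GT (mds_mean Ge n) mMf iMfe.
have ME w : (\sum_(i < n.+1) f i w * e i w) ^+ 2 =
    (\sum_(i < n) f i w * e i w) ^+ 2 + (2 * (M n w * f n w * e n w) + f n w ^+ 2 * e n w ^+ 2).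
  rewrite big_ord_recr/= -/(M n w); ring.
have i2 : P.-integrable setT (EFin \o (fun w => 2 * (M n w * f n w * e n w) + f n w ^+ 2 * e n w ^+ 2)).
  by apply: integrableD_R => //; exact: integrableZl_R.
under eq_fun do rewrite ME.
split; first exact: integrableD_R.
rewrite RintegralD// RintegralD//; last exact: integrableZl_R.
rewrite RintegralZl// cross mulr0 add0r big_ord_recr/= mulrDr lerD//.
exact: (is_cond_exp_mul_le GT EV VC mf2 f2B).
Qed.

(* Only the upper tail of u is truncated and the bound is linear in the untruncated
   u, whose conditional mean vanishes: no recentering is needed. *)
Lemma expR_min1_le (u : R) : expR (Order.min u 1) <= 1 + u + 3 * u ^+ 2.
Proof.
have inv (v : R) : v < 1 -> expR v <= (1 - v)^-1.
  move=> v1; rewrite -[expR v]invrK lef_pV2 ?posrE ?invr_gt0 ?expR_gt0 ?subr_gt0//.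
  by rewrite -expRN expR_ge1Dx.
have small (v : R) : v <= 1 -> expR v <= 1 + v + 3 * v ^+ 2.
  move=> v1; have [v0|v0] := leP v 0.
    rewrite (le_trans (inv v _)) ?(le_lt_trans v0)//.
    rewrite -div1r ler_pdivrMr; nra.
  (* The bound 1 / (1 - v), which comes from exp (-v) >= 1 - v, explodes at 1; applied twice to v /
     2 it stays below the polynomial on (0, 1]. *)
  have -> : v = v / 2 + v / 2 by field.
  rewrite expRD; apply: (@le_trans _ _ ((1 - v / 2)^-1 * (1 - v / 2)^-1)).
    by rewrite ler_pM ?expR_ge0// inv//; lra.
  rewrite -invfM -div1r ler_pdivrMr; nra.
rewrite /Order.min; case: ltP => [u1|u1]; first by rewrite small// ltW.
by rewrite (le_trans (small 1 _))//; nra.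
Qed.

(** Given time n, the factor exp (min (f e, 1)) has mean at most 1 + 3 C f^2 by [expR_min1_le] and
    the centring of e; this is at most exp (3 C f^2), which the compensator removes. *)
Lemma mds_exp_supermartingale G e C f B n : is_mds G e C -> predictable G f B ->
  P.-integrable setT (EFin \o (fun w =>
    expR (\sum_(i < n) (Order.min (f i w * e i w) 1 - 3 * C * f i w ^+ 2)))) /\
  \int[P]_w expR (\sum_(i < n) (Order.min (f i w * e i w) 1 - 3 * C * f i w ^+ 2)) <= 1.
Proof.
move=> Ge pf.
pose S n w := \sum_(i < n) (Order.min (f i w * e i w) 1 - 3 * C * f i w ^+ 2).
have C0 := mds_ge0 Ge.
(* Each summand is at most 1, the compensator being nonnegative, so all the exponentials are bounded
   and hence integrable: this is what the truncation buys. *)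
have Sn k w : S k w <= k%:R.
  rewrite /S [leRHS](_ : _ = \sum_(i < k) 1); last by rewrite sumr_const card_ord.
  apply: ler_sum.
  move=> i _; rewrite lerBlDr (le_trans (_ : _ <= 1)) ?ge_min ?lexx ?orbT//.
  by rewrite lerDl; apply: mulr_ge0; rewrite ?sqr_ge0// mulr_ge0.
have mq k : sub_measurable (G k) (fun w => 3 * C * f k w ^+ 2).
  apply: sub_measurableM; first exact: measurable_cst.
  by under eq_fun do rewrite expr2; apply: sub_measurableM; exact: pred_measurable pf _.
have mS k : sub_measurable (G k) (S k).
  elim: k => [|k IH].
    by rewrite /S; under eq_fun do rewrite big_ord0; exact: measurable_cst.
  rewrite (_ : S k.+1 = fun w =>
      S k w + (Order.min (f k w * e k w) 1 - 3 * C * f k w ^+ 2)); last first.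
    by apply/funext => w; rewrite /S big_ord_recr.
  apply: sub_measurableD.
    exact: (sub_measurableW (mds_filtration Ge k) IH).
  apply: sub_measurableB; last exact: (sub_measurableW (mds_filtration Ge k) (mq k)).
  apply: (@measurable_minr _ (g_sigma_algebraType (G k.+1))); last exact: measurable_cst.
  apply: sub_measurableM; last exact: mds_adapted Ge k.
  exact: (sub_measurableW (mds_filtration Ge k) (pred_measurable pf k)).
have iS k : P.-integrable setT (EFin \o (expR \o S k)).
  apply: (@integrable_bounded _ _ _ P _ (expR k%:R)); last first.
    by move=> w; rewrite /= ger0_norm ?expR_ge0// ler_expR.
  by apply: measurableT_comp => //; exact: sub_measurable_measurable (mds_sub Ge k) (mS k).
split; first exact: iS n.
elim: n => [|n IH].
  under eq_Rintegral do rewrite big_ord0 expR0.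
  by rewrite Rintegral_cst// mul1r [X in fine X]probability_setT.
apply: le_trans IH.
have GT := mds_sub Ge n; have [V EV VC] := mds_var Ge n; have [ie2 _ _ _] := EV.
have [ie _ _ _] := mds_mean Ge n.
(* W gathers all that is known at time n, including the compensator of the new term. *)
pose W w := expR (S n w - 3 * C * f n w ^+ 2).
have mW : sub_measurable (G n) W.
  by apply: sub_measurable_comp => //; exact: sub_measurableB.
have WB w : 0 <= W w <= expR n%:R.
  by rewrite expR_ge0 ler_expR lerBlDr (le_trans (Sn n w))// lerDl mulr_ge0 ?sqr_ge0// mulr_ge0.
have mf := pred_measurable pf n.
have B0 : 0 <= B by exact: le_trans (pred_bounded pf 0 point).
have f2B w : 0 <= f n w ^+ 2 <= B ^+ 2.
  by rewrite sqr_ge0 -real_normK ?num_real// ler_sqr ?nnegrE ?normr_ge0// (pred_bounded pf).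
have mWf : sub_measurable (G n) (fun w => W w * f n w) by exact: sub_measurableM.
have WfB w : `|W w * f n w| <= expR n%:R * B.
  by have /andP[? ?] := WB w; rewrite normrM ler_pM ?(pred_bounded pf)// ger0_norm.
have mWf2 : sub_measurable (G n) (fun w => W w * f n w ^+ 2).
  apply: sub_measurableM => //; under eq_fun do rewrite expr2; exact: sub_measurableM.
have Wf2B w : 0 <= W w * f n w ^+ 2 <= expR n%:R * B ^+ 2.
  have /andP[? ?] := WB w; have /andP[? ?] := f2B w.
  by rewrite mulr_ge0//= ler_pM.
have mT := sub_measurable_measurable GT.
have i1 : P.-integrable setT (EFin \o W).
  by apply: (@integrable_bounded _ _ _ P _ (expR n%:R)) => [|w]; [exact: mT|have /andP[? ?] := WB w; rewrite ger0_norm].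
have i2 : P.-integrable setT (EFin \o (fun w => W w * f n w * e n w)).
  by apply: (integrable_bounded_mul ie _ WfB); exact: mT.
have Wf2B' w : `|W w * f n w ^+ 2| <= expR n%:R * B ^+ 2.
  by have /andP[? ?] := Wf2B w; rewrite ger0_norm.
have i3 : P.-integrable setT (EFin \o (fun w => W w * f n w ^+ 2 * e n w ^+ 2)).
  by apply: (integrable_bounded_mul ie2 _ Wf2B'); exact: mT.
have i4 : P.-integrable setT (EFin \o (fun w => W w * f n w ^+ 2)).
  exact: (@integrable_bounded _ _ _ P _ _ (mT _ _ mWf2) Wf2B').
apply: (@le_trans _ _ (\int[P]_w (W w + (W w * f n w * e n w + 3 * (W w * f n w ^+ 2 * e n w ^+ 2))))).
  apply: le_Rintegral => //; first exact: iS n.+1.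
    by do 2 (apply: integrableD_R => //); exact: integrableZl_R.
  move=> w _; rewrite big_ord_recr/= -/(S n w) addrCA addrC expRD.
  rewrite [X in _ <= X](_ : _ = W w * (1 + f n w * e n w + 3 * (f n w * e n w) ^+ 2)); last by ring.
  by rewrite -/(W w) ler_wpM2l ?expR_ge0 ?expR_min1_le.
rewrite RintegralD//; last by apply: integrableD_R => //; exact: integrableZl_R.
rewrite RintegralD//; last exact: integrableZl_R.
rewrite (is_cond_exp0_mul GT (mds_mean Ge n) mWf WfB) add0r RintegralZl//.
apply: (@le_trans _ _ (\int[P]_w W w + 3 * (C * \int[P]_w (W w * f n w ^+ 2)))).
  by rewrite lerD2l ler_wpM2l// (is_cond_exp_mul_le GT EV VC mWf2 Wf2B).
rewrite mulrA -RintegralZl// -RintegralD//; last exact: integrableZl_R.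
apply: le_Rintegral => //; last 2 first.
- exact: iS n.
- move=> w _; rewrite [X in X <= _](_ : _ = W w * (1 + 3 * C * f n w ^+ 2)); last by ring.
  by rewrite -/(S n w) -[S n w](subrK (3 * C * f n w ^+ 2)) expRD ler_wpM2l ?expR_ge0// expR_ge1Dx.
by apply: integrableD_R => //; exact: integrableZl_R.
Qed.

Lemma mds_exp_tail G e C f B n (x : R) : is_mds G e C -> predictable G f B ->
  (P [set w | (x <= \sum_(i < n) (Order.min (f i w * e i w) 1 - 3 * C * f i w ^+ 2))%R]
    <= (expR (- x))%:E)%E.
Proof.
move=> Ge pf; have [iS S1] := mds_exp_supermartingale n Ge pf.
have := markov_Rintegral (expR_gt0 x) iS (fun=> expR_ge0 _).
under eq_set do rewrite ler_expR.
move=> /le_trans; apply; rewrite lee_fin expRN ler_pdivrMr ?expR_gt0// mulVf//.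
by rewrite gt_eqF ?expR_gt0.
Qed.

End martingale_differences.
Arguments mds_sub {R dT T P G e C} _ k _ _.
Arguments pred_measurable {R dT T G f B} _ k _ _ _.

(** * Matrices and least squares *)

Section euclidean.
Context {R : realType}.

Definition dotv n (x y : 'cV[R]_n) : R := (x^T *m y) 0 0.

Lemma dotvE n (x y : 'cV[R]_n) : dotv x y = \sum_i x i 0 * y i 0.
Proof. by rewrite /dotv mxE; apply: eq_bigr => i _; rewrite mxE. Qed.

Lemma dotvC n (x y : 'cV[R]_n) : dotv x y = dotv y x.
Proof. by rewrite !dotvE; apply: eq_bigr => i _; rewrite mulrC. Qed.

Lemma dotvDr n (x y z : 'cV[R]_n) : dotv x (y + z) = dotv x y + dotv x z.
Proof. by rewrite /dotv mulmxDr mxE. Qed.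

Lemma dotvDl n (x y z : 'cV[R]_n) : dotv (x + y) z = dotv x z + dotv y z.
Proof. by rewrite !(dotvC _ z) dotvDr. Qed.

Lemma dotvZr n (x y : 'cV[R]_n) a : dotv x (a *: y) = a * dotv x y.
Proof. by rewrite /dotv -scalemxAr mxE. Qed.

Lemma dotvZl n (x y : 'cV[R]_n) a : dotv (a *: x) y = a * dotv x y.
Proof. by rewrite !(dotvC _ y) dotvZr. Qed.

Lemma dotvNr n (x y : 'cV[R]_n) : dotv x (- y) = - dotv x y.
Proof. by rewrite -scaleN1r dotvZr mulN1r. Qed.

Lemma dotvNl n (x y : 'cV[R]_n) : dotv (- x) y = - dotv x y.
Proof. by rewrite !(dotvC _ y) dotvNr. Qed.

Lemma dotvBr n (x y z : 'cV[R]_n) : dotv x (y - z) = dotv x y - dotv x z.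
Proof. by rewrite dotvDr dotvNr. Qed.

Lemma dotvBl n (x y z : 'cV[R]_n) : dotv (x - y) z = dotv x z - dotv y z.
Proof. by rewrite dotvDl dotvNl. Qed.

Lemma dotv0r n (x : 'cV[R]_n) : dotv x 0 = 0.
Proof. by rewrite /dotv mulmx0 mxE. Qed.

Lemma dotv_mulmxr m n (A : 'M[R]_(m, n)) x y : dotv x (A *m y) = dotv (A^T *m x) y.
Proof. by rewrite /dotv trmx_mul trmxK mulmxA. Qed.

Lemma dotv_mulmxl m n (A : 'M[R]_(m, n)) x y : dotv (A *m y) x = dotv y (A^T *m x).
Proof. by rewrite dotvC dotv_mulmxr dotvC. Qed.

Lemma dotv_ge0 n (x : 'cV[R]_n) : 0 <= dotv x x.
Proof. by rewrite dotvE sumr_ge0// => i _; rewrite -expr2 sqr_ge0. Qed.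

Lemma dotv_eq0 n (x : 'cV[R]_n) : dotv x x = 0 -> x = 0.
Proof.
rewrite dotvE => /eqP; rewrite psumr_eq0; last by move=> i _; rewrite -expr2 sqr_ge0.
move=> /allP x0; apply/colP => i; rewrite mxE.
by have := x0 i (mem_index_enum _); rewrite /= mulf_eq0 orbb => /eqP.
Qed.

Lemma enormE n (x : 'cV[R]_n) : enorm x = Num.sqrt (dotv x x).
Proof. by rewrite /enorm dotvE; congr Num.sqrt; apply: eq_bigr => i _; rewrite expr2. Qed.

Lemma enorm_sqr n (x : 'cV[R]_n) : enorm x ^+ 2 = dotv x x.
Proof. by rewrite enormE sqr_sqrtr ?dotv_ge0. Qed.

Lemma enorm_ge0 n (x : 'cV[R]_n) : 0 <= enorm x.
Proof. exact: sqrtr_ge0. Qed.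
Hint Resolve enorm_ge0 : core.

Lemma enorm0_eq0 n (x : 'cV[R]_n) : enorm x = 0 -> x = 0.
Proof. by move=> x0; apply: dotv_eq0; rewrite -enorm_sqr x0 expr0n. Qed.

Lemma enorm0 n : enorm (0 : 'cV[R]_n) = 0.
Proof. by rewrite enormE dotv0r sqrtr0. Qed.

Lemma enormZ n a (x : 'cV[R]_n) : enorm (a *: x) = `|a| * enorm x.
Proof. by rewrite !enormE dotvZr dotvZl mulrA -expr2 sqrtrM ?sqr_ge0// sqrtr_sqr. Qed.

Lemma enormN n (x : 'cV[R]_n) : enorm (- x) = enorm x.
Proof. by rewrite -scaleN1r enormZ normrN1 mul1r. Qed.

Lemma dotv_le n (x y : 'cV[R]_n) : `|dotv x y| <= enorm x * enorm y.
Proof.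
rewrite -(@ler_pXn2r _ 2) ?nnegrE ?mulr_ge0// exprMn !enorm_sqr real_normK ?num_real//.
have [y0|yn0] := eqVneq (dotv y y) 0.
  by rewrite (dotv_eq0 y0) !dotv0r expr0n mulr0.
have ygt0 : 0 < dotv y y by rewrite lt_def yn0 dotv_ge0.
have := dotv_ge0 (dotv y y *: x - dotv x y *: y).
rewrite dotvBr !dotvBl !dotvZr !dotvZl (dotvC y x) => h.
rewrite -(ler_pM2l ygt0) -subr_ge0; apply: le_trans h _.
by rewrite le_eqVlt; apply/orP; left; apply/eqP; ring.
Qed.

Lemma dotv_le_norm n (x y : 'cV[R]_n) : dotv x y <= enorm x * enorm y.
Proof. exact: le_trans (ler_norm _) (dotv_le x y). Qed.

Lemma enormD n (x y : 'cV[R]_n) : enorm (x + y) <= enorm x + enorm y.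
Proof.
rewrite -(@ler_pXn2r _ 2) ?nnegrE ?addr_ge0// enorm_sqr dotvDr !dotvDl (dotvC y x).
by rewrite sqrrD !enorm_sqr; have := dotv_le_norm x y; nra.
Qed.

Lemma enormB n (x y : 'cV[R]_n) : enorm (x - y) <= enorm x + enorm y.
Proof. by rewrite -(enormN y) enormD. Qed.

Lemma enormD_orth n (x y : 'cV[R]_n) : dotv x y = 0 ->
  enorm (x + y) ^+ 2 = enorm x ^+ 2 + enorm y ^+ 2.
Proof.
by move=> xy; rewrite !enorm_sqr dotvDl !dotvDr (dotvC y x) xy addr0 add0r.
Qed.

Lemma coord_le_enorm n (x : 'cV[R]_n) i : `|x i 0| <= enorm x.
Proof.
rewrite -(@ler_pXn2r _ 2) ?nnegrE// real_normK ?num_real// enorm_sqr dotvE.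
by rewrite (bigD1 i)//= -expr2 lerDl sumr_ge0// => j _; rewrite -expr2 sqr_ge0.
Qed.

Lemma enorm_le_sum n (x : 'cV[R]_n) (M : R) : (forall i, `|x i 0| <= M) ->
  enorm x <= Num.sqrt n%:R * M.
Proof.
case: n x => [|n] x xM.
  by rewrite enormE dotvE big_ord0 sqrtr0 mul0r.
have M0 : 0 <= M by exact: le_trans (xM ord0).
rewrite -(@ler_pXn2r _ 2) ?nnegrE ?mulr_ge0 ?sqrtr_ge0// enorm_sqr dotvE exprMn.
rewrite sqr_sqrtr ?ler0n// mulr_natl -[in leRHS](card_ord n.+1) -sumr_const.
by apply: ler_sum => i _; rewrite -expr2 -real_normK ?num_real// ler_sqr ?nnegrE.
Qed.

(** [sup] bounds its set only when the set is nonempty and bounded above; the bound comes from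
    Cauchy-Schwarz on each row. *)
Lemma spectral_norm_has_sup m n (A : 'M[R]_(m, n)) :
  has_sup [set enorm (A *m x) | x in [set x : 'cV[R]_n | enorm x <= 1]].
Proof.
split; first by exists (enorm (A *m 0)), 0 => //=; rewrite enorm0.
exists (Num.sqrt m%:R * \sum_i enorm (row i A)^T) => _ [x /= x1 <-].
apply: enorm_le_sum => i.
have -> : (A *m x) i 0 = dotv (row i A)^T x by rewrite /dotv trmxK !mxE; apply: eq_bigr => j _; rewrite mxE.
rewrite (le_trans (dotv_le _ _))// (le_trans (ler_piMr _ x1))//.
by rewrite (bigD1 i)//= lerDl sumr_ge0.
Qed.

Lemma enorm_mulmx_le m n (A : 'M[R]_(m, n)) x :
  enorm (A *m x) <= spectral_norm A * enorm x.
Proof.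
have [x0|xn0] := eqVneq (enorm x) 0.
  by rewrite (enorm0_eq0 x0) mulmx0 !enorm0 mulr0.
have x0 : 0 < enorm x by rewrite lt_def xn0 enorm_ge0.
rewrite -ler_pdivrMr// (_ : _ / _ = enorm (A *m ((enorm x)^-1 *: x))); last first.
  by rewrite -scalemxAr enormZ ger0_norm ?invr_ge0// mulrC.
apply: ub_le_sup; first by have [] := spectral_norm_has_sup A.
by exists ((enorm x)^-1 *: x) => //=; rewrite enormZ ger0_norm ?invr_ge0// mulVf.
Qed.

Lemma spectral_norm_ge0 m n (A : 'M[R]_(m, n)) : 0 <= spectral_norm A.
Proof.
apply: (le_trans (enorm_ge0 (A *m 0))); apply: ub_le_sup.
  by have [] := spectral_norm_has_sup A.
by exists 0 => //=; rewrite enorm0.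
Qed.

(** Pairing A^T x with itself: |A^T x|^2 = x . A (A^T x) <= |x| |A| |A^T x|. *)
Lemma enorm_trmx_mulmx_le m n (A : 'M[R]_(m, n)) x :
  enorm (A^T *m x) <= spectral_norm A * enorm x.
Proof.
have [z|nz] := eqVneq (enorm (A^T *m x)) 0.
  by rewrite z mulr_ge0// spectral_norm_ge0.
have gt0 : 0 < enorm (A^T *m x) by rewrite lt_def nz enorm_ge0.
rewrite -(ler_pM2l gt0) -expr2 enorm_sqr -dotv_mulmxr mulmxA.
rewrite (le_trans (dotv_le_norm _ _))// mulrC -mulmxA.
rewrite mulrA ler_wpM2r// mulrC; exact: enorm_mulmx_le.
Qed.

Lemma unitmx_of_ker n (A : 'M[R]_n) : (forall x : 'cV_n, A *m x = 0 -> x = 0) ->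
  A \in unitmx.
Proof.
move=> A0; rewrite -unitmx_tr -row_free_unit; apply: inj_row_free => v vA.
by rewrite -[v]trmxK (A0 v^T) ?trmx0// -[A]trmxK -trmx_mul vA trmx0.
Qed.

Lemma continuous_sum (V : topologicalType) I (s : seq I) (h : I -> V -> R) :
  (forall i, continuous (h i)) -> continuous (fun v => \sum_(i <- s) h i v).
Proof.
move=> ch; elim: s => [|i s IH] v.
  by under eq_fun do rewrite big_nil; exact: cvg_cst.
rewrite (_ : (fun v => _) = (fun v => h i v + \sum_(i <- s) h i v)); last first.
  by apply/funext => ?; rewrite big_cons.
exact: (cvgD (ch i v) (IH v)).
Qed.

(* The minimum of the quadratic form on the sphere is attained at an eigenvector. *)
Lemma lambda_min_rayleigh n (A : 'M[R]_n) x : A^T = A ->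
  lambda_min A * enorm x ^+ 2 <= dotv x (A *m x).
Proof.
move=> Asym; rewrite enorm_sqr.
have [->|xn0] := eqVneq x 0; first by rewrite mulmx0 !dotv0r mulr0.
pose q (v : 'rV[R]_n) := dotv v^T (A *m v^T).
pose sph := [set v : 'rV[R]_n | dotv v^T v^T = 1].
have coordE (B : 'M[R]_n) : continuous (fun v : 'rV[R]_n => dotv v^T (B *m v^T)).
  rewrite (_ : (fun v : 'rV[R]_n => _) =
      (fun v => \sum_i v 0 i * \sum_j B i j * v 0 j)); last first.
    apply/funext => v; rewrite dotvE; apply: eq_bigr => i _; rewrite !mxE.
    by congr (_ * _); apply: eq_bigr => j _; rewrite mxE.
  have cB i : continuous (fun v : 'rV[R]_n => \sum_j B i j * v 0 j).
    apply: continuous_sum => j v.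
    exact: (cvgM (cvg_cst (B i j)) (@coord_continuous R 1 n 0 j v)).
  by apply: continuous_sum => i v; exact: (cvgM (@coord_continuous R 1 n 0 i v) (cB i v)).
have xx0 : 0 < dotv x x.
  by rewrite lt_def dotv_ge0 andbT; apply: contra_neq xn0; exact: dotv_eq0.
pose nx (y : 'cV[R]_n) := ((enorm y)^-1 *: y)^T.
have nxE y : y != 0 -> sph (nx y).
  move=> yn0; have y0 : dotv y y != 0 by apply: contra_neq yn0; exact: dotv_eq0.
  rewrite /sph /nx /= trmxK dotvZr dotvZl mulrA -invfM -expr2 enorm_sqr mulVf//.
have [] := @EVT_min_rV R n q sph.
- by exists (nx x); exact: nxE.
- apply: bounded_closed_compact.
    exists 1; split; first exact: num_real.
    move=> M M1 v; rewrite /sph /= => v1; rewrite (le_trans _ (ltW M1))//.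
    rewrite /Num.Def.normr/= mx_normrE; apply: bigmax_le => // -[i j] _ /=.
    rewrite ord1 (_ : v 0 j = v^T j 0); last by rewrite mxE.
    by rewrite (le_trans (coord_le_enorm _ _))// enormE v1 sqrtr1.
  rewrite (_ : sph = (fun v : 'rV[R]_n => dotv v^T (1%:M *m v^T)) @^-1` [set 1]).
    by apply: preimage_closed; [move=> v _; exact: coordE|exact: closed_eq].
  by apply/seteqP; split=> v /=; rewrite mul1mx.
- by apply: continuous_subspaceT; exact: coordE.
move=> v0 /[!inE] v0s v0min; set mu := q v0.
have rayl y : mu * dotv y y <= dotv y (A *m y).
  have [->|yn0] := eqVneq y 0; first by rewrite mulmx0 !dotv0r mulr0.
  have yy0 : 0 < dotv y y.
    by rewrite lt_def dotv_ge0 andbT; apply: contra_neq yn0; exact: dotv_eq0.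
  have := v0min _ (mem_set (nxE y yn0)); rewrite /q /nx trmxK -scalemxAr dotvZr dotvZl.
  by rewrite mulrA -invfM -expr2 enorm_sqr mulrC -ler_pdivlMr// mulrC.
have eigmu : eigenvalue A mu.
  apply/eigenvalueP; exists v0; last first.
    by apply: contra_eq_neq v0s => ->; rewrite trmx0 dotv0r eq_sym oner_eq0.
  pose B := A - mu%:M.
  have Bq y : 0 <= dotv y (B *m y).
    by rewrite mulmxBl mul_scalar_mx dotvBr dotvZr subr_ge0.
  have B0 : dotv v0^T (B *m v0^T) = 0.
    by rewrite mulmxBl mul_scalar_mx dotvBr dotvZr v0s mulr1 subrr.
  have Bs : B^T = B by rewrite /B linearB/= Asym tr_scalar_mx.
  have : B *m v0^T = 0.
    apply: dotv_eq0; set z := B *m v0^T.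
    apply/eqP; rewrite eq_le dotv_ge0 andbT leNgt; apply/negP => z0.
    have c0 : 0 <= dotv z (B *m z) by exact: Bq.
    (* The form of B vanishes at v0. Moving to v0 - t z would change it by -2 t |z|^2 + t^2 z . B z,
       negative for this t; the + 1 keeps the denominator positive. *)
    pose t := dotv z z / (dotv z (B *m z) + 1).
    have t0 : 0 < t by rewrite divr_gt0// ltr_wpDl.
    have := Bq (v0^T - t *: z).
    rewrite mulmxBr -scalemxAr !(dotvBr, dotvBl, dotvZr, dotvZl) B0.
    rewrite -/z (dotv_mulmxr B v0^T z) Bs -/z => h.
    have : t * dotv z (B *m z) < dotv z z.
      by rewrite /t mulrAC ltr_pdivrMr ?ltr_wpDl// ltr_pM2l// ltrDl.
    nra.
  move/(congr1 trmx); rewrite trmx0 trmx_mul Bs trmxK /B mulmxBr mul_mx_scalar.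
  by move/eqP; rewrite subr_eq0 => /eqP.
(* [lambda_min] is an infimum: it lies below the eigenvalue mu only once the spectrum is known to be
   bounded below, here by mu itself. *)
have lbd : has_lbound [set a | eigenvalue A a].
  exists mu => a /= /eigenvalueP[v vA vn0].
  have vT0 : v^T != 0 by apply: contra_neq vn0 => /(congr1 trmx); rewrite trmxK trmx0.
  have vv0 : 0 < dotv v^T v^T.
    by rewrite lt_def dotv_ge0 andbT; apply: contra_neq vT0; exact: dotv_eq0.
  have := rayl v^T; rewrite -[A in A *m _]Asym -trmx_mul vA linearZ/= dotvZr.
  by rewrite ler_pM2r.
by rewrite (le_trans _ (rayl x))// ler_pM2r// ge_inf.
Qed.

(** The square root of a negative number is 0, so [0 < s] is what makes s^2 equal to
    [lambda_min (S *m S^T)]; the rest is the Rayleigh bound. *)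
Lemma least_singular_value m n (S : 'M[R]_(m, n)) (s := Num.sqrt (lambda_min (S *m S^T)) : R) x :
  0 < s -> s * enorm x <= enorm (S^T *m x).
Proof.
move=> s0; rewrite -(@ler_pXn2r _ 2) ?nnegrE ?mulr_ge0 ?(ltW s0)// exprMn.
rewrite [s ^+ 2]sqr_sqrtr; last by rewrite ltW// -sqrtr_gt0.
rewrite [leRHS]enorm_sqr dotv_mulmxl trmxK mulmxA.
by apply: lambda_min_rayleigh; rewrite trmx_mul trmxK.
Qed.

Lemma psd_unitmx n (A : 'M[R]_n) (a : R) : 0 < a ->
  (forall x, a * enorm x ^+ 2 <= dotv x (A *m x)) -> A \in unitmx.
Proof.
move=> a0 Aa; apply: unitmx_of_ker => x Ax; apply: enorm0_eq0.
have := Aa x; rewrite Ax dotv0r pmulr_rle0// => x2.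
by apply/eqP; rewrite -sqrf_eq0 eq_le x2 sqr_ge0.
Qed.

(** On an invertible matrix the first Penrose identity already forces the inverse, whichever witness
    [xget] returns; the inverse itself shows that a witness exists. *)
Lemma mpinv_unit n (A : 'M[R]_n) : A \in unitmx -> mpinv A = invmx A.
Proof.
move=> uA; rewrite /mpinv; case: xgetP => [G _ [AGA _ _ _]|/(_ (invmx A))[]].
  have : invmx A *m (A *m G *m A) *m invmx A = invmx A by rewrite AGA mulVmx// mul1mx.
  by rewrite -!mulmxA mulmxV// mulmx1 mulKmx.
by split; rewrite ?mulmxV// ?mulVmx// ?mul1mx// trmx1.
Qed.

(** Nonvanishing excludes the default value of [xget]. From G G = A^-1 follows G (G A) = 1, and a
    one-sided inverse of a square matrix is two-sided; the norm bound reads a |G x|^2 <= G x . A G x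
    = |x|^2. *)
Lemma mxinvsqrt_whitening n (A : 'M[R]_n) (a : R) : A^T = A -> 0 < a ->
  a <= lambda_min A -> mxinvsqrt A != 0 ->
  [/\ (mxinvsqrt A)^T = mxinvsqrt A,
      mxinvsqrt A *m A *m mxinvsqrt A = 1%:M &
      forall x, enorm (mxinvsqrt A *m x) <= (Num.sqrt a)^-1 * enorm x].
Proof.
move=> As a0 aA; set r := mxinvsqrt A; rewrite /r /mxinvsqrt.
case: xgetP => [G _ [[Gs _] GG]|]; last by rewrite eqxx.
move=> _.
have Aq x : a * enorm x ^+ 2 <= dotv x (A *m x).
  by rewrite (le_trans _ (lambda_min_rayleigh x As))// ler_wpM2r ?sqr_ge0.
have uA := psd_unitmx a0 Aq.
have GAG : G *m A *m G = 1%:M.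
  have : G *m (G *m A) = 1%:M by rewrite mulmxA GG mulVmx.
  by move/mulmx1C.
split=> // x; rewrite -(@ler_pXn2r _ 2) ?nnegrE ?mulr_ge0 ?invr_ge0 ?sqrtr_ge0//.
rewrite (_ : (_ * _) ^+ 2 = a^-1 * enorm x ^+ 2); last first.
  by rewrite exprMn exprVn sqr_sqrtr// ltW.
rewrite ler_pdivlMl//.
apply: le_trans (Aq _) _.
by rewrite dotv_mulmxl Gs mulmxA mulmxA GAG mul1mx enorm_sqr.
Qed.

(** * Least squares and its perturbation *)

Section least_squares.
Context (J K : nat) (S : 'M[R]_(J, K)) (s : R).
Context (s0 : 0 < s).
Context (Ss : forall x, s * enorm x <= enorm (S^T *m x)).

Lemma gram_unit : S *m S^T \in unitmx.
Proof.
apply: (@psd_unitmx _ _ (s ^+ 2)) => [|x]; first by rewrite exprn_gt0.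
by rewrite -mulmxA dotv_mulmxr -enorm_sqr -exprMn ler_pXn2r ?nnegrE ?Ss// mulr_ge0// ltW.
Qed.

(** [a] is the least squares coefficient of u on the columns of S^T; the residual is orthogonal to
    the fit, and Pythagoras bounds both by u. *)
Lemma lstsq_residual (u : 'cV_K) (a := invmx (S *m S^T) *m S *m u) :
  enorm (u - S^T *m a) <= enorm u /\ enorm a <= s^-1 * enorm u.
Proof.
set r := u - S^T *m a.
have Sr : S *m r = 0.
  by rewrite mulmxBr /a !mulmxA mulmxV ?gram_unit// mul1mx subrr.
have uE : enorm u ^+ 2 = enorm r ^+ 2 + enorm (S^T *m a) ^+ 2.
  set b := S^T *m a.
  have rb : dotv r b = 0 by rewrite dotv_mulmxr trmxK Sr dotvC dotv0r.
  by rewrite -enormD_orth// /r subrK.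
split.
  by rewrite -(@ler_pXn2r _ 2) ?nnegrE// uE lerDl sqr_ge0.
rewrite ler_pdivlMl// (le_trans (Ss a))//.
by rewrite -(@ler_pXn2r _ 2) ?nnegrE// uE lerDr sqr_ge0.
Qed.

(** c is the adjoint of the least squares operator applied to v, so |c|^2 is v paired with the least
    squares coefficient of c, whose norm is at most |c| / s. *)
Lemma lstsq_dual (v : 'cV_J) (c := S^T *m (invmx (S *m S^T))^T *m v) :
  enorm c <= s^-1 * enorm v.
Proof.
have [_] := lstsq_residual c.
have [z|nz] := eqVneq (enorm c) 0.
  by rewrite z mulr_ge0// invr_ge0 ltW.
have gt0 : 0 < enorm c by rewrite lt_def nz enorm_ge0.
move=> h; rewrite -(ler_pM2r gt0) -expr2 enorm_sqr {1}/c.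
rewrite dotv_mulmxl trmx_mul !trmxK (le_trans (dotv_le_norm _ _))//.
by rewrite (mulrC s^-1) -mulrA ler_wpM2l.
Qed.

Context (S' : 'M[R]_(J, K)) (G : 'M[R]_K) (h : R).
Context (hs : h <= s / 8).
Context (s1 : s <= 1).
Context (DS : forall x, enorm ((S' - S)^T *m x) <= h * enorm x).
Context (DG : forall x, enorm ((G - 1%:M) *m x) <= h * enorm x).

Let h8 : h <= 1 / 8. Proof. by have := hs; have := s1; lra. Qed.

Lemma near1_unit : G \in unitmx.
Proof.
apply: unitmx_of_ker => x Gx; apply: enorm0_eq0.
have h8' := h8; have := DG x; rewrite mulmxBl Gx sub0r mul1mx enormN => xh.
by apply/eqP; rewrite eq_le enorm_ge0 andbT; have := enorm_ge0 x; nra.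
Qed.

(** With q = G^-1 t one has q - t = -(G - 1) q, of norm at most h |q| <= |q| / 8. The third bound is
    coercivity of G^-1, obtained without symmetry of G. *)
Lemma near1_inv t :
  [/\ enorm (invmx G *m t) <= 2 * enorm t,
      enorm (invmx G *m t - t) <= 2 * h * enorm t &
      enorm t ^+ 2 <= 2 * dotv t (invmx G *m t)].
Proof.
set q := invmx G *m t.
have qt : q - t = - ((G - 1%:M) *m q).
  by rewrite mulmxBl mul1mx /q mulKVmx ?near1_unit// opprB.
have h1 : enorm (q - t) <= h * enorm q by rewrite qt enormN DG.
have q0 := enorm_ge0 q; have t0 := enorm_ge0 t; have qt0 := enorm_ge0 (q - t).
have h2 : enorm q <= enorm t + enorm (q - t) by rewrite -{1}(subrK t q) addrC enormD.
have h8' := h8; have hq : h * enorm q <= 1 / 8 * enorm q by rewrite ler_wpM2r.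
have h3 : enorm q <= 2 * enorm t by lra.
have h0 : 0 <= h * enorm q by exact: le_trans h1.
have h4 : enorm (q - t) <= 2 * h * enorm t.
  (* A negative h forces q = 0 and hence t = 0. *)
  have [|hn] := leP 0 h; first by nra.
  have -> : enorm t = 0.
    have q00 : enorm q = 0 by nra.
    by apply/eqP; rewrite eq_le t0 andbT -(subKr q t) (le_trans (enormB _ _))// q00; nra.
  by nra.
split=> //.
rewrite (_ : q = t + (q - t)); last by rewrite addrC subrK.
rewrite dotvDr -enorm_sqr.
have := dotv_le t (q - t); rewrite ler_norml => /andP[+ _].
nra.
Qed.

Context (h0 : 0 <= h).

Lemma pert_lower x : s / 2 * enorm x <= enorm (S'^T *m x).
Proof.
have := Ss x; have := DS x; have x0 := enorm_ge0 x.
have := ler_wpM2r x0 hs; have : 0 <= s * enorm x by rewrite mulr_ge0// ltW.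
have : enorm (S^T *m x) <= enorm (S'^T *m x) + enorm ((S' - S)^T *m x).
  rewrite (_ : S^T *m x = S'^T *m x - (S' - S)^T *m x) ?enormB//.
  by rewrite linearB/= mulmxBl subKr.
lra.
Qed.

(** With z = S'^T x the quadratic form is z . G^-1 z >= |z|^2 / 2, and |z| >= (s / 2) |x|; whence
    the coercivity constant s^2 / 8. *)
Lemma pert_unit : S' *m invmx G *m S'^T \in unitmx.
Proof.
apply: (@psd_unitmx _ _ (s ^+ 2 / 8)) => [|x]; first by rewrite divr_gt0// exprn_gt0.
rewrite -mulmxA -mulmxA dotv_mulmxr.
have [_ _] := near1_inv (S'^T *m x); have := pert_lower x.
have := enorm_ge0 x; have := enorm_ge0 (S'^T *m x).
set a := enorm _; set b := enorm x; set c := dotv _ _ => a0 b0 ab ac.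
have : (s / 2 * b) ^+ 2 <= a ^+ 2 by rewrite ler_pXn2r ?nnegrE// mulr_ge0// divr_ge0// ltW.
lra.
Qed.

(* Put r := u - S^T a0, M := S' G^-1 S'^T. As S r = 0, the difference d of the two
   solutions satisfies M d = (S' - S) r + S' (G^-1 - 1) r - S' G^-1 (S' - S)^T a0;
   pair this with d and use d^T M d >= |S'^T d|^2 / 2 and |S'^T d| >= (s/2) |d|. *)
Lemma lstsq_perturbation (u : 'cV_K) :
  enorm (invmx (S' *m invmx G *m S'^T) *m (S' *m invmx G) *m u -
         invmx (S *m S^T) *m S *m u) <= 24 * (h / s ^+ 2) * enorm u.
Proof.
set a := invmx (S' *m _ *m _) *m _ *m u; set a0 := invmx (S *m _) *m _ *m u.
have [ru a0u] := lstsq_residual u; rewrite -/a0 in ru a0u.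
set r := u - S^T *m a0 in ru.
have Sr : S *m r = 0.
  by rewrite mulmxBr /a0 !mulmxA mulmxV ?gram_unit// mul1mx subrr.
clearbody a0; set d := a - a0; set z := S'^T *m d.
have Md : S' *m invmx G *m S'^T *m d = S' *m invmx G *m (r - (S' - S)^T *m a0).
  rewrite /d mulmxBr {1}/a !mulmxA mulmxV ?pert_unit// mul1mx.
  rewrite -[_ *m _ *m S'^T *m a0]mulmxA -mulmxBr [(S' - S)^T](linearB trmx) mulmxBl /r.
  by rewrite opprB addrA subrK.
have dM : dotv z (invmx G *m z) = dotv ((S' - S)^T *m d) r +
    dotv z (invmx G *m r - r) - dotv z (invmx G *m ((S' - S)^T *m a0)).
  rewrite {1}/z -dotv_mulmxr /z !mulmxA Md mulmxBr dotvBr.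
  rewrite -[S' *m _ *m r]mulmxA -[S' *m _ *m (_ *m a0)]mulmxA !(dotv_mulmxr S').
  rewrite !mulmxA; congr (_ - _).
  rewrite [(S' - S)^T](linearB trmx) mulmxBl dotvBl.
  by rewrite [dotv (S^T *m d) r]dotv_mulmxl trmxK Sr dotv0r subr0 (dotvBr (S'^T *m d) (invmx G *m r)); ring.
have [_ _ zz] := near1_inv z; have [_ rr _] := near1_inv r.
have [pa _ _] := near1_inv ((S' - S)^T *m a0).
have zd := pert_lower d; rewrite -/z in zd.
have e1 := dotv_le_norm ((S' - S)^T *m d) r.
have e2 := dotv_le_norm z (invmx G *m r - r).
have e3 := dotv_le z (invmx G *m ((S' - S)^T *m a0)).
rewrite ler_norml in e3; have /andP[e3' _] := e3.
have f1 := DS d; have f3 := DS a0.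
have U0 := enorm_ge0 u.
set U := enorm u in ru a0u U0 *; set D := enorm d in f1 zd *.
set Z := enorm z in zd zz e2 e3' *.
have Z0 : 0 <= Z := enorm_ge0 z.
have D0 : 0 <= D := enorm_ge0 d.
have g1 : dotv ((S' - S)^T *m d) r <= h * D * U.
  by apply: le_trans e1 _; apply: ler_pM.
have g2 : dotv z (invmx G *m r - r) <= Z * (2 * h * U).
  apply: le_trans e2 _; apply: ler_wpM2l => //; apply: le_trans rr _.
  by apply: ler_wpM2l => //; rewrite mulr_ge0.
have g3 : - dotv z (invmx G *m ((S' - S)^T *m a0)) <= Z * (2 * (h * (s^-1 * U))).
  rewrite lerNl; apply: le_trans e3'; rewrite lerN2; apply: ler_wpM2l => //.
  apply: le_trans pa _; apply: ler_wpM2l => //; apply: le_trans f3 _.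
  exact: ler_wpM2l.
have Ds : D <= 2 * (s^-1 * Z).
  rewrite mulrA -(ler_pM2l s0) (_ : s * (2 * s^-1 * Z) = 2 * Z); last by field; rewrite gt_eqF.
  by lra.
have si : 1 <= s^-1 by rewrite invf_ge1.
set i := s^-1 in si g3 Ds.
have hU : 0 <= h * U by rewrite mulr_ge0.
(* Each of the three terms of [dM] is at most 2 i Z (h U), by 1 <= i for the middle one. Coercivity
   doubles their sum to 12, and [Ds] doubles once more to the final 24. *)
have ZZ : Z * Z <= Z * (12 * (i * (h * U))).
  have q1 : h * D * U <= 2 * (i * Z) * (h * U).
    by rewrite (_ : h * D * U = D * (h * U)); [apply: ler_wpM2r|ring].
  have q2 : Z * (h * U) <= i * (Z * (h * U)) by rewrite ler_peMl// mulr_ge0.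
  rewrite expr2 in zz; nra.
have Zle : Z <= 12 * (i * (h * U)).
  have [Zp|] := ltP 0 Z; first by rewrite -(ler_pM2l Zp).
  by move=> /le_trans; apply; rewrite mulr_ge0// mulr_ge0// (le_trans _ si).
apply: le_trans Ds _.
rewrite (_ : 24 * (h / s ^+ 2) * U = 2 * (i * (12 * (i * (h * U))))); last first.
  by rewrite /i; field; rewrite gt_eqF.
by rewrite ler_pM2l// ler_wpM2l// (le_trans _ si).
Qed.

End least_squares.

(** Two-stage least squares is equivariant under invertible changes of both bases. Invertibility of
    the whitened G and M passes to each factor of these products, so the Moore-Penrose inverses of
    the raw formula are true inverses and the basis matrices cancel. *)
Lemma tsls_change_of_basis J K (Pm : 'M[R]_J) (Rm : 'M[R]_K) (A0 : 'M[R]_(J, K))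
    (D : 'M[R]_K) (c : R) (S' := c *: (Pm *m A0 *m Rm)) (G := c *: (Rm *m D *m Rm))
    (M := S' *m invmx G *m S'^T) (v : 'cV[R]_J) (t : 'cV[R]_K) :
  c != 0 -> Pm^T = Pm -> Rm^T = Rm -> G \in unitmx -> M \in unitmx ->
  v^T *m mpinv (A0 *m mpinv D *m A0^T) *m A0 *m mpinv D *m t =
  (Pm *m v)^T *m (invmx M *m (S' *m invmx G) *m (c *: (Rm *m t))).
Proof.
move=> c0 Ps Rs uG uM.
have uc : c \is a GRing.unit by rewrite unitfE.
have uRDR : Rm *m D *m Rm \in unitmx by move: uG; rewrite /G unitmxZ.
have [uR uD] : Rm \in unitmx /\ D \in unitmx.
  by move: uRDR; rewrite !unitmx_mul => /andP[/andP[-> ->]].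
have uiR : invmx Rm \in unitmx by rewrite unitmx_inv.
have uiD : invmx D \in unitmx by rewrite unitmx_inv.
have GV : invmx G = c^-1 *: (invmx Rm *m invmx D *m invmx Rm).
  have GH : G *m (c^-1 *: (invmx Rm *m invmx D *m invmx Rm)) = 1%:M.
    rewrite /G -scalemxAl -scalemxAr scalerA mulfV// scale1r !mulmxA.
    by rewrite mulmxK// mulmxK// mulmxV.
  by rewrite -[LHS]mulmx1 -GH mulKmx.
have SG : S' *m invmx G = Pm *m A0 *m invmx D *m invmx Rm.
  by rewrite GV /S' -scalemxAl -scalemxAr scalerA mulfV// scale1r !mulmxA mulmxK.
pose N := A0 *m invmx D *m A0^T.
have NE : A0 *m invmx D *m A0^T = N by [].
have ME : M = c *: (Pm *m N *m Pm).
  rewrite /M SG /S' linearZ/= !trmx_mul Ps Rs -scalemxAr !mulmxA mulmxKV//.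
have [uP uN] : Pm \in unitmx /\ N \in unitmx.
  by move: uM; rewrite ME unitmxZ// !unitmx_mul => /andP[/andP[-> ->]].
clearbody N.
have MV : invmx M *m Pm = c^-1 *: (invmx Pm *m invmx N).
  have MH : M *m (c^-1 *: (invmx Pm *m invmx N)) = Pm.
    rewrite ME -scalemxAl -scalemxAr scalerA mulfV// scale1r !mulmxA.
    by rewrite mulmxK// mulmxK.
  by rewrite -{1}MH mulKmx.
rewrite (mpinv_unit uD) NE (mpinv_unit uN) trmx_mul Ps SG !mulmxA.
rewrite -!scalemxAr -[_ *m Pm *m invmx M *m Pm]mulmxA MV -scalemxAr -!scalemxAl scalerA.
by rewrite mulfV// scale1r !mulmxA mulmxK// mulmxKV.
Qed.

End euclidean.
#[global] Hint Resolve enorm_ge0 : core.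

(** * Hoelder moduli and grids *)

Section holder_modulus.
Context {R : realType} {d : nat}.
Implicit Types (x y : d.-tuple R) (f : d.-tuple R -> R).

Lemma set_coord_set x i (s t : R) : set_coord (set_coord x i s) i t = set_coord x i t.
Proof. by apply: eq_from_tnth => j; rewrite !tnth_mktuple; case: eqP. Qed.

Lemma set_coord_open x i (t : R) : open_unit_cube x -> 0 < t < 1 ->
  open_unit_cube (set_coord x i t).
Proof. by move=> xo t01 j; rewrite tnth_mktuple; case: eqP. Qed.

(** Mean value theorem along one coordinate line, inside the open cube where [is_partial] provides
    derivatives. *)
Lemma partial_le f g (L : R) x i (t : R) : is_partial i f g ->
  (forall z, unit_cube z -> `|g z| <= L) -> open_unit_cube x -> 0 < t < 1 ->
  `|f (set_coord x i t) - f x| <= L * `|t - tnth x i|.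
Proof.
move=> fg gL xo t01.
pose F s := f (set_coord x i s).
have dF (s : R) : 0 < s < 1 -> is_derive s 1 F (g (set_coord x i s)).
  move=> s01; have := fg _ (set_coord_open i xo s01).
  rewrite tnth_mktuple eqxx; congr is_derive; apply/funext => r.
  by rewrite set_coord_set.
have xE : set_coord x i (tnth x i) = x.
  by apply: eq_from_tnth => j; rewrite tnth_mktuple; case: eqP => [->|].
have main (a b : R) : 0 < a < 1 -> 0 < b < 1 -> a <= b -> `|F b - F a| <= L * `|b - a|.
  move=> /andP[a0 a1] /andP[b0 b1] ab.
  have inab s : s \in `[a, b] -> 0 < s < 1.
    by rewrite in_itv/= => /andP[sa sb]; rewrite (lt_le_trans a0)//= (le_lt_trans sb).
  have [c cab ->] : exists2 c, c \in `[a, b] &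
      F b - F a = g (set_coord x i c) * (b - a).
    apply: (@MVT_segment R F (fun s => g (set_coord x i s))) => //.
      by move=> s /subset_itv_oo_cc sab; exact: dF (inab _ sab).
    apply: derivable_within_continuous => s sab.
    by have [] := dF _ (inab _ sab).
  rewrite normrM ler_wpM2r// gL// => j.
  have /andP[c0 c1] := inab _ cab.
  by have /andP[? ?] := set_coord_open i xo (inab _ cab) j; rewrite !ltW.
rewrite -[in f x]xE -/(F t) -/(F _).
have [tx|xt] := leP t (tnth x i).
  by rewrite distrC [X in L * X]distrC; apply: main.
by apply: main => //; exact: ltW.
Qed.

(** x is turned into y one coordinate at a time: [z k] has the first k coordinates of y, and all
    these points stay in the open cube. *)
Lemma partials_lipschitz_open f (L : R) x y :
  (forall i, exists2 g, is_partial i f g & forall z, unit_cube z -> `|g z| <= L) ->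
  open_unit_cube x -> open_unit_cube y ->
  `|f y - f x| <= L * \sum_i `|tnth y i - tnth x i|.
Proof.
move=> fL xo yo.
pose z k : d.-tuple R := [tuple if (j < k)%N then tnth y j else tnth x j | j < d].
have zo k : open_unit_cube (z k) by move=> j; rewrite tnth_mktuple; case: ifP.
have z0 : z 0 = x by apply: eq_from_tnth => j; rewrite tnth_mktuple.
have zd : z d = y by apply: eq_from_tnth => j; rewrite tnth_mktuple ltn_ord.
rewrite -{1}zd -{1}z0.
have -> : f (z d) - f (z 0) = \sum_(k < d) (f (z k.+1) - f (z k)).
  by rewrite -(telescope_sumr (fun k => f (z k)) (leq0n d)) big_mkord.
rewrite (le_trans (ler_norm_sum _ _ _))// mulr_sumr; apply: ler_sum => i _.
have -> : z i.+1 = set_coord (z i) i (tnth y i).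
  apply: eq_from_tnth => j; rewrite !tnth_mktuple ltnS leq_eqVlt.
  by have [->|ji] := eqVneq j i; rewrite ?eqxx// (negbTE (_ : val j != val i)).
have [g fg gL] := fL i.
by have := partial_le fg gL (zo i) (yo i); rewrite tnth_mktuple ltnn.
Qed.

(** Contraction towards the centre of the cube; for 0 < e <= 1/2 it moves the closed cube into its
    interior. *)
Definition shrink (e : R) x : d.-tuple R := [tuple (1 - 2 * e) * tnth x i + e | i < d].

Lemma shrink_open e x : 0 < e -> e <= 1 / 2 -> unit_cube x -> open_unit_cube (shrink e x).
Proof.
move=> e0 e1 xc i; rewrite tnth_mktuple; have /andP[x0 x1] := xc i.
apply/andP; split; first by rewrite ltr_wpDl// mulr_ge0//; lra.
have : (1 - 2 * e) * tnth x i <= (1 - 2 * e) * 1 by rewrite ler_wpM2l//; lra.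
lra.
Qed.

Lemma eucl_dist_le_sum x y : eucl_dist x y <= \sum_i `|tnth x i - tnth y i|.
Proof.
rewrite -(@ler_pXn2r _ 2) ?nnegrE ?sqrtr_ge0 ?sumr_ge0// sqr_sqrtr; last first.
  by rewrite sumr_ge0// => i _; rewrite sqr_ge0.
rewrite [leRHS]expr2 mulr_suml; apply: ler_sum => i _.
rewrite -real_normK ?num_real// expr2 ler_wpM2l// (bigD1 i)//= lerDl.
by rewrite sumr_ge0.
Qed.

Lemma shrink_dist e x : 0 < e -> unit_cube x -> eucl_dist x (shrink e x) <= d%:R * e.
Proof.
move=> e0 xc; rewrite (le_trans (eucl_dist_le_sum _ _))//.
rewrite [leRHS](_ : _ = \sum_(i < d) e); last by rewrite sumr_const card_ord mulr_natl.
apply: ler_sum => i _; rewrite tnth_mktuple; have /andP[x0 x1] := xc i.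
by rewrite ler_norml; apply/andP; split; nra.
Qed.

(** Derivatives live in the open cube, so both points are first moved inside by [shrink], which does
    not increase coordinate differences; continuity up to the boundary absorbs the displacement. *)
Lemma partials_lipschitz f (L : R) x y : continuous_on_cube f -> 0 <= L ->
  (forall i, exists2 g, is_partial i f g & forall z, unit_cube z -> `|g z| <= L) ->
  unit_cube x -> unit_cube y ->
  `|f y - f x| <= L * \sum_i `|tnth y i - tnth x i|.
Proof.
move=> fc L0 fL xc yc; apply/ler_addgt0Pr => e e0.
have e2 : 0 < e / 2 by rewrite divr_gt0.
have [r r0 fx] := fc x xc _ e2; have [r' r'0 fy] := fc y yc _ e2.
(* At most 1/2 so that [shrink] lands inside, and so small that the displacement d t stays below
   both radii of continuity. *)
pose t := Order.min (1 / 2) (Order.min r r' / (d%:R + 1)).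
have d1 : 0 < d%:R + 1 :> R by rewrite ltr_wpDl.
have t0 : 0 < t by rewrite lt_min divr_gt0//= divr_gt0// lt_min r0.
have t12 : t <= 1 / 2 by rewrite ge_min lexx.
have tr : d%:R * t < Order.min r r'.
  have : t * (d%:R + 1) <= Order.min r r'.
    by rewrite -ler_pdivlMr// ge_min lexx orbT.
  by apply: lt_le_trans; rewrite mulrDr mulr1 mulrC ltrDl.
have opc z : open_unit_cube z -> @unit_cube R d z.
  by move=> zo i; have /andP[? ?] := zo i; rewrite !ltW.
have xo := shrink_open t0 t12 xc; have yo := shrink_open t0 t12 yc.
have hx := fx _ (opc _ xo) (le_lt_trans (shrink_dist t0 xc) (lt_le_trans tr _)).
have hy := fy _ (opc _ yo) (le_lt_trans (shrink_dist t0 yc) (lt_le_trans tr _)).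
have {}hx : `|f x - f (shrink t x)| < e / 2 by apply: hx; rewrite ge_min lexx.
have {}hy : `|f y - f (shrink t y)| < e / 2 by apply: hy; rewrite ge_min lexx orbT.
have hm := partials_lipschitz_open fL xo yo.
have : L * \sum_i `|tnth (shrink t y) i - tnth (shrink t x) i| <=
    L * \sum_i `|tnth y i - tnth x i|.
  rewrite ler_wpM2l//; apply: ler_sum => i _; rewrite !tnth_mktuple.
  rewrite (_ : _ - _ = (1 - 2 * t) * (tnth y i - tnth x i)); last by ring.
  by rewrite normrM ler_piMl// ler_norml; apply/andP; split; lra.
move: hx hy hm; rewrite !ltr_norml !ler_norml => /andP[? ?] /andP[? ?] /andP[? ?] ?.
by apply/andP; split; lra.
Qed.

(** Smoothness at most 1 is the Hoelder bound itself, with d^a <= d as d is positive; above 1 the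
    first partials are bounded by L and f is Lipschitz. *)
Lemma holder_modulus (s L r : R) f x y : (0 < d)%N -> holder s L f ->
  unit_cube x -> unit_cube y -> 0 < r -> (forall i, `|tnth x i - tnth y i| <= r) ->
  `|f x - f y| <= L * d%:R * r `^ Order.min s 1.
Proof.
move=> d0 [m [a [a0 a1 -> fh]]] xc yc r0 xyr.
have d1 : 1 <= d%:R :> R by rewrite ler1n.
have sr : \sum_i `|tnth x i - tnth y i| <= d%:R * r.
  rewrite [leRHS](_ : _ = \sum_(i < d) r); last by rewrite sumr_const card_ord mulr_natl.
  exact: ler_sum.
have L0 : 0 <= L.
  by case: m fh => [|m] /= [fL _]; rewrite (le_trans _ (fL x xc)).
case: m fh => [|m] /= [_ fh].
  rewrite add0r min_l// (le_trans (fh x y xc yc))// -mulrA ler_wpM2l//.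
  apply: (@le_trans _ _ ((d%:R * r) `^ a)).
    rewrite ge0_ler_powR ?nnegrE ?sqrtr_ge0 ?(ltW a0) ?mulr_ge0 ?(ltW r0)//.
    exact: le_trans (eucl_dist_le_sum _ _) sr.
  rewrite powRM ?ler0n ?(ltW r0)// ler_wpM2r ?powR_ge0//.
  by rewrite -[leRHS]powRr1 ?ler0n// ler_powR.
rewrite min_r; last by rewrite -natr1 -addrA addrCA lerDl addr_ge0// ltW.
rewrite powRr1 ?(ltW r0)// -mulrA.
apply: (@le_trans _ _ (L * \sum_i `|tnth x i - tnth y i|)); last by rewrite ler_wpM2l.
have [fc fg] := fh; apply: partials_lipschitz => // i.
by have [g gi gh] := fg i; exists g => //; case: m gh {fh fg} => [|m] /= [].
Qed.

Lemma holder_bound (s L : R) f x : holder s L f -> unit_cube x -> `|f x| <= L.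
Proof. by case=> m [a [_ _ _]]; case: m => [|m] /= [fL _]; exact: fL. Qed.

Definition grid q (k : {ffun 'I_d -> 'I_q.+1}) : d.-tuple R :=
  [tuple (k j)%:R / q%:R | j < d].

Lemma grid_cube q k : (0 < q)%N -> unit_cube (@grid q k).
Proof.
move=> q0 i; rewrite tnth_mktuple divr_ge0//= ler_pdivrMr ?ltr0n// mul1r ler_nat.
by rewrite -ltnS.
Qed.

Lemma grid_near q y : (0 < q)%N -> unit_cube y ->
  exists k, forall i, `|tnth y i - tnth (@grid q k) i| <= q%:R^-1.
Proof.
(* Rounding down; the coordinate 1 is sent to the index q, whence q + 1 values per axis. *)
move=> q0 yc; exists [ffun i => inord (Num.truncn (q%:R * tnth y i))] => i.
have /andP[y0 y1] := yc i.
have qy : 0 <= q%:R * tnth y i by rewrite mulr_ge0.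
have qp : 0 < q%:R :> R by rewrite ltr0n.
have /andP[t0 t1] := truncn_itv qy.
rewrite tnth_mktuple ffunE inordK; last first.
  by rewrite ltnS -(ler_nat R) (le_trans t0)// ler_piMr// ltW.
rewrite -(ler_pM2l qp) mulfV ?gt_eqF// -{1}(gtr0_norm qp) -normrM mulrBr.
rewrite mulrCA mulfV ?gt_eqF// mulr1 -natr1 in t1 *.
by rewrite ler_norml; apply/andP; split; lra.
Qed.

End holder_modulus.

(** * Second moments and whitening *)

Section second_moments.
Context {R : realType} {dT : measure_display} {T : measurableType dT}.
Context (P : probability T R).

Definition mx_integrable m n (M : T -> 'M[R]_(m, n)) :=
  forall i j, P.-integrable setT (EFin \o (fun w => M w i j)).

Lemma expectation_mxE m n (M : T -> 'M[R]_(m, n)) i j :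
  expectation_mx P M i j = \int[P]_w M w i j.
Proof. by rewrite mxE unlock. Qed.

Lemma integrable_mul_sq (F H : T -> R) :
  measurable_fun setT F -> measurable_fun setT H ->
  P.-integrable setT (EFin \o (fun w => F w ^+ 2)) ->
  P.-integrable setT (EFin \o (fun w => H w ^+ 2)) ->
  P.-integrable setT (EFin \o (fun w => F w * H w)).
Proof.
move=> mF mH iF iH; apply: (le_integrable measurableT _ _ (integrableD_R iF iH)).
  by apply/measurable_EFinP; exact: measurable_funM.
move=> w _ /=; rewrite lee_fin [leRHS]ger0_norm ?addr_ge0 ?sqr_ge0//.
rewrite ler_norml; apply/andP; split.
  by have := sqr_ge0 (F w + H w); have := sqr_ge0 (F w); have := sqr_ge0 (H w); nra.
by have := sqr_ge0 (F w - H w); have := sqr_ge0 (F w); have := sqr_ge0 (H w); nra.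
Qed.

Lemma outerE m n (F : 'cV[R]_m) (H : 'cV[R]_n) i j : (F *m H^T) i j = F i 0 * H j 0.
Proof. by rewrite mxE big_ord1 mxE. Qed.

Lemma dotv_mulmxE m n (A : 'M[R]_(m, n)) p q :
  dotv p (A *m q) = \sum_i \sum_j (p i 0 * q j 0) * A i j.
Proof.
rewrite dotvE; apply: eq_bigr => i _; rewrite mxE mulr_sumr.
by apply: eq_bigr => j _; rewrite -mulrA; congr (_ * _); rewrite mulrC.
Qed.

Lemma dotv_outer m n (F : 'cV[R]_m) (H : 'cV[R]_n) p q :
  dotv p (F *m H^T *m q) = dotv p F * dotv H q.
Proof.
have -> : F *m H^T *m q = dotv H q *: F.
  by rewrite -mulmxA [H^T *m q]mx11_scalar mul_mx_scalar.
by rewrite dotvZr mulrC.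
Qed.

Lemma expectation_mx_quad m n (M : T -> 'M[R]_(m, n)) p q : mx_integrable M ->
  P.-integrable setT (EFin \o (fun w => dotv p (M w *m q))) /\
  dotv p (expectation_mx P M *m q) = \int[P]_w dotv p (M w *m q).
Proof.
move=> iM.
have iM1 i j : P.-integrable setT (EFin \o (fun w => (p i 0 * q j 0) * M w i j)).
  exact: integrableZl_R.
have iM2 i : P.-integrable setT (EFin \o (fun w => \sum_j (p i 0 * q j 0) * M w i j)).
  by apply: integrable_Rsum => j; exact: iM1.
under eq_fun do rewrite dotv_mulmxE.
split; first exact: integrable_Rsum.
rewrite dotv_mulmxE Rintegral_sum//; apply: eq_bigr => i _.
rewrite Rintegral_sum//; apply: eq_bigr => j _.
by rewrite RintegralZl// expectation_mxE.
Qed.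

Lemma expectation_mx_mul m n m' n' (A : 'M[R]_(m', m)) (M : T -> 'M[R]_(m, n))
    (B : 'M[R]_(n, n')) : mx_integrable M ->
  expectation_mx P (fun w => A *m M w *m B) = A *m expectation_mx P M *m B.
Proof.
move=> iM; apply/matrixP => i j; rewrite expectation_mxE.
have E (N : 'M[R]_(m, n)) : (A *m N *m B) i j = dotv (row i A)^T (N *m col j B).
  by rewrite /dotv trmxK mulmxA -row_mul -row_mul colE mulmxA -colE !mxE.
by under eq_Rintegral do rewrite E; rewrite E; have [_ ->] := expectation_mx_quad (row i A)^T (col j B) iM.
Qed.

Lemma expectation_outer_sym m (F : T -> 'cV[R]_m) :
  (expectation_mx P (fun w => F w *m (F w)^T))^T =
  expectation_mx P (fun w => F w *m (F w)^T).
Proof.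
apply/matrixP => i j; rewrite mxE !expectation_mxE; apply: eq_Rintegral => w _.
by rewrite !outerE mulrC.
Qed.

Record sq_integrable m (F : T -> 'cV[R]_m) : Prop := {
  sqi_measurable : forall i, measurable_fun setT (fun w => F w i 0);
  sqi_integrable : forall i, P.-integrable setT (EFin \o (fun w => F w i 0 ^+ 2)) }.

Lemma sq_integrable_outer m n (F : T -> 'cV[R]_m) (H : T -> 'cV[R]_n) :
  sq_integrable F -> sq_integrable H -> mx_integrable (fun w => F w *m (H w)^T).
Proof.
move=> [mF iF] [mH iH] i j; under eq_fun do rewrite /= outerE.
exact: integrable_mul_sq.
Qed.

(** Expands the expectation of (p . F - q . H)^2, which is nonnegative. *)
Lemma cross_moment_le m n (F : T -> 'cV[R]_m) (H : T -> 'cV[R]_n) p q :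
  sq_integrable F -> sq_integrable H ->
  2 * dotv p (expectation_mx P (fun w => F w *m (H w)^T) *m q) <=
  dotv p (expectation_mx P (fun w => F w *m (F w)^T) *m p) +
  dotv q (expectation_mx P (fun w => H w *m (H w)^T) *m q).
Proof.
move=> iF iH.
have [i1 ->] := expectation_mx_quad p q (sq_integrable_outer iF iH).
have [i2 ->] := expectation_mx_quad p p (sq_integrable_outer iF iF).
have [i3 ->] := expectation_mx_quad q q (sq_integrable_outer iH iH).
rewrite -RintegralZl// -RintegralD//; apply: le_Rintegral => //.
- exact: integrableZl_R.
- exact: integrableD_R.
- move=> w _; rewrite !dotv_outer (dotvC (F w) p) (dotvC (H w) q).
  by have := sqr_ge0 (dotv p (F w) - dotv q (H w)); nra.
Qed.

(* Without a positive definite square root, [mxinvsqrt] is the junk value 0; then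
   S = 0 and its least singular value is 0. *)
Lemma whitened_cross_moment J K (F : T -> 'cV[R]_J) (H : T -> 'cV[R]_K)
    (A : 'M[R]_J) (B : 'M[R]_K) (S : 'M[R]_(J, K)) (a : R)
    (s := Num.sqrt (lambda_min (S *m S^T)) : R) :
  A = expectation_mx P (fun w => F w *m (F w)^T) ->
  B = expectation_mx P (fun w => H w *m (H w)^T) ->
  S = expectation_mx P (fun w => mxinvsqrt A *m F w *m (mxinvsqrt B *m H w)^T) ->
  (0 < J)%N -> sq_integrable F -> sq_integrable H -> 0 < a ->
  a <= lambda_min A -> a <= lambda_min B -> 0 < s ->
  [/\ mxinvsqrt A != 0, mxinvsqrt B != 0 & s <= 1].
Proof.
move=> AE BE + J0 iF iH a0 aA aB s0.
have Ss x := @least_singular_value _ _ _ S x s0; rewrite -/s in Ss.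
pose x0 : 'cV[R]_J := const_mx 1.
have x00 : 0 < enorm x0.
  rewrite lt_def enorm_ge0 andbT; apply/eqP => /enorm0_eq0/colP/(_ (Ordinal J0)).
  by rewrite !mxE => /eqP; rewrite oner_eq0.
set PA := mxinvsqrt A; set PB := mxinvsqrt B => SE0.
have SE : S = PA *m expectation_mx P (fun w => F w *m (H w)^T) *m PB^T.
  rewrite -expectation_mx_mul; last exact: sq_integrable_outer.
  by rewrite SE0; congr expectation_mx; apply/funext => w; rewrite trmx_mul !mulmxA.
have Sn0 : S != 0.
  apply: contraTneq (Ss x0) => ->; rewrite trmx0 mul0mx enorm0 -ltNge.
  by rewrite mulr_gt0.
have A0 : PA != 0.
  by apply: contra_neq Sn0 => A0; rewrite SE A0 !mul0mx.
have B0 : PB != 0.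
  by apply: contra_neq Sn0 => B0; rewrite SE B0 trmx0 mulmx0.
split=> //.
have sA : A^T = A by rewrite AE expectation_outer_sym.
have sB : B^T = B by rewrite BE expectation_outer_sym.
have [As AA _] := mxinvsqrt_whitening sA a0 aA A0.
have [Bs BB _] := mxinvsqrt_whitening sB a0 aB B0.
rewrite -/PA -/PB in As AA Bs BB.
(* With these vectors the inequality reads 2 |S^T x0|^2 <= |x0|^2 + |S^T x0|^2, so |S^T x0| <= |x0|;
   against the lower bound s |x0| this leaves s <= 1. *)
have := cross_moment_le (PA *m x0) (PB *m (S^T *m x0)) iF iH.
rewrite -AE -BE !(dotv_mulmxl PA) !(dotv_mulmxl PB) As Bs.
rewrite [PA *m (A *m _)]mulmxA [PA *m A *m _]mulmxA AA.
rewrite [PB *m (B *m _)]mulmxA [PB *m B *m _]mulmxA BB !mul1mx.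
rewrite [PA *m (_ *m _)]mulmxA [_ *m (PB *m _)]mulmxA -{1}Bs -SE dotv_mulmxr -!enorm_sqr => h.
have := Ss x0; have z0 := enorm_ge0 (S^T *m x0).
have hle : enorm (S^T *m x0) <= enorm x0.
  by rewrite -(@ler_pXn2r _ 2) ?nnegrE//; lra.
by move=> /le_trans/(_ hle); rewrite -[leRHS]mul1r ler_pM2r.
Qed.

End second_moments.

(** * Consequences of the model assumptions *)

Section model_facts.
Context {R : realType} {dT : measure_display} {T : measurableType dT}.
Context (P : probability T R) {d : nat}.

Lemma L2_sq_integrable (V : {RV P >-> d.-tuple R}) h : L2 V h ->
  measurable_fun setT h /\ P.-integrable setT (EFin \o (fun w => h (V w) ^+ 2)).
Proof.
rewrite /L2/= => h2; have mh : measurable_fun setT h.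
  by move: h2; rewrite inE => /andP[]; rewrite inE.
split=> //; have /integrableP[m2 i2] := Lfun2_integrable_sqr h2.
apply/integrableP; split.
  by apply/measurable_EFinP/measurable_funX; exact: measurableT_comp.
move: i2; rewrite ge0_integral_distribution//.
by do 2 apply: measurableT_comp => //; exact/measurable_EFinP/measurable_funX.
Qed.

Lemma measurable_unit_cube : measurable (@unit_cube R d).
Proof.
rewrite (_ : unit_cube = \bigcap_(i in [set: 'I_d]) ((fun x => tnth x i) @^-1` `[0, 1]%classic)).
  apply: fin_bigcap_measurable => // i _; rewrite -[X in measurable X]setTI.
  by apply: (measurable_tnth i) => //; exact: measurable_itv.
apply/seteqP; split=> [x xc i _ /=|x xc i]; first by rewrite in_itv/= xc.
by have := xc i I; rewrite /= in_itv.
Qed.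

Lemma strictly_stationary_marginal dS (S : measurableType dS) (Z : int -> T -> S) i A :
  strictly_stationary P Z -> measurable A -> P (Z i @^-1` A) = P (Z 0 @^-1` A).
Proof.
move=> Zs mA.
have := Zs i [set z | A (z 0)]; rewrite /= add0r; apply.
by apply: sub_gen_smallest; exists 0, A.
Qed.

(** On the complement of the cube the density formula integrates over the empty set; stationarity
    carries this from index 0 to i. *)
Lemma cube_almost_surely (X Y2 : int -> {RV P >-> d.-tuple R}) (Y1 : int -> {RV P >-> R}) i : assumption1 X Y2 Y1 ->
  P (X i @^-1` ~` unit_cube) = 0.
Proof.
move=> A1; have mC := measurableC measurable_unit_cube.
have -> : P (X i @^-1` ~` unit_cube) = P (X 0 @^-1` ~` unit_cube).
  have := @strictly_stationary_marginal _ _ _ i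
    ((fun z => z.1.1) @^-1` (~` unit_cube)) (a1_stationary A1).
  apply; rewrite -[X in measurable X]setTI.
  by apply: (measurableT_comp measurable_fst measurable_fst).
have [f [c [C [_ _ _ Pf]]]] := a1_density_X A1.
by rewrite Pf// setICl integral_set0.
Qed.

Lemma eps_moment (X : int -> {RV P >-> d.-tuple R}) (eps : int -> {RV P >-> R}) delta : assumption2 X eps delta ->
  exists2 m : R, 0 <= m & forall i,
    P.-integrable setT (EFin \o (fun w => `|eps i w| `^ (2 + delta))) /\
    \int[P]_w (`|eps i w| `^ (2 + delta)) = m.
Proof.
move=> A2; exists (\int[P]_w (`|eps 0 w| `^ (2 + delta))).
  by apply: Rintegral_ge0 => w _; exact: powR_ge0.
have mp : measurable_fun setT (fun r : R => (`|r| `^ (2 + delta))).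
  by apply: (measurableT_comp (measurable_powR _)).
have mpe : measurable_fun setT (fun r : R => (`|r| `^ (2 + delta))%:E).
  exact/measurable_EFinP.
move=> i.
split.
  apply/integrableP; split.
    by apply/measurable_EFinP; exact: (measurableT_comp mp).
  have := a2_moment A2 i; rewrite unlock; congr (_ < _)%E.
  by apply: eq_integral => w _; rewrite /= (ger0_norm (powR_ge0 _ _)).
rewrite /Rintegral; congr fine.
rewrite -[LHS](@ge0_integral_distribution _ _ _ _ _ P (eps i) (fun r => (`|r| `^ (2 + delta))%:E))//.
rewrite -[RHS](@ge0_integral_distribution _ _ _ _ _ P (eps 0) (fun r => (`|r| `^ (2 + delta))%:E))//.
apply: eq_measure_integral => A mA _.
exact: strictly_stationary_marginal (a2_stationary A2) mA.
Qed.

(** Generating family of [sigma_field k]: it holds X up to index k + 1 but the errors only up to k,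
    the information just before the error of index k + 1. *)
Definition filtration (X : int -> {RV P >-> d.-tuple R}) (eps : int -> {RV P >-> R}) (k : nat) : set (set T) :=
  \bigcup_(j in [set j : int | (j <= k%:Z)%R])
    (g_sigma_algebra_preimage (X (j + 1)) `|` g_sigma_algebra_preimage (eps j)).

Lemma eps_mds (X : int -> {RV P >-> d.-tuple R}) (eps : int -> {RV P >-> R}) delta : assumption2 X eps delta ->
  exists C, is_mds P (filtration X eps) (fun k => eps (k.+1)%:Z) C.
Proof.
move=> A2; have [c [C [c0 cC]]] := a2_var A2; exists (Order.max C 0).
have kE (k : nat) : (k.+1)%:Z - 1 = k%:Z by rewrite -addn1 PoszD addrK.
split.
- move=> k A [j _ [[B mB <-]|[B mB <-]]]; rewrite setTI -[X in measurable X]setTI.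
    exact: (measurable_funPT (X (j + 1))).
  exact: (measurable_funPT (eps j)).
- move=> k A [j jk Aj]; apply: sub_gen_smallest; exists j => //=.
  by rewrite (le_trans jk)// lez_nat.
- move=> k _ B mB; rewrite setTI; apply: sub_gen_smallest; exists (k.+1)%:Z => //=.
  by right; exists B => //; rewrite setTI.
- by move=> k; have := a2_mds A2 (k.+1)%:Z; rewrite kE.
- by rewrite le_max lexx orbT.
- move=> k; have [V EV Vc] := cC (k.+1)%:Z; exists V; first by move: EV; rewrite kE.
  by apply: filterS Vc => w /andP[_ ?]; rewrite le_max orbC; apply/orP; right.
Qed.

(** [phi] is controlled on the cube only; the indicator makes it a bounded weight, and changes
    nothing almost surely when X lies in the cube almost surely. *)
Lemma predictable_comp (X : int -> {RV P >-> d.-tuple R}) (eps : int -> {RV P >-> R}) (phi : d.-tuple R -> R) B :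
  measurable_fun setT phi -> (forall x, unit_cube x -> `|phi x| <= B) -> 0 <= B ->
  predictable (filtration X eps)
    (fun k w => (\1_unit_cube (X (k.+1)%:Z w) : R) * phi (X (k.+1)%:Z w)) B.
Proof.
move=> mphi phiB B0; split=> k; last first.
  move=> w; rewrite indicE; case: (boolP (_ \in _)) => [|_]; last by rewrite mul0r normr0.
  by rewrite inE => /phiB; rewrite mul1r.
pose h x := (\1_unit_cube x : R) * phi x.
have mh : measurable_fun setT h.
  by apply: measurable_funM => //; exact: measurable_indic measurable_unit_cube.
move=> _ D mD; rewrite setTI.
have mhD : measurable (h @^-1` D) by rewrite -[X in measurable X]setTI; exact: mh.
apply: sub_gen_smallest; exists k%:Z => //=.
by left; exists (h @^-1` D) => //; rewrite setTI -addn1 PoszD.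
Qed.

End model_facts.

(** * Reduction to a good event *)

Section estimator.
Context {R : realType} {dT : measure_display} {T : measurableType dT}.
Context {P : probability T R} {d : nat}.
Context (X Y2 : int -> {RV P >-> d.-tuple R}) (Y1 eps : int -> {RV P >-> R}).
Context (h0 : d.-tuple R -> R) (psi b : forall m, d.-tuple R -> 'cV[R]_m).
Context (n J K : nat).

Local Notation Pm := (mxinvsqrt (gram P (Y2 0) (@psi J))).
Local Notation Rm := (mxinvsqrt (gram P (X 0) (@b K))).
Local Notation S := (S_mx X Y2 psi b J K).
Local Notation s := (sigma_JK X Y2 psi b J K).

Definition eps_vec (w : T) : 'cV[R]_n := \col_(i < n) eps (i.+1)%:Z w.

Definition score (w : T) : 'cV[R]_K :=
  n%:R^-1 *: ((B_tilde X b n K w)^T *m eps_vec w).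

Definition deviation (w : T) : R :=
  spectral_norm (G_hat X b n K w - 1%:M) +
  spectral_norm (S_hat X Y2 psi b n J K w - S).

Lemma design_mul m m' (V : int -> T -> d.-tuple R) (f : d.-tuple R -> 'cV[R]_m)
    (A : 'M[R]_(m', m)) w :
  design n V (fun x => A *m f x) w = design n V f w *m A^T.
Proof.
apply/matrixP => i j; rewrite !mxE; apply: eq_bigr => k _.
by rewrite !mxE mulrC.
Qed.

(** Both estimators apply one operator, to Y and to H0, whose difference is the error vector. In
    whitened form the difference is that operator at [score], and [lstsq_perturbation] compares it
    with its population version. *)
Lemma h_hat_Pn_h0 w y :
  (0 < n)%N -> (forall i, Y1 i w = h0 (Y2 i w) + eps i w) ->
  Pm^T = Pm -> Rm^T = Rm -> 0 < s -> s <= 1 -> deviation w <= s / 8 ->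
  `|h_hat X Y2 Y1 psi b n J K w y - Pn_h0 X Y2 h0 psi b n J K w y -
    dotv (psi_tilde Y2 psi J y) (invmx (S *m S^T) *m S *m score w)| <=
  enorm (psi_tilde Y2 psi J y) * (24 * (deviation w / s ^+ 2) * enorm (score w)).
Proof.
move=> n0 Yw Ps Rs s0 s1 dev8.
set B := design n X (@b K) w; set Psi := design n Y2 (@psi J) w.
have BE : B_tilde X b n K w = B *m Rm^T by exact: design_mul.
have PE : Psi_tilde Y2 psi n J w = Psi *m Pm^T by exact: design_mul.
pose c : R := n%:R^-1.
have c0 : c != 0 by rewrite invr_eq0 pnatr_eq0 -lt0n.
have GE : G_hat X b n K w = c *: (Rm *m (B^T *m B) *m Rm).
  by rewrite /G_hat BE trmx_mul trmxK Rs !mulmxA.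
have SE : S_hat X Y2 psi b n J K w = c *: (Pm *m (Psi^T *m B) *m Rm).
  by rewrite /S_hat BE PE trmx_mul trmxK Rs !mulmxA.
have Ss x := @least_singular_value _ _ _ S x s0.
rewrite -/s in Ss.
set G := G_hat X b n K w in GE *; set S' := S_hat X Y2 psi b n J K w in SE *.
have e0 : 0 <= deviation w by rewrite addr_ge0// spectral_norm_ge0.
have DS x : enorm ((S' - S)^T *m x) <= deviation w * enorm x.
  rewrite (le_trans (enorm_trmx_mulmx_le _ _))// ler_wpM2r ?enorm_ge0//.
  by rewrite lerDr spectral_norm_ge0.
have DG x : enorm ((G - 1%:M) *m x) <= deviation w * enorm x.
  rewrite (le_trans (enorm_mulmx_le _ _))// ler_wpM2r ?enorm_ge0//.
  by rewrite lerDl spectral_norm_ge0.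
have uG := near1_unit dev8 s1 DG.
have uM := pert_unit s0 Ss dev8 s1 DS DG.
pose Q := invmx (S' *m invmx G *m S'^T) *m (S' *m invmx G).
have hE : h_hat X Y2 Y1 psi b n J K w y =
    dotv (psi_tilde Y2 psi J y) (Q *m (c *: ((B_tilde X b n K w)^T *m Y_vec Y1 n w))).
  have := @tsls_change_of_basis R J K Pm Rm (Psi^T *m B) (B^T *m B) c (psi J y)
    (B^T *m Y_vec Y1 n w) c0 Ps Rs.
  rewrite -GE -SE => /(_ uG uM).
  rewrite /h_hat -/B -/Psi /dotv BE trmx_mul trmxK Rs !mulmxA => ->.
  by rewrite [(B *m _)^T]trmx_mul Rs.
have pE : Pn_h0 X Y2 h0 psi b n J K w y =
    dotv (psi_tilde Y2 psi J y) (Q *m (c *: ((B_tilde X b n K w)^T *m H0_vec Y2 h0 n w))).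
  by rewrite /Pn_h0 -/G -/S' (mpinv_unit uG) (mpinv_unit uM) /dotv /Q !mulmxA.
have uE : score w = c *: ((B_tilde X b n K w)^T *m Y_vec Y1 n w) -
    c *: ((B_tilde X b n K w)^T *m H0_vec Y2 h0 n w).
  rewrite -scalerBr -mulmxBr /score; congr (_ *: (_ *m _)).
  by apply/colP => i; rewrite !mxE Yw addrAC subrr add0r.
rewrite hE pE -dotvBr -mulmxBr -uE -dotvBr.
apply: le_trans (dotv_le _ _) _; rewrite ler_wpM2l ?enorm_ge0//.
exact: (lstsq_perturbation s0 Ss dev8 s1 DS DG e0).
Qed.

(** Adjoint of the population least squares operator: for v = psi~(y) these are the coefficients of
    g_y in the basis b~. *)
Definition weight (v : 'cV[R]_J) : 'cV[R]_K := S^T *m (invmx (S *m S^T))^T *m v.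

Lemma weight_le v : 0 < s -> enorm (weight v) <= s^-1 * enorm v.
Proof. by move=> s0; apply: lstsq_dual => // x; exact: least_singular_value. Qed.

Lemma dotv_score (c : 'cV[R]_K) w : dotv c (score w) =
  n%:R^-1 * \sum_(i < n) dotv c (b_tilde X b K (X (i.+1)%:Z w)) * eps (i.+1)%:Z w.
Proof.
rewrite /score dotvZr dotv_mulmxr trmxK dotvE; congr (_ * _).
apply: eq_bigr => i _; rewrite !mxE; congr (_ * _).
by rewrite dotvE; apply: eq_bigr => j _; rewrite mxE mulrC.
Qed.

Lemma dotv_weight v w :
  dotv v (invmx (S *m S^T) *m S *m score w) = dotv (weight v) (score w).
Proof. by rewrite dotv_mulmxr trmx_mul. Qed.

(** The empirical second moment is the quadratic form of [G_hat] at c, within [deviation] |c|^2 of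
    |c|^2; hence the factor 2. *)
Lemma sum_sqr_weight (c : 'cV[R]_K) w : (0 < n)%N -> deviation w <= 1 ->
  \sum_(i < n) dotv c (b_tilde X b K (X (i.+1)%:Z w)) ^+ 2 <= n%:R * (2 * enorm c ^+ 2).
Proof.
move=> n0 dev1.
have -> : \sum_(i < n) dotv c (b_tilde X b K (X (i.+1)%:Z w)) ^+ 2 =
    n%:R * dotv c (G_hat X b n K w *m c).
  rewrite /G_hat -scalemxAl dotvZr mulrA mulfV ?mul1r ?pnatr_eq0 -?lt0n//.
  rewrite -mulmxA dotv_mulmxr trmxK dotvE; apply: eq_bigr => i _.
  have -> : dotv c (b_tilde X b K (X (i.+1)%:Z w)) = (B_tilde X b n K w *m c) i 0.
    by rewrite dotvE [RHS]mxE; apply: eq_bigr => j _; rewrite mulrC !mxE.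
  by rewrite expr2.
rewrite ler_wpM2l//.
have -> : G_hat X b n K w *m c = c + (G_hat X b n K w - 1%:M) *m c.
  by rewrite mulmxBl mul1mx addrC subrK.
rewrite dotvDr -enorm_sqr mulr_natl mulr2n lerD2l.
apply: le_trans (dotv_le_norm _ _) _; rewrite expr2 ler_wpM2l ?enorm_ge0//.
apply: le_trans (enorm_mulmx_le _ _) _; rewrite ler_piMl ?enorm_ge0//.
by apply: le_trans dev1; rewrite lerDl spectral_norm_ge0.
Qed.

Lemma enorm_score_sqr w : enorm (score w) ^+ 2 = n%:R^-1 ^+ 2 *
  \sum_k (\sum_(i < n) b_tilde X b K (X (i.+1)%:Z w) k 0 * eps (i.+1)%:Z w) ^+ 2.
Proof.
rewrite /score enormZ exprMn real_normK ?num_real// enorm_sqr dotvE; congr (_ * _).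
apply: eq_bigr => k _; rewrite -expr2; congr (_ ^+ 2).
by rewrite mxE; apply: eq_bigr => i _; rewrite !mxE.
Qed.

End estimator.

(** * Pathwise cost of truncating the errors *)

Section truncation.
Context {R : realType}.

(** Where |e_i| < t the truncation is inactive, as l Gm t <= 1. Elsewhere |e_i| <= |e_i|^(2 + delta)
    / t^(1 + delta), which gives the last term; the first two undo the tilt and the compensator. *)
Lemma truncated_sum_le n (g e : nat -> R) (l t delta C Q Gm x m : R) :
  0 < l -> 0 < t -> 0 < delta -> 0 <= C -> 0 <= Gm -> (forall i, (i < n)%N -> `|g i| <= Gm) ->
  l * Gm * t <= 1 ->
  \sum_(i < n) (Order.min (l * g i * e i) 1 - 3 * C * (l * g i) ^+ 2) <= x ->
  \sum_(i < n) g i ^+ 2 <= Q -> \sum_(i < n) `|e i| `^ (2 + delta) <= m ->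
  \sum_(i < n) g i * e i <= x / l + 3 * C * l * Q + Gm * (t `^ (1 + delta))^-1 * m.
Proof.
move=> l0 t0 d0 C0 G0 gG lGt sx gQ em.
have tp : 0 < t `^ (1 + delta) by rewrite powR_gt0.
have pt i : (i < n)%N -> l * g i * e i <= Order.min (l * g i * e i) 1 +
    l * (Gm * (t `^ (1 + delta))^-1 * `|e i| `^ (2 + delta)).
  move=> ilt.
  have r0 : 0 <= l * (Gm * (t `^ (1 + delta))^-1 * `|e i| `^ (2 + delta)).
    by rewrite mulr_ge0 ?(ltW l0)// !mulr_ge0 ?powR_ge0// invr_ge0 ltW.
  have [le1|gt1] := leP (l * g i * e i) 1; first by rewrite lerDl.
  have ge : l * g i * e i <= l * (Gm * `|e i|).
    rewrite -mulrA ler_wpM2l ?(ltW l0)// (le_trans (ler_norm _))// normrM.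
    by rewrite ler_wpM2r ?gG.
  have te : t <= `|e i|.
    rewrite leNgt; apply/negP => et.
    have : l * (Gm * `|e i|) <= l * (Gm * t).
      by rewrite ler_wpM2l ?(ltW l0)// ler_wpM2l// ltW.
    lra.
  have e0 : 0 < `|e i| by exact: lt_le_trans te.
  apply: le_trans ge _.
  rewrite -[leLHS]add0r lerD// ler_wpM2l ?(ltW l0)// -mulrA ler_wpM2l ?enorm_ge0//.
  rewrite (_ : 2 + delta = 1 + (1 + delta)); last by ring.
  rewrite [`|e i| `^ _]powRD; last by apply/implyP => _; rewrite gt_eqF.
  rewrite powRr1 ?(ltW e0)// mulrCA ler_peMr ?(ltW e0)//.
  rewrite mulrC ler_pdivlMr// mul1r ge0_ler_powR ?nnegrE ?(ltW t0) ?(ltW e0)//.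
  by rewrite addr_ge0// ltW.
rewrite -(ler_pM2l l0) mulr_sumr.
apply: (@le_trans _ _ (\sum_(i < n) (Order.min (l * g i * e i) 1 +
    l * (Gm * (t `^ (1 + delta))^-1 * `|e i| `^ (2 + delta))))).
  by apply: ler_sum => i _; rewrite [l * (g i * e i)]mulrA pt.
rewrite big_split/= !mulrDr lerD//.
  rewrite mulrCA mulfV ?gt_eqF// mulr1.
  have : \sum_(i < n) 3 * C * (l * g i) ^+ 2 <= l * (3 * C * l * Q).
    rewrite (_ : l * _ = 3 * C * l ^+ 2 * Q); last by ring.
    have c0 : 0 <= 3 * C * l ^+ 2 by rewrite mulr_ge0 ?sqr_ge0// mulr_ge0.
    apply: le_trans (ler_wpM2l c0 gQ); rewrite mulr_sumr; apply: ler_sum => i _.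
    by rewrite exprMn mulrA.
  by move: sx; rewrite sumrB; lra.
rewrite -mulr_sumr ler_wpM2l ?(ltW l0)// -mulr_sumr.
by rewrite ler_wpM2l// mulr_ge0// invr_ge0 ltW.
Qed.

End truncation.

(** * Union bounds for the outer measure *)

Section outer_measure_bounds.
Context {R : realType} {dT : measure_display} {T : measurableType dT}.
Context (P : probability T R).

Lemma mu_ext_setU (A B : set T) (x y : R) :
  (mu_ext P A <= x%:E)%E -> (mu_ext P B <= y%:E)%E ->
  (mu_ext P (A `|` B) <= (x + y)%:E)%E.
Proof.
move=> Ax By; apply: le_trans (outer_measureU2 _ A B) _.
by rewrite EFinD; exact: leeD.
Qed.

Lemma mu_ext_bigcup (I : finType) (A : I -> set T) (x : R) : 0 <= x ->
  (forall i, mu_ext P (A i) <= x%:E)%E ->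
  (mu_ext P [set w | exists i, A i w] <= (#|I|%:R * x)%:E)%E.
Proof.
move=> x0 Ax.
have key (r : seq I) : (mu_ext P [set w | exists2 i, i \in r & A i w] <= ((size r)%:R * x)%:E)%E.
  elim: r => [|i r IH].
    rewrite mul0r (_ : [set _ | _] = set0) ?mu_ext0//.
    by apply/seteqP; split=> w // -[].
  rewrite /= -natr1 addrC mulrDl mul1r.
  apply: le_trans (mu_ext_setU (Ax i) IH); apply: le_mu_ext => w [j].
  by rewrite inE => /predU1P[->|jr] Aj; [left|right; exists j].
have := key (enum I); rewrite -cardE; apply: le_trans.
by apply: le_mu_ext => w [i Ai]; exists i => //; rewrite mem_enum.
Qed.

Lemma mu_ext_le_measure (A B : set T) (x : R) : A `<=` B -> measurable B ->
  (P B <= x%:E)%E -> (mu_ext P A <= x%:E)%E.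
Proof.
move=> AB mB; apply: le_trans; rewrite -measurable_mu_extE//; exact: le_mu_ext.
Qed.

End outer_measure_bounds.

Section good_event.
Context {R : realType} {dT : measure_display} {T : measurableType dT}.
Context {P : probability T R} {d : nat}.
Context (X Y2 : int -> {RV P >-> d.-tuple R}) (Y1 eps : int -> {RV P >-> R}).
Context (h0 : d.-tuple R -> R) (psi b : forall m, d.-tuple R -> 'cV[R]_m).
Context (n J K : nat).

Local Notation s := (sigma_JK X Y2 psi b J K).
Local Notation rho := (Num.sqrt (K%:R * ln n%:R / n%:R) : R).
Local Notation psit := (psi_tilde Y2 psi J).
Local Notation bt := (b_tilde X b K).

(** The sign [g] provides both tails, since the truncation is one-sided; [C] is the bound on the
    conditional variance and [l] the tilt. *)
Definition bernstein_sum (C l : R) (v : 'cV[R]_J) (g : bool) (w : T) : R :=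
  \sum_(i < n)
    (Order.min (l * ((-1) ^+ g *
        dotv (weight X Y2 psi b K v) (bt (X (i.+1)%:Z w))) * eps (i.+1)%:Z w) 1 -
     3 * C * (l * ((-1) ^+ g *
        dotv (weight X Y2 psi b K v) (bt (X (i.+1)%:Z w)))) ^+ 2).

Definition score_sqr (w : T) : R :=
  \sum_k (\sum_(i < n) bt (X (i.+1)%:Z w) k 0 * eps (i.+1)%:Z w) ^+ 2.

Lemma score_le (M3 : R) w : (0 < n)%N -> (0 < K)%N -> 0 <= M3 ->
  score_sqr w <= M3 ^+ 2 * (n%:R * K%:R) ->
  enorm (score X eps b n K w) <= M3 * Num.sqrt (K%:R / n%:R).
Proof.
move=> n0 K0 M0 sq.
have np : 0 < n%:R :> R by rewrite ltr0n.
rewrite -(@ler_pXn2r _ 2) ?nnegrE ?enorm_ge0//; last by rewrite mulr_ge0// sqrtr_ge0.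
rewrite enorm_score_sqr exprMn sqr_sqrtr ?divr_ge0//.
rewrite (_ : M3 ^+ 2 * _ = n%:R^-1 ^+ 2 * (M3 ^+ 2 * (n%:R * K%:R))); last first.
  by field; rewrite gt_eqF.
by rewrite ler_wpM2l// sqr_ge0.
Qed.

(* [l] is the tilt at which the deviation term A ln n / l and the variance term
   C l Q are both of order n rho / s; the errors are cut at 1 / (kappa^2 rho). *)
Lemma linear_part_le (kappa delta C A Cg M4 : R) v w
    (l := s * rho / K%:R) :
  (0 < n)%N -> (0 < K)%N -> 1 <= ln n%:R :> R -> 0 < kappa -> 0 < delta -> 0 <= C ->
  0 <= M4 -> 0 < s ->
  (forall x, unit_cube x -> enorm (bt x) <= kappa * Num.sqrt K%:R) ->
  enorm v <= kappa * Num.sqrt K%:R ->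
  K%:R * rho `^ delta <= Cg ->
  (forall i, (i < n)%N -> unit_cube (X (i.+1)%:Z w)) ->
  deviation X Y2 psi b n J K w <= 1 ->
  \sum_(i < n) `|eps (i.+1)%:Z w| `^ (2 + delta) <= n%:R * M4 ->
  (forall g, bernstein_sum C l v g w <= A * ln n%:R) ->
  `|dotv (weight X Y2 psi b K v) (score X eps b n K w)| <=
  (A + 6 * C * kappa ^+ 2 + kappa ^+ 2 * (kappa ^+ 2) `^ (1 + delta) * Cg * M4) *
    (s^-1 * rho).
Proof.
move=> n0 K0 ln1 k0 d0 C0 M40 s0 bk vk growth Xc dev1 em bern.
have np : 0 < n%:R :> R by rewrite ltr0n.
have Kp : 0 < K%:R :> R by rewrite ltr0n.
have lnp : 0 < ln n%:R :> R by exact: lt_le_trans ln1.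
have rp : 0 < rho by rewrite sqrtr_gt0 divr_gt0// mulr_gt0.
have r2 : rho ^+ 2 = K%:R * ln n%:R / n%:R by rewrite sqr_sqrtr// divr_ge0// mulr_ge0// ltW.
set r := rho in rp r2 growth l bern *.
have k2 : 0 < kappa ^+ 2 by rewrite exprn_gt0.
set c := weight X Y2 psi b K v.
have cle : enorm c <= s^-1 * (kappa * Num.sqrt K%:R).
  by rewrite (le_trans (weight_le _ s0))// ler_wpM2l// invr_ge0 ltW.
have sK0 : 0 <= kappa * Num.sqrt K%:R by rewrite mulr_ge0 ?sqrtr_ge0// ltW.
have sK2 : Num.sqrt K%:R ^+ 2 = K%:R :> R by rewrite sqr_sqrtr.
have bd : 0 <= s^-1 * (kappa * Num.sqrt K%:R) by rewrite mulr_ge0// invr_ge0 ltW.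
have lp : 0 < l by rewrite /l divr_gt0// mulr_gt0.
pose Gm := s^-1 * (kappa ^+ 2 * K%:R).
have Gm0 : 0 <= Gm by rewrite mulr_ge0 ?mulr_ge0 ?invr_ge0 ?ltW.
(* l Gm equals kappa^2 rho, so this cut gives l Gm t = 1. *)
pose t := (kappa ^+ 2 * r)^-1.
have tp : 0 < t by rewrite invr_gt0 mulr_gt0.
have lGt : l * Gm * t <= 1.
  by rewrite (_ : _ * t = 1)// /l /Gm /t; field; rewrite !gt_eqF.
have gle i : (i < n)%N -> `|dotv c (bt (X (i.+1)%:Z w))| <= Gm.
  move=> ilt; rewrite (le_trans (dotv_le _ _))//.
  rewrite (_ : Gm = s^-1 * (kappa * Num.sqrt K%:R) * (kappa * Num.sqrt K%:R)); last first.
    by rewrite /Gm -[X in kappa ^+ 2 * X]sK2; ring.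
  by apply: ler_pM => //; rewrite ?enorm_ge0// bk//; exact: Xc.
have sq := sum_sqr_weight c n0 dev1.
pose Q := n%:R * (2 * (s^-1 * (kappa * Num.sqrt K%:R)) ^+ 2).
have sqQ : \sum_(i < n) dotv c (bt (X (i.+1)%:Z w)) ^+ 2 <= Q.
  apply: le_trans sq _; rewrite ler_wpM2l// ler_wpM2l//.
  by rewrite ler_pXn2r// ?nnegrE// enorm_ge0.
pose Bd := A * ln n%:R / l + 3 * C * l * Q + Gm * (t `^ (1 + delta))^-1 * (n%:R * M4).
have side (g : bool) : \sum_(i < n) (-1) ^+ g * dotv c (bt (X (i.+1)%:Z w)) * eps (i.+1)%:Z w <= Bd.
  apply: (@truncated_sum_le _ n (fun i => (-1) ^+ g * dotv c (bt (X (i.+1)%:Z w)))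
    (fun i => eps (i.+1)%:Z w) l t delta C Q Gm) => //.
  - by move=> i ilt; rewrite normrM normr_sign mul1r; exact: gle.
  - exact: (bern g).
  - by under eq_bigr do rewrite exprMn sqrr_sign mul1r.
have absle : `|\sum_(i < n) dotv c (bt (X (i.+1)%:Z w)) * eps (i.+1)%:Z w| <= Bd.
  rewrite ler_norml; apply/andP; split.
    have := side true; rewrite expr1.
    by under eq_bigr do rewrite mulN1r mulNr; rewrite sumrN lerNl.
  by have := side false; rewrite expr0; under eq_bigr do rewrite mul1r.
rewrite dotv_score normrM ger0_norm ?invr_ge0//.
apply: (@le_trans _ _ (n%:R^-1 * Bd)); first by rewrite ler_wpM2l// invr_ge0.
(* The truncation loss Gm / t^(1 + delta) is thus a multiple of (K rho^delta) rho / s, whose first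
   factor [growth] bounds by Cg. *)
have tE : (t `^ (1 + delta))^-1 = (kappa ^+ 2) `^ (1 + delta) * (r * r `^ delta).
  rewrite -powRN /t -powR_inv1; last by rewrite mulr_ge0// ltW.
  rewrite -powRrM mulN1r opprK powRM ?(ltW k2) ?(ltW rp)//; congr (_ * _).
  by rewrite powRD ?powRr1 ?(ltW rp)//; apply/implyP => _; rewrite gt_eqF.
have t1 : n%:R^-1 * (A * ln n%:R / l) = A * (s^-1 * r).
  rewrite [LHS](_ : _ = A * (K%:R * ln n%:R / n%:R) / (s * r)); last first.
    by rewrite /l; field; rewrite !gt_eqF.
  by rewrite -r2; field; rewrite !gt_eqF.
have t2 : n%:R^-1 * (3 * C * l * Q) = 6 * C * kappa ^+ 2 * (s^-1 * r).
  rewrite /Q !exprMn sK2 /l; field; by rewrite !gt_eqF.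
have t3 : n%:R^-1 * (Gm * (t `^ (1 + delta))^-1 * (n%:R * M4)) <=
    kappa ^+ 2 * (kappa ^+ 2) `^ (1 + delta) * Cg * M4 * (s^-1 * r).
  rewrite tE [leLHS](_ : _ = kappa ^+ 2 * (kappa ^+ 2) `^ (1 + delta) * (K%:R * r `^ delta) *
      M4 * (s^-1 * r)); last by rewrite /Gm; field; rewrite !gt_eqF.
  have sr0 : 0 <= s^-1 * r by rewrite mulr_ge0 ?invr_ge0 ?ltW.
  by rewrite ler_wpM2r// ler_wpM2r// ler_wpM2l// mulr_ge0 ?powR_ge0// ltW.
rewrite /Bd !mulrDr t1 t2 !mulrDl lerD2l; exact: t3.
Qed.

(** Origin of the constant: its first three terms bound the linear form at a grid point near y;
    [D * M3] pays for the passage from there to y, and [24 * kappa * M1 * M3] for replacing the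
    sample matrices by their population versions. *)
Lemma good_event_bound (kappa delta C A Cg M1 M3 M4 D : R) (q : nat) w y
    (l := s * rho / K%:R) :
  (0 < n)%N -> (0 < K)%N -> (0 < q)%N -> 1 <= ln n%:R :> R ->
  0 < kappa -> 0 < delta -> 0 <= C -> 0 <= M1 -> 0 <= M3 -> 0 <= M4 -> 0 <= D ->
  (forall i, Y1 i w = h0 (Y2 i w) + eps i w) ->
  (mxinvsqrt (gram P (Y2 0) (@psi J)))^T = mxinvsqrt (gram P (Y2 0) (@psi J)) ->
  (mxinvsqrt (gram P (X 0) (@b K)))^T = mxinvsqrt (gram P (X 0) (@b K)) ->
  0 < s -> s <= 1 ->
  (forall x, unit_cube x -> enorm (bt x) <= kappa * Num.sqrt K%:R) ->
  (forall x, unit_cube x -> enorm (psit x) <= kappa * Num.sqrt K%:R) ->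
  (forall x z, unit_cube x -> unit_cube z ->
    (forall i, `|tnth x i - tnth z i| <= q%:R^-1) -> enorm (psit x - psit z) <= D) ->
  K%:R * rho `^ delta <= Cg ->
  (forall i, (i < n)%N -> unit_cube (X (i.+1)%:Z w)) ->
  s^-1 * deviation X Y2 psi b n J K w <= 1 / 8 ->
  s^-1 * deviation X Y2 psi b n J K w <= M1 * Num.sqrt (ln n%:R / K%:R) ->
  score_sqr w <= M3 ^+ 2 * (n%:R * K%:R) ->
  \sum_(i < n) `|eps (i.+1)%:Z w| `^ (2 + delta) <= n%:R * M4 ->
  (forall g (k : {ffun 'I_d -> 'I_q.+1}),
    bernstein_sum C l (psit (grid k)) g w <= A * ln n%:R) ->
  unit_cube y ->
  `|h_hat X Y2 Y1 psi b n J K w y - Pn_h0 X Y2 h0 psi b n J K w y| <=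
  (A + 6 * C * kappa ^+ 2 + kappa ^+ 2 * (kappa ^+ 2) `^ (1 + delta) * Cg * M4 +
   D * M3 + 24 * kappa * M1 * M3) * (s^-1 * rho).
Proof.
move=> n0 K0 q0 ln1 k0 d0 C0 M10 M30 M40 D0 Yw Ps Rs s0 s1 bk pk pD growth Xc dev8 dev1.
move=> sq em bern yc.
have np : 0 < n%:R :> R by rewrite ltr0n.
have Kp : 0 < K%:R :> R by rewrite ltr0n.
have lnp : 0 < ln n%:R :> R by exact: lt_le_trans ln1.
set dv := deviation X Y2 psi b n J K w in dev8 dev1 *.
have dvs : dv <= s / 8 by move: dev8; rewrite ler_pdivrMl// mul1r.
have dv1 : dv <= 1 by apply: le_trans dvs _; lra.
have ule := score_le n0 K0 M30 sq.
set u := score X eps b n K w in ule *.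
have [k kn] := grid_near q0 yc.
have kc : unit_cube (@grid R d q k) by exact: grid_cube.
have main := linear_part_le n0 K0 ln1 k0 d0 C0 M40 s0 bk (pk _ kc) growth Xc dv1 em
  (fun g => bern g k).
have rem := h_hat_Pn_h0 y n0 Yw Ps Rs s0 s1 dvs.
rewrite -/u -/dv in main rem.
set r := rho in growth bern main *.
have sip : 0 < s^-1 by rewrite invr_gt0.
have u_r : Num.sqrt (K%:R / n%:R) <= r.
  by rewrite ler_wsqrtr// mulrAC ler_peMr// divr_ge0.
have disc : `|dotv (weight X Y2 psi b K (psit y - psit (grid k))) u| <= D * M3 * (s^-1 * r).
  rewrite (le_trans (dotv_le _ _))//.
  rewrite (_ : D * M3 * (s^-1 * r) = s^-1 * D * (M3 * r)); last by ring.
  apply: ler_pM; rewrite ?enorm_ge0//.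
    rewrite (le_trans (weight_le _ s0))// ler_wpM2l ?(ltW sip)//.
    exact: pD.
  by rewrite (le_trans ule)// ler_wpM2l.
have reml : enorm (psit y) * (24 * (dv / s ^+ 2) * enorm u) <=
    24 * kappa * M1 * M3 * (s^-1 * r).
  (* rho splits into the orders of the three factors of the remainder: psi~, the deviation over s,
     and the score. *)
  have rE : r = Num.sqrt K%:R * Num.sqrt (ln n%:R / K%:R) * Num.sqrt (K%:R / n%:R).
    rewrite -!sqrtrM ?mulr_ge0 ?divr_ge0 ?(ltW lnp)//; congr Num.sqrt.
    by field; rewrite !gt_eqF.
  have dv0 : 0 <= dv by rewrite addr_ge0// spectral_norm_ge0.
  rewrite (_ : 24 * kappa * M1 * M3 * (s^-1 * r) = (kappa * Num.sqrt K%:R) *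
    (24 * (s^-1 * (M1 * Num.sqrt (ln n%:R / K%:R))) * (M3 * Num.sqrt (K%:R / n%:R)))); last first.
    by rewrite rE; ring.
  have dE : dv / s ^+ 2 = s^-1 * (s^-1 * dv) by field; rewrite gt_eqF.
  have dd0 : 0 <= 24 * (dv / s ^+ 2) by rewrite mulr_ge0// divr_ge0// sqr_ge0.
  apply: ler_pM; rewrite ?enorm_ge0 ?pk//; first by rewrite mulr_ge0// enorm_ge0.
  apply: ler_pM; rewrite ?enorm_ge0//.
  by rewrite dE ler_wpM2l// ler_wpM2l// ltW.
have wE : dotv (psit y) (invmx (S_mx X Y2 psi b J K *m (S_mx X Y2 psi b J K)^T) *m
      S_mx X Y2 psi b J K *m u) =
    dotv (weight X Y2 psi b K (psit (grid k))) u +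
    dotv (weight X Y2 psi b K (psit y - psit (grid k))) u.
  by rewrite dotv_weight -dotvDl /weight -mulmxDr addrC subrK.
rewrite wE in rem.
set a := h_hat _ _ _ _ _ _ _ _ _ _ - _ in rem *.
set a1 := dotv (weight _ _ _ _ _ (psit (grid k))) u in main rem.
set a2 := dotv (weight _ _ _ _ _ (_ - _)) u in disc rem.
rewrite (_ : a = (a - (a1 + a2)) + (a1 + a2)); last by rewrite subrK.
rewrite (le_trans (ler_normD _ _))//.
have := ler_normD a1 a2; have := le_trans rem reml.
rewrite !mulrDl in main *; lra.
Qed.

End good_event.

(** * Probability of the good event *)

Section probability_bounds.
Context {R : realType} {dT : measure_display} {T : measurableType dT}.
Context {P : probability T R} {d : nat}.
Context (X Y2 : int -> {RV P >-> d.-tuple R}) (Y1 eps : int -> {RV P >-> R}).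
Context (psi b : forall m, d.-tuple R -> 'cV[R]_m).
Context (n J K : nat).

Local Notation bt := (b_tilde X b K).

Definition outside_cube (w : T) : Prop := exists i : 'I_n, ~ unit_cube (X (i.+1)%:Z w).

Lemma outside_cube_null : assumption1 X Y2 Y1 ->
  (mu_ext P [set w | outside_cube w] <= 0%:E)%E.
Proof.
move=> A1; have := @mu_ext_bigcup _ _ _ P 'I_n
  (fun i => X (i.+1)%:Z @^-1` ~` unit_cube) 0 (lexx 0).
rewrite mulr0; apply=> i; rewrite measurable_mu_extE.
  by rewrite le_eqVlt; apply/orP; left; apply/eqP; exact: cube_almost_surely A1.
rewrite -[X in measurable X]setTI; apply: measurable_funPT => //.
by apply: measurableC; exact: (@measurable_unit_cube R d).
Qed.

Lemma in_cube_indic w (i : 'I_n) : ~ outside_cube w -> (\1_unit_cube (X (i.+1)%:Z w) : R) = 1.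
Proof.
move=> wc; rewrite indicE mem_set//; apply: contrapT => Xi.
by apply: wc; exists i.
Qed.

Lemma measurable_mulmx_coord m m' (f : d.-tuple R -> 'cV[R]_m) (A : 'M[R]_(m', m)) k :
  (forall j, measurable_fun setT (fun x => f x j 0)) ->
  measurable_fun setT (fun x => (A *m f x) k 0).
Proof.
move=> mf; under eq_fun do rewrite mxE.
apply: measurable_sum => j; apply: measurable_funM => //; exact: measurable_cst.
Qed.

Lemma measurable_dotv m (f : d.-tuple R -> 'cV[R]_m) (c : 'cV[R]_m) :
  (forall j, measurable_fun setT (fun x => f x j 0)) ->
  measurable_fun setT (fun x => dotv c (f x)).
Proof. by move=> mf; exact: measurable_mulmx_coord. Qed.

(** Markov's inequality for the sum over k of the second moments. Coordinates are summed before
    bounding, so that |b~|^2 <= kappa^2 K is used once; bounding each of the K coordinates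
    separately would lose a factor K. *)
Lemma score_tail (C kappa M3 : R) :
  (0 < n)%N -> (0 < K)%N -> 0 < M3 -> 0 < kappa ->
  assumption1 X Y2 Y1 -> is_mds P (filtration X eps) (fun k => eps (k.+1)%:Z) C ->
  (forall j, measurable_fun setT (fun x => b K x j 0)) ->
  (forall x, unit_cube x -> enorm (bt x) <= kappa * Num.sqrt K%:R) ->
  (mu_ext P [set w | (M3 ^+ 2 * (n%:R * K%:R) < score_sqr X eps b n K w)%R] <=
    (C * kappa ^+ 2 / M3 ^+ 2)%:E)%E.
Proof.
move=> n0 K0 M0 k0 A1 mds mb bk.
have np : 0 < n%:R :> R by rewrite ltr0n.
have Kp : 0 < K%:R :> R by rewrite ltr0n.
have C0 := mds_ge0 mds.
have kK : 0 <= kappa * Num.sqrt K%:R by rewrite mulr_ge0 ?sqrtr_ge0// ltW.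
pose f (k : 'I_K) (i : nat) w := (\1_unit_cube (X (i.+1)%:Z w) : R) * bt (X (i.+1)%:Z w) k 0.
have pf k : predictable (filtration X eps) (f k) (kappa * Num.sqrt K%:R).
  apply: (@predictable_comp _ _ _ _ _ X eps (fun x => bt x k 0)) => //.
    exact: measurable_mulmx_coord.
  by move=> x xc; rewrite (le_trans (coord_le_enorm _ _))// bk.
pose W w := \sum_k (\sum_(i < n) f k i w * eps (i.+1)%:Z w) ^+ 2.
have sm k := mds_second_moment n mds (pf k).
have iW : P.-integrable setT (EFin \o W) by apply: integrable_Rsum => k; have [] := sm k.
have if2 k (i : nat) : P.-integrable setT (EFin \o (fun w => f k i w ^+ 2)).
  apply: (@integrable_bounded _ _ _ P _ ((kappa * Num.sqrt K%:R) ^+ 2)).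
    apply: measurable_funX.
    exact: (sub_measurable_measurable (mds_sub mds i) (pred_measurable (pf k) i)).
  move=> w; rewrite normrX ler_pXn2r ?nnegrE//; exact: pred_bounded (pf k) i w.
have EW : \int[P]_w W w <= C * (n%:R * (kappa ^+ 2 * K%:R)).
  rewrite Rintegral_sum; last by move=> k; have [] := sm k.
  apply: (@le_trans _ _ (\sum_k C * \sum_(i < n) \int[P]_w (f k i w ^+ 2))).
    by apply: ler_sum => k _; have [] := sm k.
  rewrite -mulr_sumr ler_wpM2l// exchange_big/=.
  rewrite [leRHS](_ : _ = \sum_(i < n) kappa ^+ 2 * K%:R); last first.
    by rewrite sumr_const card_ord mulr_natl.
  apply: ler_sum => i _; rewrite -Rintegral_sum//.
  apply: (@le_trans _ _ (\int[P]_w (kappa ^+ 2 * K%:R))); last first.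
    by rewrite Rintegral_cst// [X in fine X]probability_setT mulr1.
  apply: le_Rintegral => //.
  - exact: integrable_Rsum.
  - exact: finite_measure_integrable_cst.
  - move=> w _; have [xc|xc] := pselect (unit_cube (X (i.+1)%:Z w)).
      have : enorm (bt (X (i.+1)%:Z w)) ^+ 2 <= (kappa * Num.sqrt K%:R) ^+ 2.
        by rewrite ler_pXn2r ?nnegrE ?enorm_ge0// bk.
      rewrite enorm_sqr dotvE exprMn sqr_sqrtr//; apply: le_trans.
      apply: ler_sum => k _; rewrite /f indicE mem_set// mul1r expr2 //.
    rewrite big1; first by rewrite mulr_ge0// sqr_ge0.
    by move=> k _; rewrite /f indicE memNset// mul0r expr0n.
have W0 w : 0 <= W w by rewrite sumr_ge0// => k _; rewrite sqr_ge0.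
pose t := M3 ^+ 2 * (n%:R * K%:R).
have tp : 0 < t by rewrite mulr_gt0 ?exprn_gt0// mulr_gt0.
have := markov_Rintegral tp iW W0.
have mW : measurable [set w | t <= W w].
  have mWf : measurable_fun setT W by exact/measurable_EFinP/(measurable_int P).
  rewrite -[X in measurable X]setTI (_ : [set _ | _] = W @^-1` `[t, +oo[%classic).
    exact: mWf.
  by apply/seteqP; split=> w /=; rewrite in_itv/= andbT.
move=> PW.
(* Off the null event every indicator equals 1, and W is [score_sqr]. *)
have sub : [set w | t < score_sqr X eps b n K w] `<=`
    [set w | t <= W w] `|` [set w | outside_cube w].
  move=> w /= tw; have [wc|wc] := pselect (outside_cube w); [by right|left].
  rewrite (le_trans (ltW tw))// le_eqVlt; apply/orP; left; apply/eqP.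
  apply: eq_bigr => k _; congr (_ ^+ 2); apply: eq_bigr => i _.
  by rewrite /f in_cube_indic// mul1r.
apply: le_trans (le_mu_ext _ sub) _.
rewrite -[X in X%:E]addr0; apply: mu_ext_setU; last exact: outside_cube_null.
rewrite measurable_mu_extE//; apply: le_trans PW _; rewrite lee_fin.
rewrite ler_pdivrMr// (le_trans EW)// le_eqVlt; apply/orP; left; apply/eqP.
by rewrite /t; field; rewrite gt_eqF.
Qed.

Lemma moment_tail (delta m M4 : R) : (0 < n)%N -> 0 < M4 ->
  (forall i, P.-integrable setT (EFin \o (fun w => `|eps i w| `^ (2 + delta))) /\
    \int[P]_w (`|eps i w| `^ (2 + delta)) = m) ->
  (mu_ext P [set w | (n%:R * M4 < \sum_(i < n) `|eps (i.+1)%:Z w| `^ (2 + delta))%R] <=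
    (m / M4)%:E)%E.
Proof.
move=> n0 M0 em; have np : 0 < n%:R :> R by rewrite ltr0n.
pose W w := \sum_(i < n) `|eps (i.+1)%:Z w| `^ (2 + delta).
have iW : P.-integrable setT (EFin \o W).
  by apply: integrable_Rsum => i; have [] := em (i.+1)%:Z.
have W0 w : 0 <= W w by rewrite sumr_ge0// => i _; rewrite powR_ge0.
have tp : 0 < n%:R * M4 by rewrite mulr_gt0.
apply: (@mu_ext_le_measure _ _ _ _ _ [set w | n%:R * M4 <= W w]).
- by move=> w /= /ltW.
- have mWf : measurable_fun setT W by exact/measurable_EFinP/(measurable_int P).
  rewrite -[X in measurable X]setTI (_ : [set _ | _] = W @^-1` `[n%:R * M4, +oo[%classic).
    exact: mWf.
  by apply/seteqP; split=> w /=; rewrite in_itv/= andbT.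
- apply: le_trans (markov_Rintegral tp iW W0) _; rewrite lee_fin.
  rewrite Rintegral_sum; last by move=> i; have [] := em (i.+1)%:Z.
  rewrite (eq_bigr (fun=> m)); last by move=> i _; have [] := em (i.+1)%:Z.
  rewrite sumr_const card_ord -mulr_natl le_eqVlt; apply/orP; left; apply/eqP.
  by field; rewrite !gt_eqF.
Qed.

(** Chernoff's bound for every grid index and both signs, then a union bound. The tail is the same
    for all of them, as the compensator already carries the variance. *)
Lemma bernstein_tail (C kappa l x : R) (q : nat) (v : {ffun 'I_d -> 'I_q.+1} -> 'cV[R]_J) :
  0 <= kappa -> assumption1 X Y2 Y1 ->
  is_mds P (filtration X eps) (fun k => eps (k.+1)%:Z) C ->
  (forall j, measurable_fun setT (fun x => b K x j 0)) ->
  (forall x, unit_cube x -> enorm (bt x) <= kappa) ->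
  (mu_ext P [set w | exists gk : bool * {ffun 'I_d -> 'I_q.+1},
      (x < bernstein_sum X Y2 eps psi b n K C l (v gk.2) gk.1 w)%R] <=
    ((2 * q.+1 ^ d)%:R * expR (- x))%:E)%E.
Proof.
move=> k0 A1 mds mb bk.
pose phi (gk : bool * {ffun 'I_d -> 'I_q.+1}) x :=
  l * ((-1) ^+ gk.1 * dotv (weight X Y2 psi b K (v gk.2)) (bt x)).
pose f gk (i : nat) w := (\1_unit_cube (X (i.+1)%:Z w) : R) * phi gk (X (i.+1)%:Z w).
pose B (gk : bool * {ffun 'I_d -> 'I_q.+1}) := `|l| * (enorm (weight X Y2 psi b K (v gk.2)) * kappa).
have pf gk : predictable (filtration X eps) (f gk) (B gk).
  apply: (@predictable_comp _ _ _ _ _ X eps (phi gk)) => //.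
  - do 2 (apply: measurable_funM; first exact: measurable_cst).
    by apply: measurable_dotv => j; exact: measurable_mulmx_coord.
  - move=> y yc; rewrite !normrM normr_sign mul1r ler_wpM2l//.
    by rewrite (le_trans (dotv_le _ _))// ler_wpM2l ?enorm_ge0// bk.
  - by rewrite mulr_ge0// mulr_ge0// enorm_ge0.
pose U gk w := \sum_(i < n) (Order.min (f gk i w * eps (i.+1)%:Z w) 1 - 3 * C * f gk i w ^+ 2).
have mU gk : measurable_fun setT (U gk).
  apply: measurable_sum => i; have mf := sub_measurable_measurable (mds_sub mds i) (pred_measurable (pf gk) i).
  apply: measurable_funB; last by apply: measurable_funM => //; exact: measurable_funX.
  by apply: measurable_minr => //; exact: measurable_funM.
have PU gk : (mu_ext P [set w | (x <= U gk w)%R] <= (expR (- x))%:E)%E.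
  rewrite measurable_mu_extE; first exact: mds_exp_tail mds (pf gk).
  rewrite -[X in measurable X]setTI (_ : [set _ | _] = U gk @^-1` `[x, +oo[%classic).
    exact: mU.
  by apply/seteqP; split=> w /=; rewrite in_itv/= andbT.
have := mu_ext_bigcup (expR_ge0 (- x)) PU.
rewrite card_prod card_bool card_ffun !card_ord => PUs.
have sub : [set w | exists gk : bool * {ffun 'I_d -> 'I_q.+1},
      (x < bernstein_sum X Y2 eps psi b n K C l (v gk.2) gk.1 w)%R] `<=`
    [set w | exists gk, x <= U gk w] `|` [set w | outside_cube w].
  move=> w /= [gk xw]; have [wc|wc] := pselect (outside_cube w); [by right|left].
  exists gk; rewrite (le_trans (ltW xw))// le_eqVlt; apply/orP; left; apply/eqP.
  by apply: eq_bigr => i _; rewrite /f in_cube_indic// mul1r.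
apply: le_trans (le_mu_ext _ sub) _.
by rewrite -[X in X%:E]addr0; apply: mu_ext_setU; [exact: PUs|exact: outside_cube_null].
Qed.

End probability_bounds.

(** * Rates *)

Section rates.
Context {R : realType}.

Lemma powR_inv_base (x a : R) : 0 <= x -> x^-1 `^ a = (x `^ a)^-1.
Proof. by move=> x0; rewrite -powR_inv1// -powRrM mulN1r powRN. Qed.

(** The + 1 keeps the threshold (c + 1) / e positive when c = 0. *)
Lemma markov_constant (c e : R) : 0 <= c -> 0 < e -> c / ((c + 1) / e) <= e.
Proof.
move=> c0 e0; have c1 : 0 < c + 1 by rewrite ltr_wpDl.
rewrite (_ : c / _ = c / (c + 1) * e); last by field; rewrite !gt_eqF.
by rewrite ler_piMl ?(ltW e0)// ler_pdivrMr// mul1r lerDl.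
Qed.

(** The mesh 1 / n^kp must beat Hoelder constants growing like J^w: sqrt J J^w <= J^(1 + a) <= n^(2
    + 2 a) <= (n^kp)^al. *)
Lemma grid_error_le (n J a kp : nat) (w al : R) : (0 < n)%N -> (0 < J)%N ->
  (J <= n ^ 2)%N -> w <= a%:R -> (2 + 2 * a)%:R <= kp%:R * al ->
  Num.sqrt J%:R * J%:R `^ w * (n ^ kp)%:R^-1 `^ al <= 1.
Proof.
move=> n0 J0 Jn wa ka.
have J1 : 1 <= J%:R :> R by rewrite ler1n.
have n1 : 1 <= n%:R :> R by rewrite ler1n.
rewrite powR_inv_base ?ler0n// ler_pdivrMr ?powR_gt0 ?ltr0n ?expn_gt0 ?n0// mul1r.
apply: (@le_trans _ _ (J%:R * J%:R ^+ a)).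
  apply: ler_pM; rewrite ?sqrtr_ge0 ?powR_ge0//.
    rewrite -[leRHS]sqr_sqrtr ?ler0n// expr2 ler_peMl ?sqrtr_ge0//.
    by rewrite -[leLHS]sqrtr1 ler_wsqrtr.
  by rewrite -powR_mulrn ?ler0n// ler_powR.
rewrite natrX -[n%:R ^+ kp]powR_mulrn ?ler0n// -powRrM.
apply: (@le_trans _ _ (n%:R `^ (2 + 2 * a)%:R)); last by rewrite ler_powR.
rewrite powR_mulrn ?ler0n// -exprS -natrX -natrX ler_nat.
rewrite (_ : 2 + 2 * a = 2 * a.+1)%N ?expnM ?leq_exp2r//.
by rewrite mulnS.
Qed.

(** For N = n / ln n the square root is rho, and the left side is Kn^((2 + delta) / 2) N^(-delta /
    2): the growth condition raised to the power (2 + delta) / 2. *)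
Lemma growth_rate (N Kn C delta : R) : 0 < N -> 0 < Kn -> 0 < delta -> 0 < C ->
  Kn <= C * N `^ (delta / (2 + delta)) ->
  Kn * (Num.sqrt (Kn / N)) `^ delta <= C `^ ((2 + delta) / 2).
Proof.
move=> N0 K0 d0 C0 KN.
have d2 : 0 < 2 + delta by rewrite addr_gt0.
rewrite -powR12_sqrt; last by rewrite divr_ge0// ltW.
rewrite -powRrM powRM ?invr_ge0 ?(ltW K0) ?(ltW N0)// mulrA.
have -> : Kn * Kn `^ (2^-1 * delta) = Kn `^ ((2 + delta) / 2).
  rewrite -{1}[Kn]powRr1 ?(ltW K0)// -powRD; first by congr powR; field.
  by apply/implyP => _; rewrite gt_eqF.
apply: (@le_trans _ _ ((C * N `^ (delta / (2 + delta))) `^ ((2 + delta) / 2) *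
    N^-1 `^ (2^-1 * delta))).
  rewrite ler_wpM2r ?powR_ge0// ge0_ler_powR ?nnegrE ?(ltW K0)//.
    by rewrite divr_ge0// ltW.
  by rewrite mulr_ge0 ?powR_ge0// ltW.
rewrite powRM ?powR_ge0 ?(ltW C0)// -powRrM -mulrA powR_inv_base ?(ltW N0)//.
rewrite (_ : delta / (2 + delta) * ((2 + delta) / 2) = 2^-1 * delta); last first.
  by field; rewrite gt_eqF.
by rewrite mulfV ?mulr1// gt_eqF// powR_gt0.
Qed.

(** The exponential is n^-(kp d + 1), while the index set has at most 2^(d + 1) n^(kp d) elements;
    the extra 1 in the exponent leaves a factor 1 / n. *)
Lemma net_tail_le (n d kp : nat) (eta : R) : (0 < n)%N -> 0 < eta ->
  (2 ^ d.+1)%:R <= eta * n%:R ->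
  (2 * (n ^ kp).+1 ^ d)%:R * expR (- ((kp * d).+1%:R * ln n%:R)) <= eta :> R.
Proof.
move=> n0 e0 nb; have np : 0 < n%:R :> R by rewrite ltr0n.
rewrite expRN expRM_natl lnK ?posrE// ler_pdivrMr ?exprn_gt0//.
have h : (2 * (n ^ kp).+1 ^ d <= 2 ^ d.+1 * n ^ (kp * d))%N.
  rewrite expnS -mulnA leq_mul2l/= expnM -expnMn.
  case: d {nb} => [|d]; first by rewrite !expn0.
  by rewrite leq_exp2r// mul2n -addnn -addn1 leq_add2l expn_gt0 n0.
apply: (@le_trans _ _ ((2 ^ d.+1 * n ^ (kp * d))%:R)); first by rewrite ler_nat.
by rewrite natrM [X in _ * X]natrX exprS mulrA ler_wpM2r ?exprn_ge0 ?ler0n.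
Qed.

End rates.

Section sup_norm_bounds.
Context {R : realType} {d : nat}.
Implicit Types (f : d.-tuple R -> R).

Lemma unit_cube_origin : @unit_cube R d [tuple 0 | _ < d].
Proof. by move=> i; rewrite tnth_mktuple lexx ler01. Qed.

Lemma sup_norm_ub f x (M : R) : (sup_norm f <= M%:E)%E -> unit_cube x -> `|f x| <= M.
Proof.
move=> fM xc; rewrite -lee_fin; apply: le_trans fM.
by apply: ereal_sup_ubound; exists x.
Qed.

Lemma sup_norm_le f (M : R) : (forall x, unit_cube x -> `|f x| <= M) ->
  (sup_norm f <= M%:E)%E.
Proof. by move=> fM; apply: ge_ereal_sup => _ [x xc <-]; rewrite lee_fin fM. Qed.

Lemma sup_norm_ge0 f : (0 <= sup_norm f)%E.
Proof.
apply: (@le_trans _ _ (`|f [tuple 0 | _ < d]|%:E)); first by rewrite lee_fin.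
by apply: ereal_sup_ubound; exists [tuple 0 | _ < d] => //; exact: unit_cube_origin.
Qed.

Lemma sup_norm_fineK f (M : R) : (forall x, unit_cube x -> `|f x| <= M) ->
  (fine (sup_norm f))%:E = sup_norm f.
Proof.
move=> fM; rewrite fineK// ge0_fin_numE ?sup_norm_ge0//.
by rewrite (le_lt_trans (sup_norm_le fM))// ltry.
Qed.

(** [fine] sends +oo to 0, so g - h must be bounded; the norm of f - h may be infinite. *)
Lemma sup_norm_triangle (f g h : d.-tuple R -> R) (M : R) :
  (forall x, unit_cube x -> `|g x - h x| <= M) ->
  (sup_norm (f \- g)%R <= sup_norm (f \- h)%R + (fine (sup_norm (g \- h)%R))%:E)%E.
Proof.
move=> ghM; rewrite (sup_norm_fineK ghM).
apply: ge_ereal_sup => _ [x xc <-].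
apply: (@le_trans _ _ (`|(f \- h) x|%:E + `|(g \- h) x|%:E)%E).
  rewrite -EFinD lee_fin /= (_ : f x - g x = (f x - h x) - (g x - h x)) ?ler_normB//.
  by ring.
by apply: leeD; apply: ereal_sup_ubound; exists x.
Qed.

End sup_norm_bounds.

Section estimator_bounds.
Context {R : realType} {dT : measure_display} {T : measurableType dT}.
Context {P : probability T R} {d : nat}.
Context (X Y2 : int -> {RV P >-> d.-tuple R}) (Y1 eps : int -> {RV P >-> R}).
Context (h0 : d.-tuple R -> R) (psi b : forall m, d.-tuple R -> 'cV[R]_m).

Lemma holder_vector_bound J (g L : R) (f : d.-tuple R -> 'cV[R]_J) :
  (forall j, holder g L (fun y => f y j 0)) ->
  forall y, unit_cube y -> enorm (f y) <= Num.sqrt J%:R * L.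
Proof. by move=> fh y yc; apply: enorm_le_sum => j; exact: holder_bound (fh j) yc. Qed.

(** At fixed n and w each estimator is a fixed coefficient vector against a basis bounded on the
    cube. This covers every sample point, singular matrices included. *)
Lemma estimators_bounded (g : R) n J K w (L : R) :
  (forall j, holder g L (fun y => psi J y j 0)) ->
  exists M, forall y, unit_cube y ->
    `|h_hat X Y2 Y1 psi b n J K w y - Pn_h0 X Y2 h0 psi b n J K w y| <= M.
Proof.
move=> ph; have pb := holder_vector_bound ph.
have [c hc] : exists c, forall y, h_hat X Y2 Y1 psi b n J K w y = dotv (psi J y) c.
  rewrite /h_hat /dotv; eexists => y; rewrite -!mulmxA; reflexivity.
have [e he] : exists e, forall y, Pn_h0 X Y2 h0 psi b n J K w y = dotv (psi_tilde Y2 psi J y) e.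
  rewrite /Pn_h0 /dotv; eexists => y; rewrite -!mulmxA; reflexivity.
exists (Num.sqrt J%:R * L * enorm c +
  spectral_norm (mxinvsqrt (gram P (Y2 0) (psi J))) * (Num.sqrt J%:R * L) * enorm e) => y yc.
rewrite hc he (le_trans (ler_normB _ _))// lerD//.
  by rewrite (le_trans (dotv_le _ _))// ler_wpM2r ?enorm_ge0// pb.
rewrite (le_trans (dotv_le _ _))// ler_wpM2r ?enorm_ge0//.
by rewrite (le_trans (enorm_mulmx_le _ _))// ler_wpM2l ?spectral_norm_ge0// pb.
Qed.

Lemma basis_tilde_le m (A : 'M[R]_m) (f : d.-tuple R -> 'cV[R]_m) (a C : R) y :
  (forall x, enorm (mxinvsqrt A *m x) <= (Num.sqrt a)^-1 * enorm x) ->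
  (sup_norm (fun y => enorm (f y)) <= (C * Num.sqrt m%:R)%:E)%E -> unit_cube y ->
  enorm (mxinvsqrt A *m f y) <= (Num.sqrt a)^-1 * C * Num.sqrt m%:R.
Proof.
move=> Af fC yc; rewrite (le_trans (Af _))// -mulrA ler_wpM2l ?invr_ge0 ?sqrtr_ge0//.
by have := sup_norm_ub fC yc; rewrite ger0_norm ?enorm_ge0.
Qed.

Lemma basis_tilde_modulus J (A : 'M[R]_J) (f : d.-tuple R -> 'cV[R]_J) (a g L r : R) x y :
  (0 < d)%N -> 0 < r ->
  (forall x, enorm (mxinvsqrt A *m x) <= (Num.sqrt a)^-1 * enorm x) ->
  (forall j, holder g L (fun y => f y j 0)) -> unit_cube x -> unit_cube y ->
  (forall i, `|tnth x i - tnth y i| <= r) ->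
  enorm (mxinvsqrt A *m f x - mxinvsqrt A *m f y) <=
  (Num.sqrt a)^-1 * (Num.sqrt J%:R * (L * d%:R * r `^ Order.min g 1)).
Proof.
move=> d0 r0 Af fh xc yc xyr; rewrite -mulmxBr (le_trans (Af _))//.
rewrite ler_wpM2l ?invr_ge0 ?sqrtr_ge0//; apply: enorm_le_sum => j.
by rewrite !mxE; exact: holder_modulus (fh j) xc yc r0 xyr.
Qed.

Lemma whitening_facts lambda p gamma gamma_x H J K :
  is_sieve (Y2 0) psi H -> is_sieve (X 0) b (L2 (X 0)) ->
  assumption3 Y2 h0 psi p gamma lambda -> assumption4 X b p gamma gamma_x lambda ->
  (0 < J)%N -> (0 < K)%N -> 0 < sigma_JK X Y2 psi b J K ->
  let Pm := mxinvsqrt (gram P (Y2 0) (@psi J)) in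
  let Rm := mxinvsqrt (gram P (X 0) (@b K)) in
  [/\ sigma_JK X Y2 psi b J K <= 1, Pm^T = Pm /\ Rm^T = Rm,
      forall x, enorm (Pm *m x) <= (Num.sqrt lambda)^-1 * enorm x &
      forall x, enorm (Rm *m x) <= (Num.sqrt lambda)^-1 * enorm x].
Proof.
move=> [pL _] [bL _] A3 A4 J0 K0 s0 Pm Rm.
have sp : sq_integrable P (fun w => psi J (Y2 0 w)).
  split=> i; have [mp ip] := L2_sq_integrable (pL J i) => //.
  exact: (measurableT_comp mp (measurable_funPT (Y2 0))).
have sb : sq_integrable P (fun w => b K (X 0 w)).
  split=> i; have [mp ip] := L2_sq_integrable (bL K i) => //.
  exact: (measurableT_comp mp (measurable_funPT (X 0))).
have gp := a3_gram A3 J0; have gb := a4_gram A4 K0; have l0 := a3_lambda A3.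
have [P0 R0 s1] := @whitened_cross_moment _ _ _ P J K (fun w => psi J (Y2 0 w))
  (fun w => b K (X 0 w)) _ _ (S_mx X Y2 psi b J K) lambda
  (erefl (gram P (Y2 0) (@psi J))) (erefl (gram P (X 0) (@b K))) erefl J0 sp sb l0 gp gb s0.
have [Ps _ PL] := mxinvsqrt_whitening (expectation_outer_sym P (fun w => psi J (Y2 0 w))) l0 gp P0.
have [Rs _ RL] := mxinvsqrt_whitening (expectation_outer_sym P (fun w => b K (X 0 w))) l0 gb R0.
by split.
Qed.

End estimator_bounds.

(** * Choice of constants and assembly of the good event *)

Theorem theorem2p1
  (R : realType) (dT : measure_display) (T : measurableType dT)
  (P : probability T R) (d : nat) (d_gt0 : (0 < d)%N)
  (X Y2 : int -> {RV P >-> d.-tuple R}) (Y1 eps : int -> {RV P >-> R})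
  (H : set (d.-tuple R -> R)) (h0 : d.-tuple R -> R)
  (psi b : forall m : nat, d.-tuple R -> 'cV[R]_m)
  (p gamma gamma_x lambda delta : R)
  (model : npiv_model X Y2 Y1 eps H h0)
  (sieve_psi : is_sieve (Y2 0) psi H)
  (sieve_b : is_sieve (X 0) b (L2 (X 0)))
  (A1 : assumption1 X Y2 Y1)
  (A2 : assumption2 X eps delta)
  (A3 : assumption3 Y2 h0 psi p gamma lambda)
  (A4 : assumption4 X b p gamma gamma_x lambda)
  (J K : nat -> nat)
  (J_infty : J @ \oo --> \oo) (K_infty : K @ \oo --> \oo)
  (sigma := fun n : nat => sigma_JK X Y2 psi b (J n) (K n))
  (rate := fun n : nat =>
     (sigma n)^-1 * Num.sqrt ((K n)%:R * ln (n%:R : R) / n%:R))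
  (dev := fun (n : nat) (w : T) =>
     (sigma n)^-1 *
       (spectral_norm (G_hat X b n (K n) w - 1%:M) +
        spectral_norm (S_hat X Y2 psi b n (J n) (K n) w -
                       S_mx X Y2 psi b (J n) (K n))))
  (sigma_gt0 : \forall n \near \oo, 0 < sigma n)
  (J_le_K : \forall n \near \oo, (J n <= K n)%N)
  (K_growth : lesssim (fun n => (K n)%:R)
     (fun n => (n%:R / ln (n%:R : R)) `^ (delta / (2 + delta))))
  (rate_bounded : lesssim rate (fun=> 1))
  (dev_Op : is_Op P dev (fun n => Num.sqrt (ln (n%:R : R) / (K n)%:R)))
  (dev_op : is_op1 P dev) :
  exists2 rem : nat -> T -> R,
    is_Op P rem rate &
    forall n w,
      (sup_norm (h0 \- h_hat X Y2 Y1 psi b n (J n) (K n) w)%R <=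
       sup_norm (h0 \- Pn_h0 X Y2 h0 psi b n (J n) (K n) w)%R + (rem n w)%:E)%E.
Proof.
(* The remainder is the sup distance of the two estimators: its domination is the triangle
   inequality at every sample point, and the work goes into its order. *)
exists (fun n w => fine (sup_norm
  (h_hat X Y2 Y1 psi b n (J n) (K n) w \- Pn_h0 X Y2 h0 psi b n (J n) (K n) w)%R)); last first.
  move=> n w; have [L Lh _] := a3_holder A3.
  have [M hM] := estimators_bounded X Y2 Y1 h0 b n (K n) w (Lh (J n)).
  exact: sup_norm_triangle hM.
have l0 := a3_lambda A3; have d0 := a2_delta A2.
have [L Lh [om [CL CL0 Lom]]] := a3_holder A3.
have [Cp Cp0 psup] := a3_sup A3; have [Cb Cb0 bsup] := a4_sup A4.
have [C mds] := eps_mds A2; have C0 := mds_ge0 mds.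
have [m m0 em] := eps_moment A2.
have [Ck Ck0 Kle] := K_growth.
have sl0 : 0 < Num.sqrt lambda by rewrite sqrtr_gt0.
pose kappa := (Num.sqrt lambda)^-1 * (Cp + Cb).
have k0 : 0 < kappa by rewrite mulr_gt0 ?invr_gt0// addr_gt0.
have al0 : 0 < Order.min gamma 1.
  by rewrite lt_min ltr01 andbT (lt_trans (a3_p A3) (a3_gamma A3)).
pose a := (Num.truncn `|om|).+1.
have oma : om <= a%:R by rewrite (le_trans (ler_norm _))// ltW// truncnS_gt.
(* The grid has n^kp steps per axis, with kp just large enough for [grid_error_le]. *)
pose kp := (Num.truncn ((2 + 2 * a)%:R / Order.min gamma 1)).+1.
have kpa : (2 + 2 * a)%:R <= kp%:R * Order.min gamma 1.
  by rewrite -ler_pdivrMr// ltW// truncnS_gt.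
(* One more than the exponent kp d of the grid size, so that the union bound still decays like 1 /
   n. *)
pose A := (kp * d).+1%:R : R.
pose D := (Num.sqrt lambda)^-1 * (CL * d%:R).
have D0 : 0 <= D by rewrite mulr_ge0 ?invr_ge0 ?(ltW sl0)// mulr_ge0// ltW.
pose Cg := Ck `^ ((2 + delta) / 2).
(* Five bad events share eta; the sixth, an observation outside the cube, is null. *)
move=> eta eta0; pose eta5 := eta / 5.
have e50 : 0 < eta5 by rewrite divr_gt0.
have [M1 M10 dev1] := dev_Op _ e50.
(* 1/8 is the threshold of the perturbation bounds: the unscaled deviation must be at most sigma /
   8. *)
have dev2 : \forall n \near \oo, (mu_ext P [set w | (1 / 8 < `|dev n w|)%R] <= eta5%:E)%E.
  have e50' : (0 < eta5%:E)%E by rewrite lte_fin.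
  have e80 : 0 < 1 / 8 :> R by rewrite divr_gt0.
  have lt5 : \forall n \near \oo,
      (mu_ext P [set w | (1 / 8 < `|dev n w|)%R] < eta5%:E)%E.
    exact: dev_op _ e80 _ (open_ereal_lt' e50').
  by apply: filterS lt5 => n; exact: ltW.
pose M3 := Num.sqrt ((C * kappa ^+ 2 + 1) / eta5).
have Ckap0 : 0 <= C * kappa ^+ 2 by rewrite mulr_ge0// sqr_ge0.
have M30 : 0 < M3 by rewrite sqrtr_gt0 divr_gt0// ltr_wpDl.
have M3e : C * kappa ^+ 2 / M3 ^+ 2 <= eta5.
  rewrite /M3 [X in _ / X](_ : _ = (C * kappa ^+ 2 + 1) / eta5) ?markov_constant//.
  by apply: sqr_sqrtr; rewrite divr_ge0 ?(ltW e50)// addr_ge0.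
pose M4 := (m + 1) / eta5.
have M40 : 0 < M4 by rewrite divr_gt0// ltr_wpDl.
have M4e : m / M4 <= eta5 by exact: markov_constant.
pose M := A + 6 * C * kappa ^+ 2 + kappa ^+ 2 * (kappa ^+ 2) `^ (1 + delta) * Cg * M4 +
   D * M3 + 24 * kappa * M1 * M3.
have k2 : 0 <= kappa ^+ 2 by exact: sqr_ge0.
have Cg0 : 0 <= Cg by exact: powR_ge0.
have M0 : 0 <= M.
  rewrite !addr_ge0 ?ler0n//.
  - by rewrite -mulrA mulr_ge0.
  - by apply: mulr_ge0 (ltW M40); apply: mulr_ge0 Cg0; apply: mulr_ge0 k2 (powR_ge0 _ _).
  - by apply: mulr_ge0 D0 (ltW M30).
  - apply: mulr_ge0 (ltW M30); apply: mulr_ge0 (ltW M10).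
    by apply: mulr_ge0 (ltW k0); exact: ler0n.
(* [is_Op] asks for a positive constant, while M is only shown to be nonnegative. *)
exists (M + 1); first by rewrite ltr_wpDl.
have ge_e := @nbhs_infty_ger R (expR 1).
have ge_Ck := @nbhs_infty_ger R Ck.
have ge_net := @nbhs_infty_ger R (eta5^-1 * (2 ^ d.+1)%:R).
have Jpos : \forall n \near \oo, (0 < J n)%N by exact: J_infty (nbhs_infty_gt 0).
have Kpos : \forall n \near \oo, (0 < K n)%N by exact: K_infty (nbhs_infty_gt 0).
have psupJ := J_infty _ psup; have bsupK := K_infty _ bsup; have LomJ := J_infty _ Lom.
near=> n.
have n0 : (0 < n)%N by near: n; exact: nbhs_infty_gt.
have np : 0 < n%:R :> R by rewrite ltr0n.
have ln1 : 1 <= ln n%:R :> R.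
  have : expR 1 <= n%:R :> R by near: n.
  by rewrite -ler_ln ?posrE ?expR_gt0// expRK.
have J0 : (0 < J n)%N by near: n.
have K0 : (0 < K n)%N by near: n.
have JK : (J n <= K n)%N by near: n.
have s0 : 0 < sigma n by near: n.
have Kgr : (K n)%:R <= Ck * (n%:R / ln n%:R) `^ (delta / (2 + delta)) by near: n.
have Ckn : Ck <= n%:R by near: n.
have psupn : (sup_norm (fun y => enorm (psi (J n) y)) <= (Cp * Num.sqrt (J n)%:R)%:E)%E.
  by near: n.
have bsupn : (sup_norm (fun y => enorm (b (K n) y)) <= (Cb * Num.sqrt (K n)%:R)%:E)%E.
  by near: n.
have Ln : L (J n) <= CL * (J n)%:R `^ om by near: n.
have dev1n : (mu_ext P [set w | (M1 * Num.sqrt (ln n%:R / (K n)%:R) < `|dev n w|)%R]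
    <= eta5%:E)%E by near: n.
have dev2n : (mu_ext P [set w | (1 / 8 < `|dev n w|)%R] <= eta5%:E)%E by near: n.
have netn : (2 ^ d.+1)%:R <= eta5 * n%:R.
  by rewrite -ler_pdivrMl//; near: n.
have lnp : 0 < ln n%:R :> R by exact: lt_le_trans ln1.
have Kp : 0 < (K n)%:R :> R by rewrite ltr0n.
have [s1 [Ps Rs] PL RL] := whitening_facts sieve_psi sieve_b A3 A4 J0 K0 s0.
have sJK : Num.sqrt (J n)%:R <= Num.sqrt (K n)%:R :> R by rewrite ler_wsqrtr// ler_nat.
have bk x : unit_cube x -> enorm (b_tilde X b (K n) x) <= kappa * Num.sqrt (K n)%:R.
  move=> xc; apply: le_trans (basis_tilde_le RL bsupn xc) _.
  by rewrite ler_wpM2r ?sqrtr_ge0// ler_wpM2l ?invr_ge0 ?(ltW sl0)// lerDr ltW.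
have pk x : unit_cube x -> enorm (psi_tilde Y2 psi (J n) x) <= kappa * Num.sqrt (K n)%:R.
  move=> xc; apply: le_trans (basis_tilde_le PL psupn xc) _.
  apply: ler_pM; rewrite ?sqrtr_ge0//.
    by rewrite mulr_ge0 ?invr_ge0 ?(ltW sl0)// ltW.
  by rewrite ler_wpM2l ?invr_ge0 ?(ltW sl0)// lerDl ltW.
(* J <= K <= Ck n^(delta / (2 + delta)) <= n n, as eventually Ck <= n and 1 <= ln n. *)
have Jn2 : (J n <= n ^ 2)%N.
  rewrite (leq_trans JK)// -(ler_nat R) (le_trans Kgr)// natrX expr2.
  apply: ler_pM; rewrite ?powR_ge0 ?(ltW Ck0)//.
  have N0 : 0 <= n%:R / ln n%:R :> R by rewrite divr_ge0// ltW.
  have th0 : 0 <= delta / (2 + delta) by rewrite divr_ge0 ?addr_ge0 ?(ltW d0).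
  have th1 : delta / (2 + delta) <= 1.
    by rewrite ler_pdivrMr ?mul1r ?lerDr ?ltr_wpDl.
  apply: (@le_trans _ _ (n%:R `^ (delta / (2 + delta)))).
    rewrite ge0_ler_powR ?nnegrE// ler_pdivrMr// ler_peMr//.
  by rewrite -[leRHS]powRr1 ?ler0n// ler_powR// ler1n.
pose q := (n ^ kp)%N.
have q0 : (0 < q)%N by rewrite expn_gt0 n0.
have pD x z : unit_cube x -> unit_cube z ->
    (forall i, `|tnth x i - tnth z i| <= q%:R^-1) ->
    enorm (psi_tilde Y2 psi (J n) x - psi_tilde Y2 psi (J n) z) <= D.
  move=> xc zc xz; have qi : 0 < q%:R^-1 :> R by rewrite invr_gt0 ltr0n.
  apply: le_trans (basis_tilde_modulus d_gt0 qi PL (Lh (J n)) xc zc xz) _.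
  rewrite ler_wpM2l ?invr_ge0 ?(ltW sl0)//.
  apply: (@le_trans _ _ (CL * d%:R * (Num.sqrt (J n)%:R * (J n)%:R `^ om *
      q%:R^-1 `^ Order.min gamma 1))); last first.
    rewrite ler_piMr ?mulr_ge0 ?(ltW CL0)//.
    exact: (grid_error_le n0 J0 Jn2 oma kpa).
  rewrite (_ : CL * _ * _ = Num.sqrt (J n)%:R * (CL * (J n)%:R `^ om * d%:R *
      q%:R^-1 `^ Order.min gamma 1)); last by ring.
  rewrite ler_wpM2l ?sqrtr_ge0// ler_wpM2r ?powR_ge0// ler_wpM2r//.
have grow : (K n)%:R * Num.sqrt ((K n)%:R * ln n%:R / n%:R) `^ delta <= Cg.
  rewrite (_ : (K n)%:R * ln n%:R / n%:R = (K n)%:R / (n%:R / ln n%:R)); last first.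
    by field; rewrite !gt_eqF.
  by apply: growth_rate => //; rewrite divr_gt0.
have mb j : measurable_fun setT (fun x => b (K n) x j 0).
  by have [] := L2_sq_integrable (proj1 sieve_b (K n) j).
pose lam := sigma n * Num.sqrt ((K n)%:R * ln n%:R / n%:R) / (K n)%:R.
pose v (k : {ffun 'I_d -> 'I_q.+1}) := psi_tilde Y2 psi (J n) (grid k).
pose E1 := [set w | (M1 * Num.sqrt (ln n%:R / (K n)%:R) < `|dev n w|)%R].
pose E2 := [set w | (1 / 8 < `|dev n w|)%R].
pose E3 := [set w | (M3 ^+ 2 * (n%:R * (K n)%:R) < score_sqr X eps b n (K n) w)%R].
pose E4 := [set w | (n%:R * M4 < \sum_(i < n) `|eps (i.+1)%:Z w| `^ (2 + delta))%R].
pose E5 := [set w | exists gk : bool * {ffun 'I_d -> 'I_q.+1},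
  (A * ln n%:R < bernstein_sum X Y2 eps psi b n (K n) C lam (v gk.2) gk.1 w)%R].
pose E6 := [set w | outside_cube X n w].
have P3 : (mu_ext P E3 <= eta5%:E)%E.
  apply: le_trans (score_tail n0 K0 M30 k0 A1 mds mb bk) _.
  by rewrite lee_fin.
have P4 : (mu_ext P E4 <= eta5%:E)%E.
  by apply: le_trans (moment_tail n0 M40 em) _; rewrite lee_fin.
have P5 : (mu_ext P E5 <= eta5%:E)%E.
  have kK0 : 0 <= kappa * Num.sqrt (K n)%:R by rewrite mulr_ge0 ?(ltW k0) ?sqrtr_ge0.
  apply: le_trans (@bernstein_tail _ _ _ P d X Y2 Y1 eps psi b n (J n) (K n) C _ lam
    (A * ln n%:R) q v kK0 A1 mds mb bk) _.
  by rewrite lee_fin; exact: net_tail_le.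
have P6 := outside_cube_null n A1.
(* Off the six events [good_event_bound] holds at the same w for all y, so it passes to the
   supremum. *)
have sub : [set w | ((M + 1) * rate n < `|fine (sup_norm
  (h_hat X Y2 Y1 psi b n (J n) (K n) w \- Pn_h0 X Y2 h0 psi b n (J n) (K n) w)%R)|)%R]
    `<=` E1 `|` (E2 `|` (E3 `|` (E4 `|` (E5 `|` E6)))).
  move=> w; apply: contraPP => wE /=; apply/negP; rewrite -leNgt.
  have [[w1 w2 w3 w4 w5] w6] :
      [/\ ~ E1 w, ~ E2 w, ~ E3 w, ~ E4 w & ~ E5 w] /\ ~ E6 w.
    by split; [split|] => ?; apply: wE; rewrite /setU/=; tauto.
  have rho0 : 0 <= Num.sqrt ((K n)%:R * ln n%:R / n%:R) :> R by exact: sqrtr_ge0.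
  have bnd y : unit_cube y ->
      `|h_hat X Y2 Y1 psi b n (J n) (K n) w y - Pn_h0 X Y2 h0 psi b n (J n) (K n) w y| <=
      M * rate n.
    move=> yc.
    apply: (good_event_bound (q := q) n0 K0 q0 ln1 k0 d0 C0 (ltW M10) (ltW M30) (ltW M40) D0
      _ Ps Rs s0 s1 bk pk pD grow) => //.
    - by move=> i; exact: npiv_eq model i w.
    - by move=> i ni; apply: contrapT => nc; apply: w6; exists (Ordinal ni).
    - by apply: le_trans (ler_norm _) _; rewrite leNgt; exact/negP.
    - by apply: le_trans (ler_norm _) _; rewrite leNgt; exact/negP.
    - by rewrite leNgt; exact/negP.
    - by rewrite leNgt; exact/negP.
    - by move=> g k; rewrite leNgt; apply/negP => h; apply: w5; exists (g, k).
  rewrite ger0_norm ?fine_ge0 ?sup_norm_ge0//.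
  apply: (@le_trans _ _ (M * rate n)).
    by rewrite -lee_fin (sup_norm_fineK bnd); exact: sup_norm_le.
  by rewrite ler_wpM2r ?lerDl// /rate mulr_ge0// invr_ge0 ltW.
have -> : eta = eta5 + (eta5 + (eta5 + (eta5 + (eta5 + 0)))) by rewrite /eta5; field.
apply: le_trans (le_mu_ext _ sub) _.
by do 5 (apply: mu_ext_setU => //).
Unshelve. all: by end_near.
Qed.
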